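(* Let $(g,\nabla)$ be a statistical structure on $M$, and let $\tilde g$ be the Sasakian metric on $TM$ determined by $g$ and $\nabla$. At $\xi\in T_pM$, for all $X,Y,Z\in T_pM$ (all lifts taken at $\xi$), the curvature tensor $R^{\tilde g}$ of $\tilde g$ is given by: (1) $R^{\tilde g}(X^v,Y^v)Z^v=([K_Y,K_X]Z)^v+\{R_1(K(X,Z),\xi,Y)-R_1(K(Y,Z),\xi,X)\}^h$; (2) $R^{\tilde g}(X^v,Y^v)Z^h=\{K(R_1(Z,\xi,Y),X)-K(R_1(Z,\xi,X),Y)\}^v+\{R^g(X,Y)Z+R_1(R_1(Z,\xi,Y),\xi,X)-R_1(R_1(Z,\xi,X),\xi,Y)\}^h$; (3) $R^{\tilde g}(X^v,Y^h)Z^h=\{-\frac12R(Y,Z)X+[K_X,K_Y]Z+\nabla K(Y,X,Z)-\frac12R(Y,R_1(Z,\xi,X))\xi\}^v+\{-\frac12K(X,R(Y,Z)\xi)+R_1(K(Y,Z),\xi,X)+(\nabla_YR_1)(Z,\xi,X)-K(Y,R_1(Z,\xi,X))-R_1(Y,\xi,K(X,Z))\}^h$; (4) $R^{\tilde g}(X^v,Y^h)Z^v=\{K(R_1(Y,\xi,Z),X)+\frac12R(Y,K(X,Z))\xi\}^v+\{[K_Y,K_X]Z+R_1(R_1(Y,\xi,Z),\xi,X)-R_1(Y,X,Z)-\nabla K(Y,X,Z)\}^h$; (5) $R^{\tilde g}(X^h,Y^h)Z^h=(R^g(X,Y)Z)^h+\frac12\{R_1(X,\xi,R(Y,Z)\xi)-R_1(Y,\xi,R(X,Z)\xi)-2R_1(Z,\xi,R(X,Y)\xi)\}^h+\frac12\{(\nabla_ZR)(X,Y)\xi-R(Y,K(X,Z))\xi+R(X,K(Y,Z))\xi+K(X,R(Y,Z)\xi)-K(Y,R(X,Z)\xi)-2K(Z,R(X,Y)\xi)\}^v$;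 (6) $R^{\tilde g}(X^h,Y^h)Z^v=(R^g(X,Y)Z)^v+\frac12\{R(X,R_1(Y,\xi,Z))\xi-R(Y,R_1(X,\xi,Z))\xi\}^v+\{(\nabla_YR_1)(X,\xi,Z)-(\nabla_XR_1)(Y,\xi,Z)+K(X,R_1(Y,\xi,Z))-K(Y,R_1(X,\xi,Z))+K(R(X,Y)\xi,Z)+R_1(X,\xi,K(Y,Z))-R_1(Y,\xi,K(X,Z))\}^h$.
   Context: All objects are smooth. A statistical structure on a manifold $M$ is a pair $(g,\nabla)$, where $g$ is a (positive definite) Riemannian metric and $\nabla$ is a torsion-free affine connection such that $(\nabla_Xg)(Y,Z)=(\nabla_Yg)(X,Z)$ for all $X,Y,Z$. $\nabla^g$ is the Levi-Civita connection of $g$ and $R^g$ its curvature tensor; $K(X,Y)=K_XY=\nabla_XY-\nabla^g_XY$; $R$ is the curvature tensor of $\nabla$; all curvature tensors use the convention $R(X,Y)Z=\nabla_X\nabla_YZ-\nabla_Y\nabla_XZ-\nabla_{[X,Y]}Z$. Write $\nabla K(Y,X,Z)=(\nabla_YK)(X,Z)$. The $(1,3)$-tensor field $R_1$ is defined by $g(W,R_1(X,Y,Z))=\frac12g(R(W,X)Y,Z)$ for every $W$. Let $\pi:TM\to M$ be the tangent bundle. For $\xi,X\in T_pM$: the vertical lift $X^v_\xi\in T_\xi TM$ is the velocity at $t=0$ of the curve $t\mapsto \xi+tX$; the horizontal lift $X^h_\xi\in T_\xi TM$ is the velocity at $t=0$ of the curve $t\mapsto\xi_t$ obtained by $\nabla$-parallel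 transport of $\xi$ along the $\nabla$-geodesic with initial velocity $X$. One has $T_\xi TM=\{X^v_\xi\}\oplus\{X^h_\xi\}$. The Sasakian metric $\tilde g$ on $TM$ is given by $\tilde g(X^v,Y^v)=g(X,Y)=\tilde g(X^h,Y^h)$, $\tilde g(X^v,Y^h)=0$. *)

(* Defs.v *)
From mathcomp Require Import all_boot all_order all_algebra.
From mathcomp Require Import all_classical all_reals all_analysis.

Set Implicit Arguments.
Unset Strict Implicit.
Unset Printing Implicit Defensive.

Import Order.TTheory GRing.Theory Num.Theory.
Import numFieldNormedType.Exports.

Local Open Scope classical_set_scope.
Local Open Scope ring_scope.

Section Smooth.
Context {R : realType}.

(* Meant for finite-dimensional V and open U, where f is C^k.+1 on U iff it is
   differentiable on U and all its directional derivatives are C^k on U. *)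
Fixpoint Ck {V W : normedModType R} (k : nat) (U : set V) (f : V -> W) : Prop :=
  match k with
  | 0%N => forall x, U x -> {for x, continuous f}
  | k'.+1 => (forall x, U x -> differentiable f x) /\
             forall v, Ck k' U ('D_v f)
  end.

Definition smooth_on {V W : normedModType R} (U : set V) (f : V -> W) : Prop :=
  forall k, Ck k U f.

End Smooth.

(* The charts of a manifold of dimension n, as total functions that matter only
   on chart_dom and on its image.  chart_at selects one chart around each
   point. *)
Record atlas (R : realType) (n : nat) (M : Type) := Atlas {
  chart_index : Type;
  chart_dom : chart_index -> set M;
  chart_map : chart_index -> M -> 'rV[R]_n;
  chart_inv : chart_index -> 'rV[R]_n -> M;
  chart_at : M -> chart_index
}.

Record manifold (R : realType) (n : nat) (M : topologicalType)
    (A : atlas R n M) : Prop := Manifold {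
  manifold_hausdorff : hausdorff_space M;
  manifold_second_countable : @second_countable M;
  chart_at_dom : forall p, chart_dom (chart_at A p) p;
  chart_dom_open : forall c : chart_index A, open (chart_dom c);
  chart_image_open : forall c : chart_index A,
    open (chart_map c @` chart_dom c);
  chart_mapK : forall (c : chart_index A) p,
    chart_dom c p -> chart_inv c (chart_map c p) = p;
  chart_map_continuous : forall c : chart_index A,
    {within chart_dom c, continuous (chart_map c)};
  chart_inv_continuous : forall c : chart_index A,
    {within chart_map c @` chart_dom c, continuous (chart_inv c)};
  chart_transition_smooth : forall c c' : chart_index A,
    smooth_on (chart_map c @` (chart_dom c `&` chart_dom c'))
              (chart_map c' \o chart_inv c)
}.

Section Geometry.
Context {R : realType} {n : nat} {M : Type} (A : atlas R n M).

(* The tangent space at p is 'rV[R]_n for every p: a tangent vector at p is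
   given by its components in the selected chart chart_at A p. *)
Local Notation V := 'rV[R]_n.

(* components, in the chart c, of the tangent vector v at q *)
Definition to_chart (c : chart_index A) (q : M) (v : V) : V :=
  'D_v (chart_map c \o chart_inv (chart_at A q)) (chart_map (chart_at A q) q).

(* the tangent vector at q whose components in the chart c are u *)
Definition from_chart (c : chart_index A) (q : M) (u : V) : V :=
  'D_u (chart_map (chart_at A q) \o chart_inv c) (chart_map c q).

(* f is smooth on some neighbourhood of p *)
Definition smooth_near {W : normedModType R} (p : M) (f : M -> W) : Prop :=
  exists2 U : set V, open_nbhs (chart_map (chart_at A p) p) U
                   & smooth_on U (f \o chart_inv (chart_at A p)).

(* derivative of f at p along the tangent vector v *)
Definition dir {W : normedModType R} (f : M -> W) (p : M) (v : V) : W :=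
  'D_v (f \o chart_inv (chart_at A p)) (chart_map (chart_at A p) p).

Definition vfield := M -> V.

(* components of the field X in the chart selected at p *)
Definition local_rep (p : M) (X : vfield) : M -> V :=
  fun q => to_chart (chart_at A p) q (X q).

Definition smooth_vfield (p : M) (X : vfield) : Prop :=
  smooth_near p (local_rep p X).

(* [X, Y]^k = X^i d_i Y^k - Y^i d_i X^k *)
Definition bracket (X Y : vfield) : vfield :=
  fun p => dir (local_rep p Y) p (X p) - dir (local_rep p X) p (Y p).

(* local extension of the tangent vector v at p to a vector field: the field
   with constant components in the chart selected at p *)
Definition extend (p : M) (v : V) : vfield :=
  fun q => from_chart (chart_at A p) q v.

Definition metric_field := M -> V -> V -> R.

Record riemannian_metric (g : metric_field) : Prop := RiemannianMetric {
  metric_sym : forall p x y, g p x y = g p y x;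
  metric_linear : forall p a x y z, g p (a *: x + y) z = a * g p x z + g p y z;
  metric_pos : forall p x, x != 0 -> 0 < g p x x;
  metric_smooth : forall p X Y, smooth_vfield p X -> smooth_vfield p Y ->
    smooth_near p (fun q => g q (X q) (Y q))
}.

(* Affine connections are taken as operators on local sections: D X Y p is
   meaningful as soon as X and Y are smooth on a neighbourhood of p.  Locality
   is a consequence of the axioms: in the Leibniz rule, f may be the indicator
   function of a neighbourhood of p. *)
Definition connection := vfield -> vfield -> vfield.

Record affine_connection (D : connection) : Prop := AffineConnection {
  conn_addl : forall p X X' Y, smooth_vfield p X -> smooth_vfield p X' ->
    smooth_vfield p Y -> D (X \+ X') Y p = D X Y p + D X' Y p;
  conn_scalel : forall p (f : M -> R) X Y, smooth_near p f ->
    smooth_vfield p X -> smooth_vfield p Y ->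
    D (fun q => f q *: X q) Y p = f p *: D X Y p;
  conn_addr : forall p X Y Y', smooth_vfield p X -> smooth_vfield p Y ->
    smooth_vfield p Y' -> D X (Y \+ Y') p = D X Y p + D X Y' p;
  conn_leibniz : forall p (f : M -> R) X Y, smooth_near p f ->
    smooth_vfield p X -> smooth_vfield p Y ->
    D X (fun q => f q *: Y q) p = dir f p (X p) *: Y p + f p *: D X Y p;
  conn_smooth : forall p X Y, smooth_vfield p X -> smooth_vfield p Y ->
    smooth_vfield p (D X Y)
}.

Definition torsion_free (D : connection) : Prop :=
  forall p X Y, smooth_vfield p X -> smooth_vfield p Y ->
    D X Y p - D Y X p = bracket X Y p.

(* (D_X g)(Y, Z) at p *)
Definition cov_metric (D : connection) (g : metric_field) (X Y Z : vfield)
    (p : M) : R :=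
  dir (fun q => g q (Y q) (Z q)) p (X p)
  - g p (D X Y p) (Z p) - g p (Y p) (D X Z p).

Definition statistical_structure (g : metric_field) (D : connection) : Prop :=
  [/\ riemannian_metric g, affine_connection D, torsion_free D &
      forall p X Y Z,
        smooth_vfield p X -> smooth_vfield p Y -> smooth_vfield p Z ->
        cov_metric D g X Y Z p = cov_metric D g Y X Z p].

Definition levi_civita (g : metric_field) (D : connection) : Prop :=
  [/\ affine_connection D, torsion_free D &
      forall p X Y Z,
        smooth_vfield p X -> smooth_vfield p Y -> smooth_vfield p Z ->
        cov_metric D g X Y Z p = 0].

(* Tensor fields are evaluated on tangent vectors x, y, z at p through their
   local extensions. *)
Definition tensor2 := M -> V -> V -> V.
Definition tensor3 := M -> V -> V -> V -> V.

Definition curvature (D : connection) : tensor3 := fun p x y z =>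
  let X := extend p x in let Y := extend p y in let Z := extend p z in
  D X (D Y Z) p - D Y (D X Z) p - D (bracket X Y) Z p.

(* D - D', as a (1,2)-tensor field *)
Definition difference_tensor (D D' : connection) : tensor2 := fun p x y =>
  D (extend p x) (extend p y) p - D' (extend p x) (extend p y) p.

(* (D_w T)(x, y) *)
Definition cov_tensor2 (D : connection) (T : tensor2) (p : M) (w x y : V) : V :=
  let W := extend p w in let X := extend p x in let Y := extend p y in
  D W (fun q => T q (X q) (Y q)) p - T p (D W X p) y - T p x (D W Y p).

(* (D_w T)(x, y, z) *)
Definition cov_tensor3 (D : connection) (T : tensor3) (p : M) (w x y z : V) : V :=
  let W := extend p w in
  let X := extend p x in let Y := extend p y in let Z := extend p z in
  D W (fun q => T q (X q) (Y q) (Z q)) p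
  - T p (D W X p) y z - T p x (D W Y p) z - T p x y (D W Z p).

Definition is_R1 (g : metric_field) (D : connection) (R1 : tensor3) : Prop :=
  forall p w x y z,
    g p w (R1 p x y z) = 2^-1 * g p (curvature D p w x y) z.

Definition smooth_curve_near (gam : R -> M) (t : R) : Prop :=
  (\forall s \near t, chart_dom (chart_at A (gam t)) (gam s)) /\
  exists2 U : set R, open_nbhs t U
                   & smooth_on U (chart_map (chart_at A (gam t)) \o gam).

Definition velocity (gam : R -> M) (t : R) : V :=
  'D_1 (chart_map (chart_at A (gam t)) \o gam) t.

(* Covariant derivative at t of the field V along the curve gam; in a chart,
   DV/dt = (dV^k/dt) d_k + V^j D_(gam') d_j. *)
Definition cov_along (D : connection) (gam : R -> M) (v : R -> V) (t : R) : V :=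
  let p := gam t in
  'D_1 (fun s => to_chart (chart_at A p) (gam s) (v s)) t
  + D (extend p (velocity gam t)) (extend p (v t)) p.

End Geometry.

Section TangentBundle.
Context {R : realType} {n : nat} {M : Type} (A : atlas R n M).
Local Notation V := 'rV[R]_n.

(* TM as the set of pairs (p, v) with v a tangent vector at p, with the charts
   (p, v) |-> (x^i(p), v^i) induced by those of M.  The manifold structure of TM
   is the one given by this atlas. *)
Definition tangent_atlas : atlas R (n + n) (M * V) :=
  @Atlas R (n + n) (M * V) (chart_index A)
    (fun c => [set w | chart_dom c w.1])
    (fun c w => row_mx (chart_map c w.1) (to_chart c w.1 w.2))
    (fun c u => let q := chart_inv c (lsubmx u) in
                (q, from_chart c q (rsubmx u)))
    (fun w => chart_at A w.1).

Definition vlift (p : M) (xi X : V) : 'rV[R]_(n + n) :=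
  velocity tangent_atlas (fun t : R => (p, xi + t *: X)) 0.

(* H is the velocity at 0 of the D-parallel transport of xi along the
   D-geodesic with initial velocity X *)
Definition is_hlift (D : connection (n := n) (M := M)) (p : M) (xi X : V)
    (H : 'rV[R]_(n + n)) : Prop :=
  exists (gam : R -> M) (v : R -> V),
    [/\ smooth_curve_near tangent_atlas (fun t => (gam t, v t)) 0,
        [/\ gam 0 = p, velocity A gam 0 = X & v 0 = xi],
        \forall t \near (0 : R), cov_along A D gam (velocity A gam) t = 0,
        \forall t \near (0 : R), cov_along A D gam v t = 0 &
        H = velocity tangent_atlas (fun t => (gam t, v t)) 0].

Definition horizontal_lift (D : connection (n := n) (M := M))
    (hlift : M -> V -> V -> 'rV[R]_(n + n)) : Prop :=
  forall p xi X, is_hlift D p xi X (hlift p xi X).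

Definition sasakian_metric (g : metric_field)
    (hlift : M -> V -> V -> 'rV[R]_(n + n))
    (gt : metric_field (n := n + n) (M := M * V)) : Prop :=
  riemannian_metric tangent_atlas gt /\
  forall p xi X Y,
    [/\ gt (p, xi) (vlift p xi X) (vlift p xi Y) = g p X Y,
        gt (p, xi) (hlift p xi X) (hlift p xi Y) = g p X Y &
        gt (p, xi) (vlift p xi X) (hlift p xi Y) = 0].

End TangentBundle.

(* Main.v *)
From HB Require Import structures.
Require Import Defs.
From mathcomp Require Import all_boot all_order all_algebra.
From mathcomp Require Import all_classical all_reals all_analysis.
From mathcomp Require Import ring lra.


(** The idea. At every point of the tangent bundle the vertical and horizontal
    lifts give a moving frame: with C the Christoffel symbols of the connection
    in a chart, the vector with horizontal part a and vertical part a' at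
    (x, xi) has the components (a, a' - C x a xi). In this frame the Sasakian
    metric is G(a, b) + G(a', b'), the bracket of two frame fields with
    constant a, a', b, b' has the vertical part C x a b' - C x b a' - R(a, b) xi
    and no horizontal part, and the Koszul formula, with the Codazzi equation and
    the definition of R1, gives the Levi-Civita connection of the Sasakian
    metric:
      nabla of (b, b') along (a, a') is the frame vector with parts
        Cg(a, b) + K(a', b') - R1(b, xi, a') - R1(a, xi, b')   (horizontal)
        Cg(a, b') - K(a', b) - R(a, b) xi / 2                  (vertical).
    It is enough to check that this expression is metric and has the right
    torsion, because the Levi-Civita connection is unique (nabla_frame). Its
    curvature is then obtained by differentiating once more along the frame
    (frame_riem). The six formulas come out by multilinear algebra
    (riem_vvv to riem_hhv), with two geometric inputs: the second Bianchi
    identity in the formula for three horizontal lifts (riem_bianchi2), and,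
    for two vertical lifts and a horizontal one, the identity
      R1(Z, Y, X) - R1(Z, X, Y) = Rg(X, Y) Z + [K_X, K_Y] Z
    (R1_commutator), which rests on the pair symmetry of Rg and on the total
    symmetry of K and of its Levi-Civita covariant derivative.

    The tensor R1 is defined only through the metric, hence its smoothness is
    to be proved. It is read off from the horizontal part of the covariant
    derivative of a horizontal lift along a vertical one, a smooth field on
    the tangent bundle (R1_smooth).

    The computation takes place in an open subset of a coordinate space. The
    passage from operators on vector fields to Christoffel symbols in one
    fixed chart around the point is made once for every smooth atlas and
    serves both for the manifold and for its tangent bundle: fields, brackets,
    connections, metrics, curvature and covariant derivatives of tensors have
    the usual expressions in that chart at all nearby points, although the
    tangent space at a nearby point is described in another chart
    (bracketE, connE, metricE, curvatureE, cov_tensor3E). For the tangent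
    bundle the one new fact is the transformation law of the Christoffel
    symbols (christoffel_change), by which the horizontal lift has the
    components above in every chart (to_chart_hlift). *)

Set Implicit Arguments.
Unset Strict Implicit.
Unset Printing Implicit Defensive.

Import Order.TTheory GRing.Theory Num.Theory.
Import numFieldNormedType.Exports.

Local Open Scope classical_set_scope.
Local Open Scope ring_scope.

(** * Linear maps given as bare functions *)

Section Linear.
Context {R : realType} {V W : lmodType R} (f : V -> W) (fl : linear f).
Let fM := GRing.isLinear.Build _ _ _ _ _ fl.
Let fL : {linear V -> W} := HB.pack f fM.
Lemma lin0 : f 0 = 0. Proof. exact: (linear0 fL). Qed.
Lemma linD x y : f (x + y) = f x + f y. Proof. exact: (linearD fL). Qed.
Lemma linB x y : f (x - y) = f x - f y. Proof. exact: (linearB fL). Qed.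
Lemma linN x : f (- x) = - f x. Proof. exact: (linearN fL). Qed.
Lemma linZ a x : f (a *: x) = a *: f x. Proof. exact: (linearZ_LR fL). Qed.
Lemma lin_sum (I : Type) (r : seq I) (P : pred I) (E : I -> V) :
  f (\sum_(i <- r | P i) E i) = \sum_(i <- r | P i) f (E i).
Proof. exact: (linear_sum fL). Qed.
End Linear.

(** * Smooth maps between normed modules *)

Section Calculus.
Context {R : realType}.
Implicit Types V W : normedModType R.

Lemma open_near V (U : set V) x : open U -> U x -> \forall y \near x, U y.
Proof. by move=> Uo Ux; apply: open_nbhs_nbhs. Qed.

Lemma derive_linear V W (f : V -> W) x :
  differentiable f x -> linear (fun v => 'D_v f x).
Proof. by move=> df a u v; rewrite !deriveE // linearP. Qed.

Lemma derive_comp V V' W (g : V -> V') (f : V' -> W) x v :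
  differentiable g x -> differentiable f (g x) ->
  'D_v (f \o g) x = 'D_('D_v g x) f (g x).
Proof.
move=> dg df; rewrite !deriveE //; last exact: differentiable_comp.
by rewrite diff_comp.
Qed.

(** The error term of the two functions differs only away from x, so the same
    linear map serves as differential. *)
Lemma differentiable_near_eq V W (f g : V -> W) x :
  (\forall y \near x, f y = g y) -> differentiable f x -> differentiable g x.
Proof.
move=> fg df; have fx := nbhs_singleton fg.
have [dc dl] := (diff_locallyP _ _).1 df.
have E : g \o shift x = cst (g x) + 'd f x +o_ (0 : V) id.
  apply/eqaddoP => e e0.
  have H := (eqaddoP _ _ _ _).1 dl e e0.
  have fg0 : \forall h \near (0 : V), f (h + x) = g (h + x).
    by move: fg; rewrite (near_shift 0 x) subr0.
  near=> h.
  have -> : (g \o shift x - (cst (g x) + 'd f x)) h =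
     (f \o shift x - (cst (f x) + 'd f x)) h.
    by rewrite /= /cst !fctE /= -fx (near fg0 h).
  near: h; exact: H.
by apply/diff_locallyP; rewrite (diff_unique dc E).
Unshelve. all: by end_near. Qed.

Lemma continuous_near_eq V W (f g : V -> W) x :
  (\forall y \near x, f y = g y) -> {for x, continuous f} ->
  {for x, continuous g}.
Proof.
move=> fg fc; have fx : f x = g x := nbhs_singleton fg.
have {}fc : f @ x --> f x := fc.
have : g @ x --> g x by rewrite -fx; exact: cvg_trans (near_eq_cvg fg) fc.
by [].
Qed.

(** Scaling as a binary function, so that it can carry the structure of a
    continuous bilinear map and its differential be taken in both arguments. *)
Definition scaling W (a : R) (w : W) : W := a *: w.
Lemma scaling_bilinear W : bilinear_for
    (GRing.Scale.Law.clone _ _ *:%R _) (GRing.Scale.Law.clone _ _ *:%R _)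
    (@scaling W).
Proof.
split=> [u|u] a x y /=; rewrite /scaling.
  by rewrite scalerDl -!scalerA.
by rewrite scalerDr !scalerA mulrC.
Qed.
HB.instance Definition _ W :=
  bilinear_isBilinear.Build R R W W _ _ (@scaling W) (@scaling_bilinear W).

Lemma scaling_continuous W : continuous (fun q : R * W => scaling q.1 q.2).
Proof. exact: scale_continuous. Qed.

Lemma differentiable_scale V W (f : V -> R) (g : V -> W) x :
  differentiable f x -> differentiable g x ->
  differentiable (fun y => f y *: g y) x.
Proof.
move=> df dg.
exact: (differentiable_comp (differentiable_pair df dg)
         (differentiable_bilin _ (@scaling_continuous W))).
Qed.

Lemma derive_scale V W (f : V -> R) (g : V -> W) x v :
  differentiable f x -> differentiable g x ->
  'D_v (fun y => f y *: g y) x = 'D_v f x *: g x + f x *: 'D_v g x.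
Proof.
move=> df dg; rewrite !deriveE //; last exact: differentiable_scale.
have -> : (fun y => f y *: g y) =
   (fun q : R * W => scaling q.1 q.2) \o (fun y => (f y, g y)) by [].
rewrite diff_comp /=; [|exact: differentiable_pair|
  exact: (differentiable_bilin _ (@scaling_continuous W))].
by rewrite diff_pair // (diff_bilin _ (@scaling_continuous W)) /= addrC.
Qed.

Lemma derive_add V W (f g : V -> W) x v :
  differentiable f x -> differentiable g x ->
  'D_v (fun y => f y + g y) x = 'D_v f x + 'D_v g x.
Proof.
by move=> df dg; apply: (@deriveD _ _ _ f g); apply: diff_derivable.
Qed.

Lemma Ck_sub V W k (U U' : set V) (f : V -> W) :
  U' `<=` U -> Ck k U f -> Ck k U' f.
Proof.
elim: k f => [|k IH] f sU /=; first by move=> H x /sU/H.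
by case=> H1 H2; split=> [x /sU/H1//|v]; exact: IH (H2 v).
Qed.

Lemma Ck_eq V W k (U : set V) (f g : V -> W) : open U ->
  (forall x, U x -> f x = g x) -> Ck k U f -> Ck k U g.
Proof.
move=> Uo; elim: k f g => [|k IH] f g fg /=.
  move=> H x Ux; apply: continuous_near_eq (H x Ux).
  by apply: filterS (open_near Uo Ux) => y; apply: fg.
case=> H1 H2; split=> [x Ux|v].
  apply: differentiable_near_eq (H1 x Ux).
  by apply: filterS (open_near Uo Ux) => y; apply: fg.
apply: IH (H2 v) => x Ux; apply: near_eq_derive.
by apply: filterS (open_near Uo Ux) => y; apply: fg.
Qed.

Lemma CkW V W k (U : set V) (f : V -> W) : Ck k.+1 U f -> Ck k U f.
Proof.
elim: k f => [|k IH] f; case=> H1 H2.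
  by move=> x /H1/differentiable_continuous.
by split=> // v; apply: IH (H2 v).
Qed.

Lemma Ck_cst V W k (U : set V) (c : W) : Ck k U (cst c : V -> W).
Proof.
elim: k c => [|k IH] c /=; first by move=> x _; exact: cst_continuous.
split=> [x _|v]; first exact: differentiable_cst.
have -> : 'D_v (cst c : V -> W) = cst 0 by apply/funext => x; rewrite derive_cst.
exact: IH.
Qed.

Lemma Ck_diff V W k (U : set V) (f : V -> W) x :
  Ck k.+1 U f -> U x -> differentiable f x.
Proof. by case=> H _ /H. Qed.

Lemma Ck_add V W k (U : set V) (f g : V -> W) : open U ->
  Ck k U f -> Ck k U g -> Ck k U (fun x => f x + g x).
Proof.
move=> Uo; elim: k f g => [|k IH] f g /=.
  by move=> H H' x Ux; apply: continuousD; [exact: H|exact: H'].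
move=> [H1 H2] [H1' H2']; split=> [x Ux|v].
  by apply: differentiableD; [exact: H1|exact: H1'].
apply: Ck_eq (IH _ _ (H2 v) (H2' v)) => // x Ux.
by rewrite derive_add //; [exact: H1|exact: H1'].
Qed.

Lemma Ck_scale V W k (U : set V) (f : V -> R) (g : V -> W) : open U ->
  Ck k U f -> Ck k U g -> Ck k U (fun x => f x *: g x).
Proof.
move=> Uo; elim: k f g => [|k IH] f g Hf Hg.
  move=> x Ux; have := Hf x Ux; have := Hg x Ux; rewrite /continuous_at.
  by move=> ? ?; apply: cvgZ.
have [H1 H2] := Hf; have [H1' H2'] := Hg; split=> [x Ux|v].
  by apply: differentiable_scale; [exact: H1|exact: H1'].
apply: (@Ck_eq _ _ _ _ (fun x => 'D_v f x *: g x + f x *: 'D_v g x)) => //.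
  by move=> x Ux; rewrite derive_scale //; [exact: H1|exact: H1'].
apply: Ck_add => //; apply: IH.
- exact: H2.
- exact: CkW.
- exact: CkW.
- exact: H2'.
Qed.

Lemma Ck_sum V W k (U : set V) (I : Type) (r : seq I) (f : I -> V -> W) :
  open U -> (forall i, Ck k U (f i)) -> Ck k U (fun x => \sum_(i <- r) f i x).
Proof.
move=> Uo H; elim: r => [|i r IH].
  by apply: Ck_eq (Ck_cst k U 0) => // x _; rewrite big_nil.
by apply: Ck_eq (Ck_add Uo (H i) IH) => // x _; rewrite big_cons.
Qed.

Lemma Ck_linear V W k (U : set V) (f : V -> W) :
  linear f -> continuous f -> Ck k U f.
Proof.
move=> fl fc; pose fM := GRing.isLinear.Build _ _ _ _ _ fl.
pose fL : {linear V -> W} := HB.pack f fM.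
have fd x : differentiable f x by exact: (@linear_differentiable _ _ _ fL).
have fD v : 'D_v f = cst (f v).
  apply/funext => x; rewrite deriveE //.
  by rewrite (@diff_lin _ _ _ fL).
case: k => [|k] /=; first by move=> x _; apply: fc.
by split=> // v; rewrite fD; apply: Ck_cst.
Qed.

Lemma Ck_coord V n k (U : set V) (f : V -> 'rV[R]_n) i : open U ->
  Ck k U f -> Ck k U (fun x => f x 0 i).
Proof.
move=> Uo; elim: k f => [|k IH] f.
  move=> H x Ux.
  apply: (@continuous_comp _ _ _ f (fun u : 'rV[R]_n => u 0 i)).
    exact: H.
  exact: coord_continuous.
case=> H1 H2; split=> [x Ux|v].
  exact: (differentiable_comp (H1 x Ux) (differentiable_coord _ _ _)).
apply: Ck_eq (IH _ (H2 v)) => // x Ux.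
by rewrite derive_mx ?mxE //; apply: diff_derivable; apply: H1.
Qed.

(** Induction on k: a directional derivative of f after g is the sum of the
    partial derivatives of f after g, weighted by the components of the
    derivative of g. *)
Lemma Ck_comp V n W k (U : set V) (U' : set 'rV[R]_n) (g : V -> 'rV[R]_n)
    (f : 'rV[R]_n -> W) : open U -> (forall x, U x -> U' (g x)) ->
  Ck k U g -> Ck k U' f -> Ck k U (f \o g).
Proof.
move=> Uo UU'; elim: k f g UU' => [|k IH] f g UU' Hg Hf.
  move=> x Ux; apply: continuous_comp; [exact: Hg|exact: Hf (UU' x Ux)].
have [H1 H2] := Hg; have [H1' H2'] := Hf; split=> [x Ux|v].
  by apply: differentiable_comp; [exact: H1|exact: H1' (UU' x Ux)].
apply: (@Ck_eq _ _ _ _ (fun x => \sum_i ('D_v g x) 0 i *: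
     ('D_(delta_mx 0 i) f \o g) x)) => //.
  move=> x Ux; have df := H1' _ (UU' x Ux).
  rewrite (derive_comp v (H1 x Ux) df).
  transitivity ('D_(\sum_i ('D_v g x) 0 i *: delta_mx 0 i) f (g x)); last first.
    by rewrite -row_sum_delta.
  rewrite (lin_sum (derive_linear df)).
  by apply: eq_bigr => i _; rewrite (linZ (derive_linear df)).
apply: Ck_sum => // i; apply: Ck_scale => //.
  exact: Ck_coord (H2 v).
apply: IH => //; [exact: CkW|exact: H2'].
Qed.

Definition smooth_at V W (x : V) (f : V -> W) : Prop :=
  exists2 U : set V, open_nbhs x U & smooth_on U f.

Lemma smooth_at_on V W (U : set V) (f : V -> W) x :
  open U -> U x -> smooth_on U f -> smooth_at x f.
Proof. by move=> Uo Ux H; exists U. Qed.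

Lemma smooth_at_near V W x (f : V -> W) :
  smooth_at x f -> \forall y \near x, smooth_at y f.
Proof.
case=> U [Uo Ux] H; apply: filterS (open_near Uo Ux) => y Uy.
exact: smooth_at_on Uo Uy H.
Qed.

Lemma smooth_at_diff V W x (f : V -> W) : smooth_at x f -> differentiable f x.
Proof. by case=> U [Uo Ux] H; apply: Ck_diff (H 1%N) Ux. Qed.

Lemma smooth_at_diff_near V W x (f : V -> W) :
  smooth_at x f -> \forall y \near x, differentiable f y.
Proof. by move/smooth_at_near; apply: filterS => y; apply: smooth_at_diff. Qed.

Lemma smooth_at_derive V W x (f : V -> W) v :
  smooth_at x f -> smooth_at x ('D_v f).
Proof. by case=> U UU H; exists U => // k; case: (H k.+1) => _ /(_ v). Qed.

Lemma smooth_at_eq V W x (f g : V -> W) : (\forall y \near x, f y = g y) ->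
  smooth_at x f -> smooth_at x g.
Proof.
move=> /nbhs_interior; rewrite nbhsE => -[U' [Uo' Ux'] UU'] [U [Uo Ux] H].
exists (U `&` U'); first by split; [exact: openI|split].
move=> k; apply: (@Ck_eq _ _ _ _ f); first exact: openI.
  by move=> y [_ /UU'/interior_subset].
by apply: Ck_sub (H k) => y [].
Qed.

Lemma smooth_at_cst V W x (c : W) : smooth_at x (cst c : V -> W).
Proof. by exists setT; [split=> //; exact: openT|move=> k; exact: Ck_cst]. Qed.

Lemma smooth_at_linear V W x (f : V -> W) :
  linear f -> continuous f -> smooth_at x f.
Proof.
by move=> ? ?; exists setT; [split=> //; exact: openT|move=> k; exact: Ck_linear].
Qed.

Let openI2 V x (U U' : set V) :
  open_nbhs x U -> open_nbhs x U' -> open_nbhs x (U `&` U').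
Proof. by move=> [? ?] [? ?]; split; [exact: openI|]. Qed.

Lemma smooth_at_add V W x (f g : V -> W) :
  smooth_at x f -> smooth_at x g -> smooth_at x (fun y => f y + g y).
Proof.
move=> [U UU H] [U' UU' H']; have UI := openI2 UU UU'.
exists (U `&` U') => // k; apply: Ck_add; first by case: UI.
  by apply: Ck_sub (H k) => y [].
by apply: Ck_sub (H' k) => y [].
Qed.

Lemma smooth_at_scale V W x (f : V -> R) (g : V -> W) :
  smooth_at x f -> smooth_at x g -> smooth_at x (fun y => f y *: g y).
Proof.
move=> [U UU H] [U' UU' H']; have UI := openI2 UU UU'.
exists (U `&` U') => // k; apply: Ck_scale; first by case: UI.
  by apply: Ck_sub (H k) => y [].
by apply: Ck_sub (H' k) => y [].
Qed.

Lemma smooth_at_opp V W x (f : V -> W) :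
  smooth_at x f -> smooth_at x (fun y => - f y).
Proof.
move=> H; apply: (@smooth_at_eq _ _ _ (fun y => -1 *: f y)).
  by apply: filterE => y /=; rewrite scaleN1r.
by apply: (@smooth_at_scale _ _ _ (cst (-1))) => //; exact: smooth_at_cst.
Qed.

Lemma smooth_at_sub V W x (f g : V -> W) :
  smooth_at x f -> smooth_at x g -> smooth_at x (fun y => f y - g y).
Proof. by move=> ? ?; apply: smooth_at_add => //; apply: smooth_at_opp. Qed.

Lemma smooth_at_sum V W x (I : Type) (r : seq I) (f : I -> V -> W) :
  (forall i, smooth_at x (f i)) -> smooth_at x (fun y => \sum_(i <- r) f i y).
Proof.
move=> H; elim: r => [|i r IH].
  apply: (@smooth_at_eq _ _ _ (cst 0)); last exact: smooth_at_cst.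
  by apply: filterE => y; rewrite big_nil.
apply: (@smooth_at_eq _ _ _ (fun y => f i y + \sum_(i <- r) f i y)).
  by apply: filterE => y; rewrite big_cons.
exact: smooth_at_add.
Qed.

Lemma smooth_at_coord V n x (f : V -> 'rV[R]_n) i :
  smooth_at x f -> smooth_at x (fun y => f y 0 i).
Proof. by move=> [U [Uo Ux] H]; exists U => // k; apply: Ck_coord. Qed.

Lemma smooth_at_comp V n W x (g : V -> 'rV[R]_n) (f : 'rV[R]_n -> W) :
  smooth_at x g -> smooth_at (g x) f -> smooth_at x (f \o g).
Proof.
move=> [U [Uo Ux] Hg] [U' [Uo' Ux'] Hf].
have gc : {for x, continuous g} := Hg 0%N x Ux.
have /nbhs_interior : \forall y \near x, U' (g y).
  have U'x : nbhs (g x) U' by apply: open_nbhs_nbhs.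
  exact: gc U'x.
rewrite nbhsE => -[U'' [Uo'' Ux''] UU''].
exists (U `&` U''); first by split; [exact: openI|].
move=> k; apply: (@Ck_comp _ _ _ _ _ U'); first exact: openI.
- by move=> y [_ /UU''/interior_subset].
- by apply: Ck_sub (Hg k) => y [].
- exact: Hf.
Qed.

(** Expanding Y in the standard basis writes y |-> L y (Y y) near x as a finite
    sum of products; linearity is only available near x. *)
Lemma smooth_family V n W x (L : V -> 'rV[R]_n -> W) (Y : V -> 'rV[R]_n) :
  (\forall y \near x, linear (L y)) -> (forall v, smooth_at x (L ^~ v)) ->
  smooth_at x Y -> smooth_at x (fun y => L y (Y y)).
Proof.
move=> Ll Ls Ys.
apply: (@smooth_at_eq _ _ _ (fun y => \sum_i Y y 0 i *: L y (delta_mx 0 i))).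
  apply: filterS Ll => y Ll.
  rewrite [in RHS](row_sum_delta (Y y)) (lin_sum Ll).
  by apply: eq_bigr => i _; rewrite (linZ Ll).
apply: smooth_at_sum => i; apply: smooth_at_scale => //.
exact: smooth_at_coord.
Qed.

Lemma derive_sum_fun V W x (I : Type) (r : seq I) (f : I -> V -> W) v :
  (forall i, differentiable (f i) x) ->
  'D_v (fun y => \sum_(i <- r) f i y) x = \sum_(i <- r) 'D_v (f i) x.
Proof.
move=> H; suff [] : differentiable (fun y => \sum_(i <- r) f i y) x /\
  'D_v (fun y => \sum_(i <- r) f i y) x = \sum_(i <- r) 'D_v (f i) x by [].
elim: r => [|i r [IH1 IH2]].
  have -> : (fun y => \sum_(i <- [::]) f i y) = cst 0.
    by apply/funext => y; rewrite big_nil.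
  by rewrite big_nil derive_cst; split=> //; exact: differentiable_cst.
have -> : (fun y => \sum_(j <- i :: r) f j y) =
          (fun y => f i y + \sum_(j <- r) f j y).
  by apply/funext => y; rewrite big_cons.
rewrite big_cons derive_add // IH2; split=> //.
by apply: (@differentiableD _ _ _ (f i)).
Qed.

(** The product rule for evaluation of a family of linear maps, by the same
    expansion in the standard basis. *)
Lemma derive_family V n W x (L : V -> 'rV[R]_n -> W) (Y : V -> 'rV[R]_n) v :
  (\forall y \near x, linear (L y)) -> (forall u, differentiable (L ^~ u) x) ->
  differentiable Y x ->
  'D_v (fun y => L y (Y y)) x = 'D_v (L ^~ (Y x)) x + L x ('D_v Y x).
Proof.
move=> Ll Ls Ys; have Lx := nbhs_singleton Ll.
have cd i : differentiable (fun y => Y y 0 i) x.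
  exact: (differentiable_comp Ys (differentiable_coord _ _ _)).
rewrite (@near_eq_derive _ _ _ _
   (fun y => \sum_i Y y 0 i *: L y (delta_mx 0 i))); last first.
  apply: filterS Ll => y Ll.
  rewrite [in LHS](row_sum_delta (Y y)) (lin_sum Ll).
  by apply: eq_bigr => i _; rewrite (linZ Ll).
have cx i : differentiable (cst (Y x 0 i) : V -> R) x.
  exact: differentiable_cst.
rewrite derive_sum_fun; last by move=> i; exact: differentiable_scale.
under eq_bigr do rewrite derive_scale //.
rewrite big_split /= addrC; congr (_ + _); last first.
  rewrite [in RHS](row_sum_delta ('D_v Y x)) (lin_sum Lx).
  apply: eq_bigr => i _; rewrite (linZ Lx) derive_mx ?mxE //.
  exact: diff_derivable.
rewrite (@near_eq_derive _ _ _ (L ^~ (Y x))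
   (fun y => \sum_i Y x 0 i *: L y (delta_mx 0 i))); last first.
  apply: filterS Ll => y Ll.
  rewrite [in LHS](row_sum_delta (Y x)) (lin_sum Ll).
  by apply: eq_bigr => i _; rewrite (linZ Ll).
rewrite derive_sum_fun; last first.
  by move=> i; exact: differentiable_scale (cx i) (Ls _).
apply: eq_bigr => i _; rewrite (derive_scale _ (cx i) (Ls _)).
by rewrite derive_cst scale0r add0r.
Qed.

End Calculus.

(** * Symmetry of second derivatives *)

Section Schwarz.
Context {R : realType}.
Implicit Types V W : normedModType R.

Lemma is_derive_line V W (f : V -> W) (c u : V) (s : R) :
  differentiable f (c + s *: u) ->
  is_derive s 1 (fun t : R => f (c + t *: u)) ('D_u f (c + s *: u)).
Proof.
move=> df; pose g (t : R) : V := c + t *: u.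
have ds : is_diff s ( *:%R ^~ u) ( *:%R ^~ u) by exact: is_diff_scalel.
have dl : differentiable ( *:%R ^~ u : R -> V) s by exact: ex_diff.
have dg' : differentiable g s.
  have -> : g = cst c + ( *:%R ^~ u) by [].
  by apply: differentiableD.
have gD : 'D_1 g s = u.
  have -> : g = cst c + ( *:%R ^~ u) by [].
  rewrite deriveD; [|exact: diff_derivable|exact: diff_derivable].
  rewrite derive_cst add0r.
  by rewrite deriveE // diff_val scale1r.
have E : (fun t : R => f (c + t *: u)) = f \o g by [].
rewrite E; apply: DeriveDef.
  exact/derivable1_diffP/differentiable_comp.
by rewrite derive_comp // gD.
Qed.

Lemma MVT_line V (f : V -> R) (c u : V) (h : R) : 0 < h ->
  (forall s, 0 <= s <= h -> differentiable f (c + s *: u)) ->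
  exists2 s, 0 < s < h & f (c + h *: u) - f c = h * 'D_u f (c + s *: u).
Proof.
move=> h0 df; pose g (t : R) := f (c + t *: u).
have gd s : 0 <= s <= h -> is_derive s 1 g ('D_u f (c + s *: u)).
  by move=> sh; apply: is_derive_line; apply: df.
have D0 s : s \in `]0, h[ -> is_derive s 1 g ('D_u f (c + s *: u)).
  by rewrite in_itv /= => /andP[s0 sh]; apply: gd; rewrite !ltW.
have C0 : {within `[0, h], continuous g}.
  apply: derivable_within_continuous => s; rewrite in_itv /= => sh.
  by case: (gd s sh).
have [s] := MVT h0 D0 C0; rewrite in_itv /= => sh E; exists s => //.
by move: E; rewrite /g scale0r addr0 subr0 mulrC.
Qed.

Lemma near_plane V (x u v : V) (P : set V) : nbhs x P ->
  exists2 d : R, 0 < d &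
    forall s t, 0 <= s < d -> 0 <= t < d -> P (x + s *: u + t *: v).
Proof.
move=> /nbhs_ballP [e /= e0 He]; pose M := `|u| + `|v| + 1.
have M0 : 0 < M by rewrite ltr_wpDl // addr_ge0.
exists (e / M); first exact: divr_gt0.
move=> s t /andP[s0 sd] /andP[t0 td]; apply: He.
rewrite -ball_normE /= -addrA opprD addrA subrr add0r normrN.
apply: le_lt_trans (ler_normD _ _) _; rewrite !normrZ !ger0_norm //.
apply: (@le_lt_trans _ _ ((e / M) * (`|u| + `|v|))).
  by rewrite mulrDr; apply: lerD; apply: ler_wpM2r => //; apply: ltW.
rewrite -mulrA gtr_pMr // mulrC ltr_pdivrMr // mul1r /M.
by rewrite ltrDl.
Qed.

(** Two applications of the mean value theorem: first to the increment of f by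
    h v, along u, then to the derivative of f along u, along v. *)
Lemma second_difference V (U : set V) (f : V -> R) (x u v : V) (h : R) :
  Ck 2 U f -> 0 < h ->
  (forall s t, 0 <= s <= h -> 0 <= t <= h -> U (x + s *: u + t *: v)) ->
  exists s t, [/\ 0 < s < h, 0 < t < h &
    f (x + h *: u + h *: v) - f (x + h *: u) - f (x + h *: v) + f x =
    h * (h * 'D_v ('D_u f) (x + s *: u + t *: v))].
Proof.
move=> [df /(_ u)[dDf _]] h0 HU.
have h00 : (0 : R) <= 0 <= h by rewrite lexx ltW.
have hh : 0 <= h <= h by rewrite lexx ltW.
pose g (y : V) := f (y + h *: v) - f y.
have dsh y : differentiable (fun y : V => y + h *: v) y.
  exact: differentiableD.
have dfh s : 0 <= s <= h -> differentiable (fun y => f (y + h *: v)) (x + s *: u).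
  move=> sh; apply: (@differentiable_comp _ _ _ _ (fun y : V => y + h *: v)) => //.
  by apply: df; apply: HU.
have dfs s : 0 <= s <= h -> differentiable f (x + s *: u).
  by move=> sh; apply: df; have := HU s 0 sh h00; rewrite scale0r addr0.
have dg s : 0 <= s <= h -> differentiable g (x + s *: u).
  by move=> sh; apply: differentiableB; [exact: dfh|exact: dfs].
have [s sh E] := MVT_line h0 dg.
have sh' : 0 <= s <= h by case/andP: sh => /ltW-> /ltW->.
have dD t : 0 <= t <= h -> differentiable ('D_u f) (x + s *: u + t *: v).
  by move=> th; apply: dDf; apply: HU.
have [t th E'] := MVT_line h0 dD.
exists s, t; split=> //; rewrite -E'.
transitivity (g (x + h *: u) - g x); first by rewrite /g; lra.
rewrite E; congr (h * _).
have -> : 'D_u g (x + s *: u) =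
  'D_u (fun y => f (y + h *: v)) (x + s *: u) - 'D_u f (x + s *: u).
  apply: (@deriveB _ _ _ (fun y => f (y + h *: v)) f).
    by apply: diff_derivable; apply: dfh.
  by apply: diff_derivable; apply: dfs.
congr (_ - _).
have -> : (fun y => f (y + h *: v)) = f \o (fun y => y + h *: v) by [].
rewrite derive_comp //; last by apply: df; apply: HU.
by rewrite derive_add //= derive_id derive_cst addr0.
Qed.

(** The second difference of f over a small parallelogram is h^2 times either
    mixed derivative at some point close to x; continuity of both at x
    concludes. *)
Lemma schwarz_scalar V (f : V -> R) (x u v : V) :
  smooth_at x f -> 'D_u ('D_v f) x = 'D_v ('D_u f) x.
Proof.
move=> fs; have [U [Uo Ux] H] := fs.
have B (h d a : R) : h < d -> 0 < a < h -> 0 <= a < d.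
  by move=> hd /andP[a0 ah]; rewrite ltW //= (lt_trans ah).
apply/eqP; rewrite -subr_eq0 -normr_le0; apply/ler_addgt0Pl => e e0.
rewrite addr0; have e2 : 0 < e / 2 by rewrite divr_gt0.
have c1 : {for x, continuous ('D_u ('D_v f))}.
  by case: (H 2%N) => _ /(_ v)[_ /(_ u)]; apply.
have c2 : {for x, continuous ('D_v ('D_u f))}.
  by case: (H 2%N) => _ /(_ u)[_ /(_ v)]; apply.
have n1 : \forall t \near x, `|'D_u ('D_v f) x - 'D_u ('D_v f) t| < e / 2.
  by move/cvgrPdist_lt : c1; apply.
have n2 : \forall t \near x, `|'D_v ('D_u f) x - 'D_v ('D_u f) t| < e / 2.
  by move/cvgrPdist_lt : c2; apply.
have n3 := open_near Uo Ux.
have [d1 d10 H1] := near_plane u v (filterI n2 n3).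
have [d2 d20 H2] := near_plane v u (filterI n1 n3).
(* any h below both radii *)
pose h := (Num.min d1 d2) / 2.
have m0 : 0 < Num.min d1 d2 by rewrite lt_min d10.
have h0 : 0 < h by rewrite divr_gt0.
have hm : h < Num.min d1 d2 by rewrite /h; lra.
have hd1 : h < d1 by apply: lt_le_trans hm _; rewrite ge_min lexx.
have hd2 : h < d2 by apply: lt_le_trans hm _; rewrite ge_min lexx orbT.
have [s [t [sh th E]]] : exists s t, [/\ 0 < s < h, 0 < t < h &
    f (x + h *: u + h *: v) - f (x + h *: u) - f (x + h *: v) + f x =
    h * (h * 'D_v ('D_u f) (x + s *: u + t *: v))].
  apply: second_difference (H 2%N) h0 _ => s t /andP[s0 sh] /andP[t0 th].
  by apply: (H1 s t _ _).2; rewrite ?s0 ?t0 (le_lt_trans _ hd1).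
have [t' [s' [th' sh' E']]] : exists s t, [/\ 0 < s < h, 0 < t < h &
    f (x + h *: v + h *: u) - f (x + h *: v) - f (x + h *: u) + f x =
    h * (h * 'D_u ('D_v f) (x + s *: v + t *: u))].
  apply: second_difference (H 2%N) h0 _ => s' t' /andP[s0 sh'] /andP[t0 th'].
  by apply: (H2 s' t' _ _).2; rewrite ?s0 ?t0 (le_lt_trans _ hd2).
have EE : 'D_v ('D_u f) (x + s *: u + t *: v) =
          'D_u ('D_v f) (x + t' *: v + s' *: u).
  apply: (mulfI (lt0r_neq0 h0)); apply: (mulfI (lt0r_neq0 h0)).
  transitivity (f (x + h *: u + h *: v) - f (x + h *: u) - f (x + h *: v) + f x).
    by symmetry; exact: E.
  transitivity (f (x + h *: v + h *: u) - f (x + h *: v) - f (x + h *: u) + f x).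
    rewrite (addrAC x (h *: v) (h *: u)). congr (_ + _). exact: addrAC.
  exact: E'.
have [A1 _] := H1 s t (B _ _ _ hd1 sh) (B _ _ _ hd1 th).
have [A2 _] := H2 t' s' (B _ _ _ hd2 th') (B _ _ _ hd2 sh').
rewrite /= in A1 A2; rewrite EE in A1.
rewrite -(subrKA ('D_u ('D_v f) (x + t' *: v + s' *: u))).
apply: le_trans (ler_normD _ _) _; rewrite [leRHS](splitr e); apply: lerD.
  exact: (ltW A2).
rewrite distrC; exact: (ltW A1).
Qed.

Lemma schwarz V m (f : V -> 'rV[R]_m) (x u v : V) :
  smooth_at x f -> 'D_u ('D_v f) x = 'D_v ('D_u f) x.
Proof.
move=> fs.
have aux a b i : ('D_a ('D_b f) x) 0 i = 'D_a ('D_b (fun y => f y 0 i)) x.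
  have sD := smooth_at_derive b fs.
  rewrite derive_mx ?mxE; last exact/diff_derivable/smooth_at_diff.
  apply: near_eq_derive; apply: filterS (smooth_at_diff_near fs) => y dy.
  by rewrite derive_mx ?mxE //; exact: diff_derivable.
apply/rowP => i; apply: etrans (aux u v i) _.
apply: etrans _ (esym (aux v u i)).
exact: schwarz_scalar (smooth_at_coord i fs).
Qed.
End Schwarz.

(** * The directional derivative as a sealed constant *)

(** Directional derivatives are limits, and comparing two of them by unfolding
    is prohibitively expensive for unification: everything below works with
    this opaque copy. *)
HB.lock Definition pd {R : realType} {V W : normedModType R}
  (v : V) (f : V -> W) (x : V) : W := 'D_v f x.

Section PD.
Context {R : realType}.
Implicit Types V W : normedModType R.

Lemma pdE V W (f : V -> W) v x : 'D_v f x = pd v f x.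
Proof. by rewrite pd.unlock. Qed.

Lemma pd_near V W (f g : V -> W) v x :
  (\forall y \near x, f y = g y) -> pd v f x = pd v g x.
Proof. by move=> fg; rewrite -!pdE; apply: near_eq_derive. Qed.

Lemma pd_lin V W (f : V -> W) x :
  smooth_at x f -> linear (fun v => pd v f x).
Proof.
by move=> fs a u v; rewrite -!pdE; apply: derive_linear; apply: smooth_at_diff.
Qed.

Lemma pd_smooth V W (f : V -> W) v x :
  smooth_at x f -> smooth_at x (pd v f).
Proof.
move=> /(smooth_at_derive v); apply: smooth_at_eq.
by apply: filterE => y; rewrite pdE.
Qed.

Lemma pd_cst V W (c : W) (v x : V) : pd v (cst c) x = 0.
Proof. by rewrite -pdE derive_cst. Qed.

Lemma pd_add V W (f g : V -> W) v x : smooth_at x f -> smooth_at x g ->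
  pd v (fun y => f y + g y) x = pd v f x + pd v g x.
Proof.
by move=> fs gs; rewrite -!pdE; apply: derive_add; apply: smooth_at_diff.
Qed.

Lemma pd_linear V W (f : V -> W) v x :
  linear f -> continuous f -> pd v f x = f v.
Proof.
move=> fl fc; pose fM := GRing.isLinear.Build _ _ _ _ _ fl.
pose fL : {linear V -> W} := HB.pack f fM.
have fd : differentiable f x by exact: (@linear_differentiable _ _ _ fL).
by rewrite -pdE deriveE // (@diff_lin _ _ _ fL).
Qed.

Lemma pd_comp V n W (g : V -> 'rV[R]_n) (f : 'rV[R]_n -> W) v x :
  smooth_at x g -> smooth_at (g x) f -> pd v (f \o g) x = pd (pd v g x) f (g x).
Proof.
by move=> gs fs; rewrite -!pdE; apply: derive_comp; apply: smooth_at_diff.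
Qed.

Lemma pd_scale V W (f : V -> R) (g : V -> W) v x :
  smooth_at x f -> smooth_at x g ->
  pd v (fun y => f y *: g y) x = pd v f x *: g x + f x *: pd v g x.
Proof.
by move=> fs gs; rewrite -!pdE; apply: derive_scale; apply: smooth_at_diff.
Qed.

Lemma pd_opp V W (f : V -> W) v x : smooth_at x f ->
  pd v (fun y => - f y) x = - pd v f x.
Proof.
by move=> fs; rewrite -!pdE; apply: deriveN; apply/diff_derivable/smooth_at_diff.
Qed.

Lemma pd_sub V W (f g : V -> W) v x : smooth_at x f -> smooth_at x g ->
  pd v (fun y => f y - g y) x = pd v f x - pd v g x.
Proof.
by move=> fs gs; rewrite pd_add ?pd_opp //; exact: smooth_at_opp.
Qed.

Lemma pd_family V n W x (L : V -> 'rV[R]_n -> W) (Y : V -> 'rV[R]_n) v :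
  (\forall y \near x, linear (L y)) -> (forall u, smooth_at x (L ^~ u)) ->
  smooth_at x Y ->
  pd v (fun y => L y (Y y)) x = pd v (L ^~ (Y x)) x + L x (pd v Y x).
Proof.
move=> Ll Ls Ys; rewrite -!pdE; apply: derive_family => //.
  by move=> u; exact: smooth_at_diff.
exact: smooth_at_diff.
Qed.

Lemma pd_comm V m (f : V -> 'rV[R]_m) (x u v : V) :
  smooth_at x f -> pd u (pd v f) x = pd v (pd u f) x.
Proof.
move=> fs.
have aux a : pd a f = 'D_a f by apply/funext => y; rewrite pdE.
by rewrite -!pdE (aux u) (aux v); apply: schwarz.
Qed.

Lemma pd_comm_scalar V (f : V -> R) (x u v : V) :
  smooth_at x f -> pd u (pd v f) x = pd v (pd u f) x.
Proof.
move=> fs.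
have aux a : pd a f = 'D_a f by apply/funext => y; rewrite pdE.
by rewrite -!pdE (aux u) (aux v); apply: schwarz_scalar.
Qed.
End PD.

(** * Connections and curvature in an open set of coordinate space *)

Definition bilin (R : realType) (U V W : lmodType R) (B : U -> V -> W) :=
  (forall v, linear (B ^~ v)) /\ (forall u, linear (B u)).

(** The curvature of the connection with Christoffel symbols C, on vectors:
    sealed so that additivity of a metric in its arguments does not rewrite
    inside it. *)
HB.lock Definition riem {R : realType} {n : nat}
  (C : 'rV[R]_n -> 'rV[R]_n -> 'rV[R]_n -> 'rV[R]_n) (x u v z : 'rV[R]_n)
  : 'rV[R]_n :=
  pd u (fun y => C y v z) x - pd v (fun y => C y u z) x
  + C x u (C x v z) - C x v (C x u z).

Section Coordinates.
Context {R : realType} {n : nat}.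
Local Notation V := 'rV[R]_n.
Implicit Types W : normedModType R.
Implicit Types (X Y Z : V -> V) (x u v w z : V) (C : V -> V -> V -> V).

(** The connection with Christoffel symbols C, on coordinate fields. *)
Definition nabla C X Y x : V :=
  pd (X x) Y x + C x (X x) (Y x).

Definition lie X Y x : V := pd (X x) Y x - pd (Y x) X x.

(** The covariant derivatives, in the direction u, of tensor fields of type
    (1,2) and (1,3). *)
Definition cov2 C (T : V -> V -> V -> V) x u a b : V :=
  pd u (fun y => T y a b) x + C x u (T x a b) - T x (C x u a) b - T x a (C x u b).

Definition cov3 C (T : V -> V -> V -> V -> V) x u a b c : V :=
  pd u (fun y => T y a b c) x + C x u (T x a b c) - T x (C x u a) b c
  - T x a (C x u b) c - T x a b (C x u c).

Lemma smooth_bilinear W (C : V -> V -> V -> W) X Y x :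
  (forall y, bilin (C y)) -> (forall u v, smooth_at x (fun y => C y u v)) ->
  smooth_at x X -> smooth_at x Y -> smooth_at x (fun y => C y (X y) (Y y)).
Proof.
move=> Cb Cs Xs Ys.
apply: (smooth_family (L := fun y => C y (X y))) => //.
  by apply: filterE => y; case: (Cb y).
move=> v; apply: (smooth_family (L := fun y u => C y u v)) => //.
by apply: filterE => y; case: (Cb y).
Qed.

Lemma pd_bilinear W (C : V -> V -> V -> W) X Y x w :
  (forall y, bilin (C y)) -> (forall u v, smooth_at x (fun y => C y u v)) ->
  smooth_at x X -> smooth_at x Y ->
  pd w (fun y => C y (X y) (Y y)) x =
  pd w (fun y => C y (X x) (Y x)) x + C x (pd w X x) (Y x)
  + C x (X x) (pd w Y x).
Proof.
move=> Cb Cs Xs Ys.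
rewrite (pd_family (L := fun y => C y (X y))) //.
- rewrite (pd_family (L := fun y u => C y u (Y x))) //.
  by apply: filterE => y; case: (Cb y).
- by apply: filterE => y; case: (Cb y).
- move=> v; apply: (smooth_family (L := fun y u => C y u v)) => //.
  by apply: filterE => y; case: (Cb y).
Qed.

Lemma smooth_along W X (f : V -> W) x :
  smooth_at x X -> smooth_at x f -> smooth_at x (fun y => pd (X y) f y).
Proof.
move=> Xs fs; apply: (smooth_family (L := fun y u => pd u f y)) => //.
  apply: filterS (smooth_at_near fs) => y; exact: pd_lin.
by move=> v; apply: pd_smooth.
Qed.

Lemma pd_along W X (f : V -> W) x w :
  smooth_at x X -> smooth_at x f ->
  pd w (fun y => pd (X y) f y) x = pd w (pd (X x) f) x + pd (pd w X x) f x.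
Proof.
move=> Xs fs; rewrite (pd_family (L := fun y u => pd u f y)) //.
  apply: filterS (smooth_at_near fs) => y; exact: pd_lin.
by move=> v; apply: pd_smooth.
Qed.

Lemma nabla_near C X Y Y' x :
  (\forall y \near x, Y y = Y' y) -> nabla C X Y x = nabla C X Y' x.
Proof.
by move=> H; rewrite /nabla (pd_near _ H) (nbhs_singleton H : Y x = Y' x).
Qed.

Lemma nabla_smooth C X Y x :
  (forall y, bilin (C y)) -> (forall u v, smooth_at x (fun y => C y u v)) ->
  smooth_at x X -> smooth_at x Y -> smooth_at x (nabla C X Y).
Proof.
move=> Cb Cs Xs Ys; apply: smooth_at_add.
  exact: smooth_along.
exact: smooth_bilinear.
Qed.

Lemma lie_smooth X Y x :
  smooth_at x X -> smooth_at x Y -> smooth_at x (lie X Y).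
Proof. by move=> Xs Ys; apply: smooth_at_sub; exact: smooth_along. Qed.

(** Curvature is a tensor: the second derivatives of Z cancel by their symmetry,
    and the first derivatives of Y and Z cancel against the bracket term. *)
Lemma riem_fields C X Y Z x :
  (forall y, bilin (C y)) -> (forall u v, smooth_at x (fun y => C y u v)) ->
  smooth_at x X -> smooth_at x Y -> smooth_at x Z ->
  nabla C X (nabla C Y Z) x - nabla C Y (nabla C X Z) x
    - nabla C (lie X Y) Z x = riem C x (X x) (Y x) (Z x).
Proof.
move=> Cb Cs Xs Ys Zs.
have Zl := pd_lin Zs.
have [_ C2] := Cb x; have C1 := (Cb x).1.
have E P Q : smooth_at x P -> smooth_at x Q ->
    nabla C P (nabla C Q Z) x =
    pd (P x) (pd (Q x) Z) x + pd (pd (P x) Q x) Z x +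
    (pd (P x) (fun y => C y (Q x) (Z x)) x + C x (pd (P x) Q x) (Z x) +
      C x (Q x) (pd (P x) Z x)) +
    (C x (P x) (pd (Q x) Z x) + C x (P x) (C x (Q x) (Z x))).
  move=> Ps Qs; rewrite {1}/nabla {1}/nabla.
  rewrite pd_add; last first.
  - exact: smooth_bilinear.
  - exact: smooth_along.
  by rewrite pd_along // pd_bilinear // (linD (C2 _)).
rewrite !E // /nabla /lie (linB Zl) (linB (C1 _)) riem.unlock.
rewrite (pd_comm (Y x) (X x) Zs).
by apply/rowP => i; rewrite !mxE; ring.
Qed.
End Coordinates.

Section Bilin.
Context {R : realType} {U V W : lmodType R} (B : U -> V -> W) (Bb : bilin B).
Lemma bilinDl x y v : B (x + y) v = B x v + B y v.
Proof. exact: (linD (Bb.1 v)). Qed.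
Lemma bilinDr u x y : B u (x + y) = B u x + B u y.
Proof. exact: (linD (Bb.2 u)). Qed.
Lemma bilinBl x y v : B (x - y) v = B x v - B y v.
Proof. exact: (linB (Bb.1 v)). Qed.
Lemma bilinBr u x y : B u (x - y) = B u x - B u y.
Proof. exact: (linB (Bb.2 u)). Qed.
Lemma bilinNl x v : B (- x) v = - B x v.
Proof. exact: (linN (Bb.1 v)). Qed.
Lemma bilinNr u x : B u (- x) = - B u x.
Proof. exact: (linN (Bb.2 u)). Qed.
Lemma bilinZl a x v : B (a *: x) v = a *: B x v.
Proof. exact: (linZ (Bb.1 v)). Qed.
Lemma bilinZr a u x : B u (a *: x) = a *: B u x.
Proof. exact: (linZ (Bb.2 u)). Qed.
Lemma bilin0l v : B 0 v = 0. Proof. exact: (lin0 (Bb.1 v)). Qed.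
Lemma bilin0r u : B u 0 = 0. Proof. exact: (lin0 (Bb.2 u)). Qed.
End Bilin.

(** * Linear maps of coordinate spaces and blocks of row vectors *)

Section FiniteDim.
Context {R : realType}.
Implicit Types W : normedModType R.

Lemma smooth_linear n W (f : 'rV[R]_n -> W) x : linear f -> smooth_at x f.
Proof.
move=> fl; apply: (@smooth_at_eq _ _ _ _
    (fun y : 'rV[R]_n => \sum_i y 0 i *: f (delta_mx 0 i))).
  apply: filterE => y; rewrite [in RHS](row_sum_delta y) (lin_sum fl).
  by apply: eq_bigr => i _; rewrite (linZ fl).
apply: smooth_at_sum => i; apply: smooth_at_scale.
  apply: (@smooth_at_coord _ _ _ _ id).
  by apply: smooth_at_linear => // y; exact: cvg_id.
exact: smooth_at_cst.
Qed.

Lemma pd_linear_row n W (f : 'rV[R]_n -> W) x v : linear f -> pd v f x = f v.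
Proof.
move=> fl; apply: pd_linear => // y.
exact/differentiable_continuous/smooth_at_diff/smooth_linear.
Qed.

Lemma smooth_lincomp (V : normedModType R) n W (f : 'rV[R]_n -> W)
  (g : V -> 'rV[R]_n) x : linear f -> smooth_at x g ->
  smooth_at x (fun y => f (g y)).
Proof. by move=> fl gs; apply: (smooth_at_comp gs); apply: smooth_linear. Qed.

Lemma pd_lincomp (V : normedModType R) n W (f : 'rV[R]_n -> W)
  (g : V -> 'rV[R]_n) x v : linear f -> smooth_at x g ->
  pd v (fun y => f (g y)) x = f (pd v g x).
Proof.
move=> fl gs.
by rewrite (pd_comp v gs (smooth_linear _ fl)) pd_linear_row.
Qed.

Lemma lsubmx_linear m n : linear (lsubmx : 'rV[R]_(m + n) -> 'rV[R]_m).
Proof. by move=> a u v; rewrite linearP. Qed.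

Lemma rsubmx_linear m n : linear (rsubmx : 'rV[R]_(m + n) -> 'rV[R]_n).
Proof. by move=> a u v; rewrite linearP. Qed.

Lemma row_mx_linear_l m n : linear (fun u : 'rV[R]_m => row_mx u (0 : 'rV[R]_n)).
Proof. by move=> a u v; rewrite scale_row_mx add_row_mx scaler0 addr0. Qed.

Lemma row_mx_linear_r m n : linear (fun u : 'rV[R]_n => row_mx (0 : 'rV[R]_m) u).
Proof. by move=> a u v; rewrite scale_row_mx add_row_mx scaler0 addr0. Qed.

Lemma row_mx_split m n (u : 'rV[R]_m) (v : 'rV[R]_n) :
  row_mx u v = row_mx u 0 + row_mx 0 v.
Proof. by rewrite add_row_mx addr0 add0r. Qed.

Lemma smooth_row_mx (V : normedModType R) m n (f : V -> 'rV[R]_m)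
  (g : V -> 'rV[R]_n) x : smooth_at x f -> smooth_at x g ->
  smooth_at x (fun y => row_mx (f y) (g y)).
Proof.
move=> fs gs.
apply: (@smooth_at_eq _ _ _ _ (fun y => row_mx (f y) 0 + row_mx 0 (g y))).
  by apply: filterE => y; rewrite -row_mx_split.
apply: smooth_at_add.
  exact: (smooth_lincomp (@row_mx_linear_l m n)).
exact: (smooth_lincomp (@row_mx_linear_r m n)).
Qed.

Lemma pd_row_mx (V : normedModType R) m n (f : V -> 'rV[R]_m)
  (g : V -> 'rV[R]_n) x v : smooth_at x f -> smooth_at x g ->
  pd v (fun y => row_mx (f y) (g y)) x = row_mx (pd v f x) (pd v g x).
Proof.
move=> fs gs.
have -> : (fun y => row_mx (f y) (g y)) =
          (fun y => row_mx (f y) 0 + row_mx 0 (g y)).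
  by apply/funext => y; rewrite -row_mx_split.
rewrite pd_add.
- rewrite (pd_lincomp _ (@row_mx_linear_l m n)) // (pd_lincomp _ (@row_mx_linear_r m n)) //.
  by rewrite -row_mx_split.
- exact: (smooth_lincomp (@row_mx_linear_l m n)).
- exact: (smooth_lincomp (@row_mx_linear_r m n)).
Qed.

Lemma smooth_lsubmx m n (w : 'rV[R]_(m + n)) :
  smooth_at w (lsubmx : 'rV[R]_(m + n) -> 'rV[R]_m).
Proof. exact/smooth_linear/lsubmx_linear. Qed.

Lemma smooth_rsubmx m n (w : 'rV[R]_(m + n)) :
  smooth_at w (rsubmx : 'rV[R]_(m + n) -> 'rV[R]_n).
Proof. exact/smooth_linear/rsubmx_linear. Qed.

Lemma smooth_lsubmx_comp m n W (f : 'rV[R]_m -> W) (w : 'rV[R]_(m + n)) :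
  smooth_at (lsubmx w) f -> smooth_at w (fun y => f (lsubmx y)).
Proof. by move=> fs; apply: (smooth_at_comp (smooth_lsubmx w)). Qed.

Lemma pd_lsubmx_comp m n W (f : 'rV[R]_m -> W) (w D : 'rV[R]_(m + n)) :
  smooth_at (lsubmx w) f ->
  pd D (fun y => f (lsubmx y)) w = pd (lsubmx D) f (lsubmx w).
Proof.
move=> fs; rewrite (pd_comp D (smooth_lsubmx w) fs).
by rewrite (pd_linear_row _ _ (@lsubmx_linear m n)).
Qed.

Lemma smooth_id (V : normedModType R) (x : V) : smooth_at x id.
Proof. by apply: smooth_at_linear => // y; exact: cvg_id. Qed.

End FiniteDim.

(** * Bianchi identities *)

Section Curvature.
Context {R : realType} {n : nat}.
Local Notation V := 'rV[R]_n.
Variables (C : V -> V -> V -> V) (x : V).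
Hypothesis Cb : forall y, bilin (C y).
Hypothesis Cs : forall u v, smooth_at x (fun y => C y u v).

Lemma pd_symbols_bilin w : bilin (fun u v => pd w (fun y => C y u v) x).
Proof.
split=> [v|u] a s t /=.
  have -> : (fun y => C y (a *: s + t) v) = (fun y => cst a y *: C y s v + C y t v).
    by apply/funext => y; rewrite (bilinDl (Cb y)) (bilinZl (Cb y)).
  rewrite pd_add // ?pd_scale // ?pd_cst ?scale0r ?add0r //; try exact: smooth_at_cst.
  by apply: smooth_at_scale => //; exact: smooth_at_cst.
have -> : (fun y => C y u (a *: s + t)) = (fun y => cst a y *: C y u s + C y u t).
  by apply/funext => y; rewrite (bilinDr (Cb y)) (bilinZr (Cb y)).
rewrite pd_add // ?pd_scale // ?pd_cst ?scale0r ?add0r //; try exact: smooth_at_cst.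
by apply: smooth_at_scale => //; exact: smooth_at_cst.
Qed.

Lemma pd_symbols_lin u v : linear (fun w => pd w (fun y => C y u v) x).
Proof. exact: pd_lin. Qed.

Lemma riem_lin3 u v : linear (riem C x u v).
Proof.
move=> a s t; rewrite riem.unlock !(bilinDr (pd_symbols_bilin _)) !(bilinZr (pd_symbols_bilin _)).
rewrite !(bilinDr (Cb x)) !(bilinZr (Cb x)).
by apply/rowP => i; rewrite !mxE; ring.
Qed.

Lemma riem_skew u v z : riem C x u v z = - riem C x v u z.
Proof. by rewrite riem.unlock; apply/rowP => i; rewrite !mxE; ring. Qed.

Lemma riem_lin1 v z : linear (fun u => riem C x u v z).
Proof.
move=> a s t; rewrite riem.unlock !(linD (pd_symbols_lin _ _)) !(linZ (pd_symbols_lin _ _)).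
rewrite !(bilinDl (pd_symbols_bilin _)) !(bilinZl (pd_symbols_bilin _)).
rewrite !(bilinDl (Cb x)) !(bilinZl (Cb x)) !(bilinDr (Cb x)) !(bilinZr (Cb x)).
by apply/rowP => i; rewrite !mxE; ring.
Qed.

Lemma riem_lin2 u z : linear (fun v => riem C x u v z).
Proof.
by move=> a s t; rewrite !(riem_skew u) riem_lin1 opprD scalerN.
Qed.

Hypothesis Csym : \forall y \near x, forall u v, C y u v = C y v u.

Lemma pd_symbols_sym w u v :
  pd w (fun y => C y u v) x = pd w (fun y => C y v u) x.
Proof. by apply: pd_near; apply: filterS Csym => y /(_ u v). Qed.

(** Torsion-freeness cancels the derivatives and the quadratic terms in
    pairs. *)
Lemma riem_bianchi1 u v z :
  riem C x u v z + riem C x v z u + riem C x z u v = 0.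
Proof.
have S := nbhs_singleton Csym.
rewrite riem.unlock (pd_symbols_sym u z v) (pd_symbols_sym v u z) (pd_symbols_sym z v u).
rewrite (S v z) (S z u) (S u v).
by apply/rowP => i; rewrite !mxE; ring.
Qed.

Lemma riem_smooth u v z : smooth_at x (fun y => riem C y u v z).
Proof.
rewrite riem.unlock; apply: smooth_at_sub; [apply: smooth_at_add; [apply: smooth_at_sub|]|].
- exact: pd_smooth.
- exact: pd_smooth.
- by apply: (smooth_bilinear (X := cst u)) => //; exact: smooth_at_cst.
- by apply: (smooth_bilinear (X := cst v)) => //; exact: smooth_at_cst.
Qed.

Lemma pd_riem w u v z :
  pd w (fun y => riem C y u v z) x =
  pd w (pd u (fun y => C y v z)) x - pd w (pd v (fun y => C y u z)) x
  + (pd w (fun y => C y u (C x v z)) x + C x u (pd w (fun y => C y v z) x))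
  - (pd w (fun y => C y v (C x u z)) x + C x v (pd w (fun y => C y u z) x)).
Proof.
rewrite riem.unlock.
have sc u' v' z' : smooth_at x (fun y => C y u' (C y v' z')).
  by apply: (smooth_bilinear (X := cst u')) => //; exact: smooth_at_cst.
have pc u' v' z' : pd w (fun y => C y u' (C y v' z')) x =
    pd w (fun y => C y u' (C x v' z')) x + C x u' (pd w (fun y => C y v' z') x).
  rewrite (pd_bilinear (X := cst u')) //; last exact: smooth_at_cst.
  by rewrite pd_cst (bilin0l (Cb x)) addr0.
rewrite pd_sub //; last first.
  by apply: smooth_at_add => //; apply: smooth_at_sub; exact: pd_smooth.
rewrite pd_add //; last by apply: smooth_at_sub; exact: pd_smooth.
by rewrite pd_sub ?pc //; exact: pd_smooth.
Qed.

(** The second derivatives of C cancel by symmetry, and what remains is an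
    identity between products of C and its first derivatives, which uses only
    the symmetry of C. *)
Lemma riem_bianchi2 w u v z :
  cov3 C (riem C) x w u v z + cov3 C (riem C) x u v w z +
  cov3 C (riem C) x v w u z = 0.
Proof.
have S := nbhs_singleton Csym.
rewrite /cov3 (S u w) (S v w) (S v u).
rewrite (riem_skew (C x u v) w) (riem_skew u (C x w v)) (riem_skew v (C x w u)).
rewrite !pd_riem riem.unlock.
rewrite (pd_comm u w (Cs v z)) (pd_comm v w (Cs u z)) (pd_comm v u (Cs w z)).
rewrite !(bilinDr (Cb x)) !(bilinNr (Cb x)).
by apply/rowP => i; rewrite !mxE; ring.
Qed.

End Curvature.

(** * Statistical structures in an open set of coordinate space *)

(** The bilinear maps are so at every x, not only over U: outside U their values
    do not matter, and this spares linearity near a point. *)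
Record symbols_on {R : realType} {n : nat} (U : set 'rV[R]_n)
    (C : 'rV[R]_n -> 'rV[R]_n -> 'rV[R]_n -> 'rV[R]_n) : Prop := SymbolsOn {
  symbols_bilin : forall x, bilin (C x);
  symbols_smooth : forall x, U x -> forall u v, smooth_at x (fun y => C y u v);
  symbols_sym : forall x, U x -> forall u v, C x u v = C x v u
}.

Record metric_on {R : realType} {n : nat} (U : set 'rV[R]_n)
    (G : 'rV[R]_n -> 'rV[R]_n -> 'rV[R]_n -> R) : Prop := MetricOn {
  metric_on_bilin : forall x, bilin (G x);
  metric_on_smooth : forall x, U x -> forall u v, smooth_at x (fun y => G y u v);
  metric_on_sym : forall x, U x -> forall u v, G x u v = G x v u;
  metric_on_pos : forall x, U x -> forall u, u != 0 -> 0 < G x u u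
}.

Definition metric_compatible {R : realType} {n : nat} (U : set 'rV[R]_n)
    (C : 'rV[R]_n -> 'rV[R]_n -> 'rV[R]_n -> 'rV[R]_n)
    (G : 'rV[R]_n -> 'rV[R]_n -> 'rV[R]_n -> R) : Prop :=
  forall x, U x -> forall u v w,
    pd u (fun y => G y v w) x = G x (C x u v) w + G x v (C x u w).

(** Here C and Cg are the symbols of the connection and of the Levi-Civita
    connection. K is a parameter tied to C - Cg by an equation, so that K stays
    an atom in multilinear computations. *)
Record statistical_on {R : realType} {n : nat} (U : set 'rV[R]_n)
    (C Cg K : 'rV[R]_n -> 'rV[R]_n -> 'rV[R]_n -> 'rV[R]_n)
    (G : 'rV[R]_n -> 'rV[R]_n -> 'rV[R]_n -> R) : Prop := StatisticalOn {
  stat_open : open U;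
  stat_symbols : symbols_on U C;
  stat_lc_symbols : symbols_on U Cg;
  stat_metric : metric_on U G;
  stat_lc : metric_compatible U Cg G;
  stat_codazzi : forall x, U x -> forall u v w,
    pd u (fun y => G y v w) x - G x (C x u v) w - G x v (C x u w) =
    pd v (fun y => G y u w) x - G x (C x v u) w - G x u (C x v w);
  stat_difference : forall x u v, C x u v = Cg x u v + K x u v
}.

Section LeviCivita.
Context {R : realType} {n : nat}.
Local Notation V := 'rV[R]_n.
Variables (U : set V) (Cg : V -> V -> V -> V) (G : V -> V -> V -> R).
Hypothesis Uo : open U.
Hypothesis hCg : symbols_on U Cg.
Hypothesis hG : metric_on U G.
Hypothesis Gcompat : metric_compatible U Cg G.
Let Cgb := symbols_bilin hCg.
Let Cgs := symbols_smooth hCg.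
Let Cgsym := symbols_sym hCg.
Let Gb := metric_on_bilin hG.
Let Gs := metric_on_smooth hG.
Let Gsym := metric_on_sym hG.

Lemma pd_metric_fields X Y x w : U x -> smooth_at x X -> smooth_at x Y ->
  pd w (fun y => G y (X y) (Y y)) x =
  G x (Cg x w (X x) + pd w X x) (Y x) + G x (X x) (Cg x w (Y x) + pd w Y x).
Proof.
move=> Ux Xs Ys; rewrite pd_bilinear //; last exact: Gs.
by rewrite Gcompat // (bilinDl (Gb x)) (bilinDr (Gb x)); ring.
Qed.

(** Differentiate the compatibility equation once more and use that the second
    derivatives of the scalar G(v, w) are symmetric. *)
Lemma riem_metric_skew x t u v w : U x ->
  G x (riem Cg x t u v) w = - G x v (riem Cg x t u w).
Proof.
move=> Ux.
have E a b : pd a (pd b (fun y => G y v w)) x =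
   G x (Cg x a (Cg x b v) + pd a (fun y => Cg y b v) x) w
   + G x (Cg x b v) (Cg x a w) +
   (G x (Cg x a v) (Cg x b w)
    + G x v (Cg x a (Cg x b w) + pd a (fun y => Cg y b w) x)).
  rewrite (@pd_near _ _ _ _
     (fun y => G y (Cg y b v) w + G y v (Cg y b w))); last first.
    by apply: filterS (open_near Uo Ux) => y Uy; rewrite Gcompat.
  rewrite pd_add.
  - rewrite (pd_metric_fields (X := fun y => Cg y b v) (Y := cst w)) //; last exact: smooth_at_cst.
      rewrite (pd_metric_fields (Y := fun y => Cg y b w) (X := cst v)) //; last first.
      - exact: Cgs.
      - exact: smooth_at_cst.
      by rewrite !pd_cst !addr0.
    exact: Cgs.
  - apply: (smooth_bilinear (Y := cst w)) => //; [exact: Gs|exact: Cgs|exact: smooth_at_cst].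
  - apply: (smooth_bilinear (X := cst v)) => //; [exact: Gs|exact: smooth_at_cst|exact: Cgs].
have := pd_comm_scalar t u (Gs Ux v w).
rewrite !E riem.unlock.
rewrite ?(bilinDl (Gb x)) ?(bilinDr (Gb x)) ?(bilinNl (Gb x)) ?(bilinNr (Gb x)); lra.
Qed.

Lemma lc_symbols_near_sym x : U x -> \forall y \near x, forall u v, Cg y u v = Cg y v u.
Proof. by move=> Ux; apply: filterS (open_near Uo Ux) => y; exact: Cgsym. Qed.

(** The octahedron argument: the four Bianchi identities obtained by leaving out
    one of the arguments, combined with the two skew-symmetries. *)
Lemma riem_pair_sym x a b c d : U x ->
  G x (riem Cg x a b c) d = G x (riem Cg x c d a) b.
Proof.
move=> Ux; have Cn := lc_symbols_near_sym Ux.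
pose F a b c d := G x (riem Cg x a b c) d.
have F1 a' b' c' d' : F a' b' c' d' = - F b' a' c' d'.
  by rewrite /F riem_skew (bilinNl (Gb x)).
have F2 a' b' c' d' : F a' b' c' d' = - F a' b' d' c'.
  by rewrite /F riem_metric_skew // (Gsym Ux c').
have F3 a' b' c' d' : F a' b' c' d' + F b' c' a' d' + F c' a' b' d' = 0.
  rewrite /F -!(bilinDl (Gb x)).
  by rewrite (@riem_bianchi1 _ _ Cg x) ?(bilin0l (Gb x)).
rewrite -/(F a b c d) -/(F c d a b).
have := F3 a b c d; have := F3 b c d a; have := F3 c d a b; have := F3 d a b c.
have := F2 c a b d; have := F2 a b c d; have := F2 b c a d.
have := F2 b c d a; have := F2 c d b a; have := F2 d b c a.
have := F2 c d a b; have := F2 d a c b; have := F2 a c d b.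
have := F2 d a b c; have := F2 a b d c; have := F2 b d a c.
have := F1 a c b d; have := F1 a c d b; have := F1 b d a c; have := F1 b d c a.
lra.
Qed.
End LeviCivita.

(** The Levi-Civita covariant derivative of K in the direction w. *)
HB.lock Definition lc_cov_difference {R : realType} {n : nat}
  (Cg K : 'rV[R]_n -> 'rV[R]_n -> 'rV[R]_n -> 'rV[R]_n) (x w u v : 'rV[R]_n)
  : 'rV[R]_n :=
  pd w (fun y => K y u v) x + Cg x w (K x u v) - K x (Cg x w u) v
  - K x u (Cg x w v).

Section Statistical.
Context {R : realType} {n : nat}.
Local Notation V := 'rV[R]_n.
Variables (U : set V) (C Cg K : V -> V -> V -> V) (G : V -> V -> V -> R).
Hypothesis hS : statistical_on U C Cg K G.
Let Uo := stat_open hS.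
Let hC := stat_symbols hS.
Let hCg := stat_lc_symbols hS.
Let hG := stat_metric hS.
Let Cb := symbols_bilin hC.
Let Cs := symbols_smooth hC.
Let Csym := symbols_sym hC.
Let Cgb := symbols_bilin hCg.
Let Cgs := symbols_smooth hCg.
Let Cgsym := symbols_sym hCg.
Let Gb := metric_on_bilin hG.
Let Gsym := metric_on_sym hG.
Let Gpos := metric_on_pos hG.
Let Gcompat := stat_lc hS.
Let Gcodazzi := stat_codazzi hS.
Let CE := stat_difference hS.

Lemma differenceE x u v : K x u v = C x u v - Cg x u v.
Proof. by rewrite CE addrC addKr. Qed.

Lemma metric_nondegenerate x u v : U x -> (forall w, G x w u = G x w v) -> u = v.
Proof.
move=> Ux H; apply/eqP; rewrite -subr_eq0; apply/negP => /negP uv.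
by have := Gpos Ux uv; rewrite (bilinBr (Gb x)) H subrr ltxx.
Qed.

Lemma difference_bilin x : bilin (K x).
Proof.
split=> [v|u] a s t; rewrite !differenceE.
  rewrite !(bilinDl (Cb x)) !(bilinZl (Cb x)) !(bilinDl (Cgb x)) !(bilinZl (Cgb x)).
  by apply/rowP => i; rewrite !mxE; ring.
rewrite !(bilinDr (Cb x)) !(bilinZr (Cb x)) !(bilinDr (Cgb x)) !(bilinZr (Cgb x)).
by apply/rowP => i; rewrite !mxE; ring.
Qed.

Lemma difference_sym x u v : U x -> K x u v = K x v u.
Proof. by move=> Ux; rewrite !differenceE Csym // Cgsym. Qed.

Lemma difference_smooth x u v : U x -> smooth_at x (fun y => K y u v).
Proof.
 move=> Ux; apply: (@smooth_at_eq _ _ _ _ (fun y => C y u v - Cg y u v)).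
  by apply: filterE => y; rewrite differenceE.
by apply: smooth_at_sub; [exact: Cs|exact: Cgs].
Qed.

(** By the compatibility of Cg, the Codazzi equation says that
    G(b, K(a, c)) is symmetric in a and b; K itself is symmetric since both
    connections are torsion-free. *)
Lemma difference_total_sym x u v w : U x -> G x (K x u v) w = G x v (K x u w).
Proof.
move=> Ux.
have H a b c : G x b (K x a c) = G x a (K x b c).
  have := Gcodazzi Ux a b c; rewrite !Gcompat // !CE.
  rewrite !(bilinDl (Gb x)) !(bilinDr (Gb x)) (Cgsym Ux b a).
  rewrite (difference_sym b a Ux).
  lra.
by rewrite (Gsym Ux) (difference_sym u v Ux) H (difference_sym w u Ux).
Qed.

(** Differentiate the total symmetry of G(K(u, v), z); the Levi-Civita derivative
    of G vanishes. *)
Lemma lc_cov_difference_sym x w u v z : U x ->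
  G x (lc_cov_difference Cg K x w u v) z =
  G x v (lc_cov_difference Cg K x w u z).
Proof.
move=> Ux.
have E v' z' : pd w (fun y => G y (K y u v') z') x =
   G x (Cg x w (K x u v') + pd w (fun y => K y u v') x) z' +
   G x (K x u v') (Cg x w z').
  rewrite (pd_metric_fields hG Gcompat (Y := cst z')) //.
  - by rewrite pd_cst addr0.
  - exact: difference_smooth.
  - exact: smooth_at_cst.
have S : pd w (fun y => G y (K y u v) z) x = pd w (fun y => G y (K y u z) v) x.
  apply: pd_near; apply: filterS (open_near Uo Ux) => y Uy.
  by rewrite (difference_total_sym _ _ _ Uy) (Gsym Uy).
move: S; rewrite !E lc_cov_difference.unlock (Gsym Ux v).
rewrite !(bilinDl (Gb x)) !(bilinNl (Gb x)).
have T a b c : G x (K x a b) c = G x (K x a c) b.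
  by rewrite (difference_total_sym _ _ _ Ux) (Gsym Ux).
have := T (Cg x w u) v z; have := T u (Cg x w v) z; have := T u (Cg x w z) v.
lra.
Qed.

(** The terms in K x (Cg x u v) z cancel because Cg is torsion-free. *)
Lemma riem_difference x u v z : U x ->
  riem C x u v z = riem Cg x u v z
  + lc_cov_difference Cg K x u v z - lc_cov_difference Cg K x v u z
  + K x u (K x v z) - K x v (K x u z).
Proof.
move=> Ux; rewrite riem.unlock lc_cov_difference.unlock.
have E a b : pd a (fun y => C y b z) x = pd a (fun y => Cg y b z) x +
   pd a (fun y => K y b z) x.
  rewrite -pd_add.
  - by apply: pd_near; apply: filterE => y; rewrite CE.
  - exact: Cgs.
  - exact: difference_smooth.
rewrite !E !CE !(bilinDr (Cgb x)) !(bilinDr (difference_bilin x)) (Cgsym Ux v u).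
by apply/rowP => i; rewrite !mxE; ring.
Qed.

Definition is_R1_on (R1 : V -> V -> V -> V -> V) := forall x, U x ->
  forall w a b c, G x w (R1 x a b c) = 2^-1 * G x (riem C x w a b) c.

Variables (R1 : V -> V -> V -> V -> V).
Hypothesis R1P : is_R1_on R1.

Lemma R1_lin1 x b c : U x -> linear (fun a => R1 x a b c).
Proof.
move=> Ux s u v; apply: (metric_nondegenerate Ux) => w.
rewrite (bilinDr (Gb x)) (bilinZr (Gb x)) !R1P // riem_lin2 //; last exact: Cs.
by rewrite (bilinDl (Gb x)) (bilinZl (Gb x)) /GRing.scale /=; ring.
Qed.

Lemma R1_lin2 x a c : U x -> linear (fun b => R1 x a b c).
Proof.
move=> Ux s u v; apply: (metric_nondegenerate Ux) => w.
rewrite (bilinDr (Gb x)) (bilinZr (Gb x)) !R1P // riem_lin3 //; last exact: Cs.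
by rewrite (bilinDl (Gb x)) (bilinZl (Gb x)) /GRing.scale /=; ring.
Qed.

Lemma R1_lin3 x a b : U x -> linear (R1 x a b).
Proof.
move=> Ux s u v; apply: (metric_nondegenerate Ux) => w.
rewrite (bilinDr (Gb x)) (bilinZr (Gb x)) !R1P //.
by rewrite (bilinDr (Gb x)) (bilinZr (Gb x)) /GRing.scale /=; ring.
Qed.

(** Paired with w, the left side is half of the difference of
    G(R(w, z) v, u) and G(R(w, z) u, v). The covariant derivative of K is
    symmetric in u and v and drops out; Rg and [K, K] are skew, so they
    contribute fully, and pair symmetry moves w to the last place. *)
Lemma R1_commutator x u v z : U x ->
  R1 x z v u - R1 x z u v =
  riem Cg x u v z + K x u (K x v z) - K x v (K x u z).
Proof.
move=> Ux; apply: (metric_nondegenerate Ux) => w.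
rewrite (bilinBr (Gb x)) !R1P // !riem_difference //.
rewrite !(bilinDl (Gb x)) !(bilinNl (Gb x)) !(bilinDr (Gb x)) !(bilinNr (Gb x)).
have S1 : G x (riem Cg x w z v) u = G x w (riem Cg x u v z).
  rewrite (riem_pair_sym (U := U)) // riem_skew (bilinNl (Gb x)).
  by rewrite (riem_metric_skew (U := U)) // opprK (Gsym Ux).
have S2 : G x (riem Cg x w z v) u = - G x v (riem Cg x w z u).
  exact: (riem_metric_skew (U := U)).
rewrite (Gsym Ux v) in S2.
have P1 := lc_cov_difference_sym w z v u Ux; rewrite (Gsym Ux v) in P1.
have P2 := lc_cov_difference_sym z w v u Ux; rewrite (Gsym Ux v) in P2.
have Q a b c d : G x (K x a (K x b c)) d = G x (K x b c) (K x a d).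
  exact: difference_total_sym.
rewrite (Gsym Ux w (K x u _)) (Gsym Ux w (K x v _)) !Q.
rewrite (difference_sym v w Ux) (difference_sym u w Ux) (difference_sym v z Ux) (difference_sym u z Ux).
have := Gsym Ux (K x z v) (K x w u); have := Gsym Ux (K x z u) (K x w v).
lra.
Qed.
End Statistical.

(** * The frame of horizontal and vertical lifts *)

(** Coordinates on the tangent bundle are pairs w = (x, xi), and a pair A = (a, a')
    stands for the sum of the horizontal lift of a and the vertical lift of
    a' at w. *)
HB.lock Definition frame {R : realType} {n : nat}
  (C : 'rV[R]_n -> 'rV[R]_n -> 'rV[R]_n -> 'rV[R]_n) (w A : 'rV[R]_(n + n))
  : 'rV[R]_(n + n) :=
  row_mx (lsubmx A) (rsubmx A - C (lsubmx w) (lsubmx A) (rsubmx w)).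

(** The Levi-Civita connection of the Sasakian metric in the frame of lifts, on
    pairs with constant entries. *)
HB.lock Definition omega {R : realType} {n : nat}
  (C Cg K : 'rV[R]_n -> 'rV[R]_n -> 'rV[R]_n -> 'rV[R]_n)
  (R1 : 'rV[R]_n -> 'rV[R]_n -> 'rV[R]_n -> 'rV[R]_n -> 'rV[R]_n)
  (w A B : 'rV[R]_(n + n)) : 'rV[R]_(n + n) :=
  let x := lsubmx w in let xi := rsubmx w in
  let a := lsubmx A in let a' := rsubmx A in
  let b := lsubmx B in let b' := rsubmx B in
  row_mx (Cg x a b + K x a' b' - R1 x b xi a' - R1 x a xi b')
         (Cg x a b' - K x a' b - 2^-1 *: riem C x a b xi).

HB.lock Definition frame_bracket {R : realType} {n : nat}
  (C : 'rV[R]_n -> 'rV[R]_n -> 'rV[R]_n -> 'rV[R]_n) (w A B : 'rV[R]_(n + n))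
  : 'rV[R]_(n + n) :=
  let x := lsubmx w in
  row_mx 0 (C x (lsubmx A) (rsubmx B) - C x (lsubmx B) (rsubmx A)
            - riem C x (lsubmx A) (lsubmx B) (rsubmx w)).

Section Frame.
Context {R : realType} {n : nat}.
Local Notation V := 'rV[R]_n.
Local Notation W := 'rV[R]_(n + n).
Variables (U : set V) (C : V -> V -> V -> V).
Hypothesis Uo : open U.
Hypothesis Cb : forall x, bilin (C x).
Hypothesis Cs : forall x, U x -> forall u v, smooth_at x (fun y => C y u v).
Implicit Types (w A B E : W).

Lemma lsubmx_frame w A : lsubmx (frame C w A) = lsubmx A.
Proof. by rewrite frame.unlock row_mxKl. Qed.

Lemma rsubmx_frame w A : rsubmx (frame C w A) =
  rsubmx A - C (lsubmx w) (lsubmx A) (rsubmx w).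
Proof. by rewrite frame.unlock row_mxKr. Qed.

Lemma frame_lin w : linear (frame C w).
Proof.
move=> a A B; rewrite frame.unlock !linearP /= (bilinDl (Cb _)) (bilinZl (Cb _)).
rewrite scale_row_mx add_row_mx; congr row_mx.
by apply/rowP => i; rewrite !mxE; ring.
Qed.

Lemma smooth_symbols_fiber w a : U (lsubmx w) ->
  smooth_at w (fun y : W => C (lsubmx y) a (rsubmx y)).
Proof.
move=> Ux; apply: (smooth_family (L := fun (y : W) v => C (lsubmx y) a v)).
- by apply: filterE => y; case: (Cb (lsubmx y)).
- by move=> v; apply: (smooth_lsubmx_comp (f := fun y => C y a v)); exact: Cs.
- exact: smooth_rsubmx.
Qed.

Lemma pd_symbols_fiber w D a : U (lsubmx w) ->
  pd D (fun y : W => C (lsubmx y) a (rsubmx y)) w =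
  pd (lsubmx D) (fun y => C y a (rsubmx w)) (lsubmx w)
  + C (lsubmx w) a (rsubmx D).
Proof.
move=> Ux; rewrite (pd_family (L := fun (y : W) v => C (lsubmx y) a v)).
- rewrite (pd_lsubmx_comp (f := fun y => C y a (rsubmx w))) //; last exact: Cs.
  by rewrite (pd_linear_row _ _ (@rsubmx_linear _ _ _)).
- by apply: filterE => y; case: (Cb (lsubmx y)).
- by move=> v; apply: (smooth_lsubmx_comp (f := fun y => C y a v)); exact: Cs.
- exact: smooth_rsubmx.
Qed.

Lemma frame_smooth w A : U (lsubmx w) -> smooth_at w (frame C ^~ A).
Proof.
move=> Ux; rewrite frame.unlock; apply: smooth_row_mx.
  exact: smooth_at_cst.
by apply: smooth_at_sub; [exact: smooth_at_cst|exact: smooth_symbols_fiber].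
Qed.

Lemma pd_frame w D A : U (lsubmx w) ->
  pd D (frame C ^~ A) w =
  row_mx 0 (- (pd (lsubmx D) (fun y => C y (lsubmx A) (rsubmx w)) (lsubmx w)
               + C (lsubmx w) (lsubmx A) (rsubmx D))).
Proof.
move=> Ux; rewrite frame.unlock pd_row_mx.
- rewrite (pd_cst (lsubmx A)) pd_sub.
  + by rewrite (pd_cst (rsubmx A)) sub0r pd_symbols_fiber.
  + exact: smooth_at_cst.
  + exact: smooth_symbols_fiber.
- exact: smooth_at_cst.
- by apply: smooth_at_sub; [exact: smooth_at_cst|exact: smooth_symbols_fiber].
Qed.

Lemma frame_vert w (z : V) : frame C w (row_mx 0 z) = row_mx 0 z.
Proof. by rewrite frame.unlock row_mxKl row_mxKr (bilin0l (Cb _)) subr0. Qed.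

Lemma frame_hor w (z : V) :
  frame C w (row_mx z 0) = row_mx z (- C (lsubmx w) z (rsubmx w)).
Proof. by rewrite frame.unlock row_mxKl row_mxKr sub0r. Qed.

Lemma frame_surj w v :
  frame C w (row_mx (lsubmx v) (rsubmx v + C (lsubmx w) (lsubmx v) (rsubmx w))) = v.
Proof. by rewrite frame.unlock row_mxKl row_mxKr addrK hsubmxK. Qed.

(** Differentiating C x a xi along the base gives the derivative terms of
    R(a, b) xi, and differentiating xi along the horizontal fields gives its
    quadratic terms. *)
Lemma lie_frame w A B : U (lsubmx w) ->
  lie (frame C ^~ A) (frame C ^~ B) w = frame C w (frame_bracket C w A B).
Proof.
move=> Ux; rewrite frame_bracket.unlock frame_vert /lie !pd_frame //.
rewrite !lsubmx_frame !rsubmx_frame opp_row_mx add_row_mx oppr0 addr0; congr row_mx.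
rewrite !(bilinBr (Cb _)) riem.unlock.
by apply/rowP => i; rewrite !mxE; ring.
Qed.

End Frame.

(** * The Sasakian metric and its curvature in coordinates *)

(** Ct and Gt are the Levi-Civita symbols and the components of the Sasakian
    metric on the set of all (x, xi) with x in U; the last field is the
    defining property of this metric in the frame of lifts. *)
Record sasakian_on {R : realType} {n : nat} (U : set 'rV[R]_n)
    (C : 'rV[R]_n -> 'rV[R]_n -> 'rV[R]_n -> 'rV[R]_n)
    (G : 'rV[R]_n -> 'rV[R]_n -> 'rV[R]_n -> R)
    (Ct : 'rV[R]_(n + n) -> 'rV[R]_(n + n) -> 'rV[R]_(n + n) -> 'rV[R]_(n + n))
    (Gt : 'rV[R]_(n + n) -> 'rV[R]_(n + n) -> 'rV[R]_(n + n) -> R) : Prop :=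
  SasakianOn {
  sasakian_symbols : symbols_on [set w | U (lsubmx w)] Ct;
  sasakian_metric_on : metric_on [set w | U (lsubmx w)] Gt;
  sasakian_lc : metric_compatible [set w | U (lsubmx w)] Ct Gt;
  sasakian_frame : forall w, U (lsubmx w) -> forall A B,
    Gt w (frame C w A) (frame C w B) =
    G (lsubmx w) (lsubmx A) (lsubmx B) + G (lsubmx w) (rsubmx A) (rsubmx B)
}.

Section Bundle.
Context {R : realType} {n : nat}.
Local Notation V := 'rV[R]_n.
Local Notation W := 'rV[R]_(n + n).
Variables (U : set V) (C Cg K : V -> V -> V -> V) (G : V -> V -> V -> R).
Hypothesis hS : statistical_on U C Cg K G.
Variables (R1 : V -> V -> V -> V -> V).
Hypothesis R1P : is_R1_on U C G R1.
Variables (Ct : W -> W -> W -> W) (Gt : W -> W -> W -> R).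
Hypothesis hT : sasakian_on U C G Ct Gt.
Let Uo := stat_open hS.
Let hC := stat_symbols hS.
Let hCg := stat_lc_symbols hS.
Let hG := stat_metric hS.
Let Cb := symbols_bilin hC.
Let Cs := symbols_smooth hC.
Let Csym := symbols_sym hC.
Let Cgb := symbols_bilin hCg.
Let Cgs := symbols_smooth hCg.
Let Cgsym := symbols_sym hCg.
Let Gb := metric_on_bilin hG.
Let Gs := metric_on_smooth hG.
Let Gsym := metric_on_sym hG.
Let Gcompat := stat_lc hS.
Let CE := stat_difference hS.
Let hCt := sasakian_symbols hT.
Let hGt := sasakian_metric_on hT.
Let Ctb := symbols_bilin hCt.
Let Cts : forall w, U (lsubmx w) -> forall A B, smooth_at w (fun y => Ct y A B) :=
  symbols_smooth hCt.
Let Ctsym : forall w, U (lsubmx w) -> forall A B, Ct w A B = Ct w B A :=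
  symbols_sym hCt.
Let Gtb := metric_on_bilin hGt.
Let Gts : forall w, U (lsubmx w) -> forall A B, smooth_at w (fun y => Gt y A B) :=
  metric_on_smooth hGt.
Let Gtsym : forall w, U (lsubmx w) -> forall A B, Gt w A B = Gt w B A :=
  metric_on_sym hGt.
Let Gtpos : forall w, U (lsubmx w) -> forall A, A != 0 -> 0 < Gt w A A :=
  metric_on_pos hGt.
Let Gtcompat : forall w, U (lsubmx w) -> forall A B E,
  pd A (fun y => Gt y B E) w = Gt w (Ct w A B) E + Gt w B (Ct w A E) :=
  sasakian_lc hT.
Let GtE := sasakian_frame hT.
Implicit Types (w A B E : W).

Local Notation omega := (omega C Cg K R1).
Local Notation frame := (frame C).

Let Kb := difference_bilin hS.
Let Ksym x u v (Ux : U x) := difference_sym hS u v Ux.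
Let Ktot x u v z (Ux : U x) :=
  difference_total_sym hS u v z Ux.

Lemma near_base w : U (lsubmx w) -> \forall y \near w, U (lsubmx y).
Proof.
move=> Ux; have Un : nbhs (lsubmx w) U by exact: open_nbhs_nbhs.
exact: (@continuous_lsubmx R 1 n n w U Un).
Qed.

Lemma omega_torsion w A B : U (lsubmx w) ->
  omega w A B - omega w B A = frame_bracket C w A B.
Proof.
move=> Ux; rewrite omega.unlock frame_bracket.unlock /=.
rewrite opp_row_mx add_row_mx; congr row_mx.
  rewrite (Cgsym Ux (lsubmx B)) (Ksym (rsubmx B) _ Ux).
  by apply/rowP => i; rewrite !mxE; ring.
rewrite !CE (riem_skew _ _ (lsubmx B)).
rewrite (Ksym (rsubmx A) _ Ux) (Ksym (rsubmx B) _ Ux).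
by apply/rowP => i; rewrite !mxE; field.
Qed.

(** The terms in K cancel in pairs by total symmetry, and those in R1 cancel
    against each other and against R by the definition of R1. *)
Lemma omega_metric w A B E : U (lsubmx w) ->
  Gt w (frame w (omega w A B)) (frame w E)
  + Gt w (frame w B) (frame w (omega w A E)) =
  pd (lsubmx A) (fun y => G y (lsubmx B) (lsubmx E) + G y (rsubmx B) (rsubmx E))
     (lsubmx w).
Proof.
move=> Ux; rewrite !GtE // omega.unlock /= !row_mxKl !row_mxKr.
set x := lsubmx w; set xi := rsubmx w; rewrite -/x in Ux.
rewrite pd_add; [|exact: Gs|exact: Gs]; rewrite !Gcompat //.
have Q a b c d : G x (R1 x a b c) d = 2^-1 * G x (riem C x d a b) c.
  by rewrite (Gsym Ux) R1P.
rewrite ?(bilinDl (Gb x)) ?(bilinDr (Gb x)) ?(bilinNl (Gb x)) ?(bilinNr (Gb x)).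
rewrite ?(bilinZl (Gb x)) ?(bilinZr (Gb x)) /GRing.scale /=.
rewrite !(Gsym Ux _ (R1 _ _ _ _)) !Q.
rewrite (Gsym Ux (rsubmx B) (riem _ _ _ _ _)).
rewrite (riem_skew C x (lsubmx B) (lsubmx E)) (riem_skew C x (lsubmx B) (lsubmx A)).
rewrite (riem_skew C x (lsubmx E) (lsubmx A)).
rewrite !(bilinNl (Gb x)).
have := Ktot (rsubmx A) (rsubmx B) (lsubmx E) Ux.
have := Ktot (rsubmx A) (lsubmx B) (rsubmx E) Ux.
lra.
Qed.

Lemma nabla_metric (X Y Z : W -> W) w : U (lsubmx w) ->
  smooth_at w Y -> smooth_at w Z ->
  pd (X w) (fun y => Gt y (Y y) (Z y)) w =
  Gt w (nabla Ct X Y w) (Z w) + Gt w (Y w) (nabla Ct X Z w).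
Proof.
move=> Ux Ys Zs; rewrite pd_bilinear //; last exact: Gts.
by rewrite Gtcompat // /nabla (bilinDl (Gtb w)) (bilinDr (Gtb w)); ring.
Qed.

(** The difference S of the two sides is symmetric in A, B because both sides
    have the same torsion, and Gt(S A B, E) is skew in B, E because both are
    metric; a trilinear expression with these two symmetries vanishes. *)
Lemma nabla_frame w A B : U (lsubmx w) ->
  nabla Ct (frame ^~ A) (frame ^~ B) w = frame w (omega w A B).
Proof.
move=> Ux.
pose S A B := nabla Ct (frame ^~ A) (frame ^~ B) w - frame w (omega w A B).
have Ssym A' B' : S A' B' = S B' A'.
  apply/eqP; rewrite -subr_eq0 /S; apply/eqP.
  have L := lie_frame Cb Cs A' B' Ux.
  rewrite -(omega_torsion _ _ Ux) (linB (frame_lin Cb w)) in L.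
  rewrite /nabla (Ctsym Ux (frame w B')).
  transitivity (lie (frame ^~ A') (frame ^~ B') w
    - (frame w (omega w A' B') - frame w (omega w B' A'))).
    by rewrite /lie; apply/rowP => i; rewrite !mxE; ring.
  by rewrite L subrr.
have Santi A' B' E : Gt w (S A' B') (frame w E) = - Gt w (S A' E) (frame w B').
  have M := nabla_metric (frame ^~ A') Ux (frame_smooth Cb Cs B' Ux)
              (frame_smooth Cb Cs E Ux).
  have N := omega_metric A' B' E Ux.
  rewrite (@pd_near _ _ _ _ (fun y => G (lsubmx y) (lsubmx B') (lsubmx E)
     + G (lsubmx y) (rsubmx B') (rsubmx E))) in M; last first.
    by apply: filterS (near_base Ux) => y Uy; rewrite GtE.
  rewrite (pd_lsubmx_comp (f := fun y => G y (lsubmx B') (lsubmx E)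
     + G y (rsubmx B') (rsubmx E))) in M; last first.
    by apply: smooth_at_add; exact: Gs.
  rewrite lsubmx_frame -N in M.
  rewrite /S !(bilinBl (Gtb w)) !(Gtsym Ux _ (frame w B')).
  lra.
have S0 A' B' E : Gt w (S A' B') (frame w E) = 0.
  have := Santi A' B' E; have := Santi E A' B'; have := Santi B' E A'.
  rewrite (Ssym E A') (Ssym B' E) (Ssym B' A'); lra.
apply/eqP; rewrite -subr_eq0 -/(S A B); apply/negP => /negP Sn.
have := Gtpos Ux Sn.
by rewrite -{2}(frame_surj C w (S A B)) S0 ltxx.
Qed.

(** At (y, xi) the horizontal part of the derivative of the horizontal lift of a
    along the vertical lift of c is - R1(a, xi, c). *)
Lemma R1_smooth x a xi c : U x -> smooth_at x (fun y => R1 y a xi c).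
Proof.
move=> Ux.
pose F y := nabla Ct (frame ^~ (row_mx 0 c)) (frame ^~ (row_mx a 0)) (row_mx y xi : W).
apply: (@smooth_at_eq _ _ _ _ (fun y => - lsubmx (F y))).
  apply: filterS (open_near Uo Ux) => y Uy.
  rewrite /F nabla_frame ?row_mxKl // lsubmx_frame omega.unlock /= !row_mxKl !row_mxKr.
  rewrite (bilin0l (Cgb y)) (bilin0r (Kb y)).
  have -> : R1 y 0 xi 0 = 0 by exact: (lin0 (R1_lin3 hS R1P 0 xi Uy)).
  by rewrite addr0 sub0r subr0 opprK.
apply: smooth_at_opp; apply: (smooth_lincomp (@lsubmx_linear _ _ _)).
apply: (smooth_at_comp (g := fun y => row_mx y xi)
   (f := nabla Ct (frame ^~ (row_mx 0 c)) (frame ^~ (row_mx a 0)))).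
  apply: smooth_row_mx; [exact: smooth_id|exact: smooth_at_cst].
have Ux' : U (lsubmx (row_mx x xi)) by rewrite row_mxKl.
apply: nabla_smooth => //; [exact: Cts| |].
  exact: (frame_smooth Cb Cs _ Ux').
exact: (frame_smooth Cb Cs _ Ux').
Qed.

Let R1l1 x b c (Ux : U x) := R1_lin1 hS R1P b c Ux.
Let R1l2 x a c (Ux : U x) := R1_lin2 hS R1P a c Ux.
Let R1l3 x a b (Ux : U x) := R1_lin3 hS R1P a b Ux.

Lemma smooth_R1_fiber w a c : U (lsubmx w) ->
  smooth_at w (fun y : W => R1 (lsubmx y) a (rsubmx y) c).
Proof.
move=> Ux; apply: (smooth_family (L := fun (y : W) v => R1 (lsubmx y) a v c)).
- by apply: filterS (near_base Ux) => y; exact: R1l2.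
- by move=> v; apply: (smooth_lsubmx_comp (f := fun y => R1 y a v c)); exact: R1_smooth.
- exact: smooth_rsubmx.
Qed.

Lemma pd_R1_fiber w D a c : U (lsubmx w) ->
  pd D (fun y : W => R1 (lsubmx y) a (rsubmx y) c) w =
  pd (lsubmx D) (fun y => R1 y a (rsubmx w) c) (lsubmx w)
  + R1 (lsubmx w) a (rsubmx D) c.
Proof.
move=> Ux; rewrite (pd_family (L := fun (y : W) v => R1 (lsubmx y) a v c)).
- rewrite (pd_lsubmx_comp (f := fun y => R1 y a (rsubmx w) c)); last exact: R1_smooth.
  by rewrite (pd_linear_row _ _ (@rsubmx_linear _ _ _)).
- by apply: filterS (near_base Ux) => y; exact: R1l2.
- by move=> v; apply: (smooth_lsubmx_comp (f := fun y => R1 y a v c)); exact: R1_smooth.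
- exact: smooth_rsubmx.
Qed.

Lemma smooth_riem_fiber w a b : U (lsubmx w) ->
  smooth_at w (fun y : W => riem C (lsubmx y) a b (rsubmx y)).
Proof.
move=> Ux; apply: (smooth_family (L := fun (y : W) v => riem C (lsubmx y) a b v)).
- by apply: filterS (near_base Ux) => y Uy; apply: riem_lin3 => //; exact: Cs.
- move=> v; apply: (smooth_lsubmx_comp (f := fun y => riem C y a b v)).
  by apply: riem_smooth => //; exact: Cs.
- exact: smooth_rsubmx.
Qed.

Lemma pd_riem_fiber w D a b : U (lsubmx w) ->
  pd D (fun y : W => riem C (lsubmx y) a b (rsubmx y)) w =
  pd (lsubmx D) (fun y => riem C y a b (rsubmx w)) (lsubmx w)
  + riem C (lsubmx w) a b (rsubmx D).
Proof.
move=> Ux; rewrite (pd_family (L := fun (y : W) v => riem C (lsubmx y) a b v)).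
- rewrite (pd_lsubmx_comp (f := fun y => riem C y a b (rsubmx w))).
    by rewrite (pd_linear_row _ _ (@rsubmx_linear _ _ _)).
  by apply: riem_smooth => //; exact: Cs.
- by apply: filterS (near_base Ux) => y Uy; apply: riem_lin3 => //; exact: Cs.
- move=> v; apply: (smooth_lsubmx_comp (f := fun y => riem C y a b v)).
  by apply: riem_smooth => //; exact: Cs.
- exact: smooth_rsubmx.
Qed.

Lemma pd_omega w D A B : U (lsubmx w) ->
  smooth_at w (fun y => omega y A B) /\
  pd D (fun y => omega y A B) w =
  let x := lsubmx w in let xi := rsubmx w in
  let u := lsubmx D in let eta := rsubmx D in
  let a := lsubmx A in let a' := rsubmx A in
  let b := lsubmx B in let b' := rsubmx B in
  row_mx
    (pd u (fun y => Cg y a b) x + pd u (fun y => K y a' b') x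
     - (pd u (fun y => R1 y b xi a') x + R1 x b eta a')
     - (pd u (fun y => R1 y a xi b') x + R1 x a eta b'))
    (pd u (fun y => Cg y a b') x - pd u (fun y => K y a' b) x
     - 2^-1 *: (pd u (fun y => riem C y a b xi) x + riem C x a b eta)).
Proof.
move=> Ux; rewrite omega.unlock /=.
have s1 a b : smooth_at w (fun y : W => Cg (lsubmx y) a b).
  by apply: (smooth_lsubmx_comp (f := fun y => Cg y a b)); exact: Cgs.
have s2 a b : smooth_at w (fun y : W => K (lsubmx y) a b).
  by apply: (smooth_lsubmx_comp (f := fun y => K y a b)); exact: (difference_smooth hS).
have s3 a c := smooth_R1_fiber a c Ux.
have s4 a b : smooth_at w (fun y : W => 2^-1 *: riem C (lsubmx y) a b (rsubmx y)).
  apply: (@smooth_at_scale _ _ _ _ (cst _)); first exact: smooth_at_cst.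
  exact: smooth_riem_fiber.
have p1 a b : pd D (fun y : W => Cg (lsubmx y) a b) w =
    pd (lsubmx D) (fun y => Cg y a b) (lsubmx w).
  by rewrite (pd_lsubmx_comp (f := fun y => Cg y a b)) //; exact: Cgs.
have p2 a b : pd D (fun y : W => K (lsubmx y) a b) w =
    pd (lsubmx D) (fun y => K y a b) (lsubmx w).
  by rewrite (pd_lsubmx_comp (f := fun y => K y a b)) //; exact: (difference_smooth hS).
have p4 a b : pd D (fun y : W => 2^-1 *: riem C (lsubmx y) a b (rsubmx y)) w =
    2^-1 *: (pd (lsubmx D) (fun y => riem C y a b (rsubmx w)) (lsubmx w)
             + riem C (lsubmx w) a b (rsubmx D)).
  rewrite (@pd_scale _ _ _ (cst _)); [|exact: smooth_at_cst|exact: smooth_riem_fiber].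
  by rewrite pd_cst scale0r add0r pd_riem_fiber.
have sl a b a' b' : smooth_at w (fun y : W => Cg (lsubmx y) a b + K (lsubmx y) a' b').
  exact: smooth_at_add.
have sl' a b a' b' : smooth_at w (fun y : W => Cg (lsubmx y) a b +
    K (lsubmx y) a' b' - R1 (lsubmx y) b (rsubmx y) a').
  exact: smooth_at_sub.
have sr a a' b b' : smooth_at w (fun y : W => Cg (lsubmx y) a b' -
    K (lsubmx y) a' b).
  exact: smooth_at_sub.
split; first by apply: smooth_row_mx; exact: smooth_at_sub.
rewrite pd_row_mx; [|exact: smooth_at_sub|exact: smooth_at_sub].
congr row_mx.
  by rewrite pd_sub // pd_sub // pd_add // p1 p2 !pd_R1_fiber.
by rewrite pd_sub // pd_sub // p1 p2 p4.
Qed.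

Lemma nabla_frame_fields A (f : W -> W) w : U (lsubmx w) -> smooth_at w f ->
  nabla Ct (frame ^~ A) (fun y => frame y (f y)) w =
  frame w (pd (frame w A) f w + omega w A (f w)).
Proof.
move=> Ux fs; rewrite (linD (frame_lin Cb w)) -nabla_frame // /nabla.
rewrite (pd_family (L := frame)) //.
- by rewrite [in RHS]addrA (addrC (frame w _)).
- by apply: filterE => y; exact: (frame_lin Cb y).
- by move=> B; exact: (frame_smooth Cb Cs B Ux).
Qed.

(** Compute the curvature on frame fields; a derivative along a frame field of
    frame f is the frame vector of the componentwise derivative of f plus
    omega. *)
Lemma frame_riem w A B E : U (lsubmx w) ->
  riem Ct w (frame w A) (frame w B) (frame w E) =
  frame w (pd (frame w A) (fun y => omega y B E) w + omega w A (omega w B E)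
    - (pd (frame w B) (fun y => omega y A E) w + omega w B (omega w A E))
    - omega w (frame_bracket C w A B) E).
Proof.
move=> Ux.
have fs D := frame_smooth Cb Cs D Ux.
have N P Q : nabla Ct (frame ^~ P) (nabla Ct (frame ^~ Q) (frame ^~ E)) w =
    frame w (pd (frame w P) (fun y => omega y Q E) w + omega w P (omega w Q E)).
  rewrite -(nabla_frame_fields P Ux (pd_omega 0 Q E Ux).1).
  by apply: nabla_near; apply: filterS (near_base Ux) => y; exact: nabla_frame.
rewrite -(riem_fields Ctb (Cts Ux) (fs A) (fs B) (fs E)) !N.
rewrite !(linB (frame_lin Cb w)) -(nabla_frame _ _ Ux).
by rewrite /nabla (lie_frame Cb Cs A B Ux).
Qed.

Lemma pd_dir0 (T T' : normedModType R) (f : T -> T') y : pd 0 f y = 0.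
Proof. by rewrite -pdE derive0. Qed.

Lemma pd_zero (T T' : normedModType R) (f : T -> T') u y :
  (\forall z \near y, f z = 0) -> pd u f y = 0.
Proof. by move=> H; rewrite (pd_near (g := cst 0)) // pd_cst. Qed.

(** * The six formulas at a point of the tangent bundle *)

Section Formulas.
Variables (w : W) (Ux : U (lsubmx w)).
Let x := lsubmx w.
Let xi := rsubmx w.

Let nearU : \forall y \near x, U y. Proof. exact: open_near. Qed.

Let z_Cg0 u b : pd u (fun y => Cg y 0 b) x = 0.
Proof. by apply: pd_zero; apply: filterE => y; exact: bilin0l. Qed.
Let z_Cg1 u b : pd u (fun y => Cg y b 0) x = 0.
Proof. by apply: pd_zero; apply: filterE => y; exact: bilin0r. Qed.
Let z_K0 u b : pd u (fun y => K y 0 b) x = 0.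
Proof. by apply: pd_zero; apply: filterE => y; exact: bilin0l. Qed.
Let z_K1 u b : pd u (fun y => K y b 0) x = 0.
Proof. by apply: pd_zero; apply: filterE => y; exact: bilin0r. Qed.
Let z_R1 u b c : pd u (fun y => R1 y 0 b c) x = 0.
Proof. by apply: pd_zero; apply: filterS nearU => y Uy; exact: (lin0 (R1l1 b c Uy)). Qed.
Let z_R3 u a b : pd u (fun y => R1 y a b 0) x = 0.
Proof. by apply: pd_zero; apply: filterS nearU => y Uy; exact: (lin0 (R1l3 a b Uy)). Qed.
Let z_C1 u b c : pd u (fun y => riem C y 0 b c) x = 0.
Proof.
apply: pd_zero; apply: filterS nearU => y Uy.
exact: (lin0 (riem_lin1 Cb (Cs Uy) b c)).
Qed.
Let z_C2 u b c : pd u (fun y => riem C y b 0 c) x = 0.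
Proof.
apply: pd_zero; apply: filterS nearU => y Uy.
exact: (lin0 (riem_lin2 Cb (Cs Uy) b c)).
Qed.
(* The lists below are the rules by which the common proof pattern of the six
   formulas normalizes: vanishing of terms with an entry 0, then homogeneity,
   then additivity. *)
Let Zpd := (z_Cg0, z_Cg1, z_K0, z_K1, z_R1, z_R3, z_C1, z_C2, @pd_dir0).

Let z_r1 b c : R1 x 0 b c = 0. Proof. exact: (lin0 (R1l1 b c Ux)). Qed.
Let z_r2 a c : R1 x a 0 c = 0. Proof. exact: (lin0 (R1l2 a c Ux)). Qed.
Let z_r3 a b : R1 x a b 0 = 0. Proof. exact: (lin0 (R1l3 a b Ux)). Qed.
Let z_c1 b c : riem C x 0 b c = 0.
Proof. exact: (lin0 (riem_lin1 Cb (Cs Ux) b c)). Qed.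
Let z_c2 a c : riem C x a 0 c = 0.
Proof. exact: (lin0 (riem_lin2 Cb (Cs Ux) a c)). Qed.
Let z_c3 a b : riem C x a b 0 = 0.
Proof. exact: (lin0 (riem_lin3 Cb (Cs Ux) a b)). Qed.
Let Zero := (z_r1, z_r2, z_r3, z_c1, z_c2, z_c3,
  (bilin0l (Cb x)), (bilin0r (Cb x)), (bilin0l (Cgb x)), (bilin0r (Cgb x)),
  (bilin0l (Kb x)), (bilin0r (Kb x))).
Let Addz := (@addr0 V, @add0r V, @subr0 V, @sub0r V, @oppr0 V, @scaler0 R V, @opprK V).
Let n_r1 a b c : R1 x (- a) b c = - R1 x a b c. Proof. exact: (linN (R1l1 b c Ux)). Qed.
Let n_r2 a b c : R1 x a (- b) c = - R1 x a b c. Proof. exact: (linN (R1l2 a c Ux)). Qed.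
Let n_r3 a b c : R1 x a b (- c) = - R1 x a b c. Proof. exact: (linN (R1l3 a b Ux)). Qed.
Let s_r1 s a b c : R1 x (s *: a) b c = s *: R1 x a b c. Proof. exact: (linZ (R1l1 b c Ux)). Qed.
Let s_r3 s a b c : R1 x a b (s *: c) = s *: R1 x a b c. Proof. exact: (linZ (R1l3 a b Ux)). Qed.
Let d_r1 a a' b c : R1 x (a + a') b c = R1 x a b c + R1 x a' b c.
Proof. exact: (linD (R1l1 b c Ux)). Qed.
Let d_r2 a b b' c : R1 x a (b + b') c = R1 x a b c + R1 x a b' c.
Proof. exact: (linD (R1l2 a c Ux)). Qed.
Let d_r3 a b c c' : R1 x a b (c + c') = R1 x a b c + R1 x a b c'.
Proof. exact: (linD (R1l3 a b Ux)). Qed.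
Let n_c1 a b c : riem C x (- a) b c = - riem C x a b c.
Proof. exact: (linN (riem_lin1 Cb (Cs Ux) b c)). Qed.
Let n_c2 a b c : riem C x a (- b) c = - riem C x a b c.
Proof. exact: (linN (riem_lin2 Cb (Cs Ux) a c)). Qed.
Let n_c3 a b c : riem C x a b (- c) = - riem C x a b c.
Proof. exact: (linN (riem_lin3 Cb (Cs Ux) a b)). Qed.
Let d_c1 a a' b c : riem C x (a + a') b c = riem C x a b c + riem C x a' b c.
Proof. exact: (linD (riem_lin1 Cb (Cs Ux) b c)). Qed.
Let d_c2 a b b' c : riem C x a (b + b') c = riem C x a b c + riem C x a b' c.
Proof. exact: (linD (riem_lin2 Cb (Cs Ux) a c)). Qed.
Let d_c3 a b c c' : riem C x a b (c + c') = riem C x a b c + riem C x a b c'.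
Proof. exact: (linD (riem_lin3 Cb (Cs Ux) a b)). Qed.

Let Neg := (n_r1, n_r2, n_r3, s_r1, s_r3, n_c1, n_c2, n_c3, (bilinNl (Cgb x)), (bilinNr (Cgb x)),
  (bilinNl (Kb x)), (bilinNr (Kb x)), (bilinZl (Cgb x)), (bilinZr (Cgb x)),
  (bilinZl (Kb x)), (bilinZr (Kb x))).
Let Add := (d_r1, d_r2, d_r3, d_c1, d_c2, d_c3, (bilinDl (Cgb x)), (bilinDr (Cgb x)),
  (bilinDl (Kb x)), (bilinDr (Kb x))).

Let frame_riemE A B E : riem Ct w (frame w A) (frame w B) (frame w E) =
  frame w (pd (frame w A) (fun y => omega y B E) w + omega w A (omega w B E)
    - (pd (frame w B) (fun y => omega y A E) w + omega w B (omega w A E))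
    - omega w (frame_bracket C w A B) E).
Proof. exact: frame_riem. Qed.

Let mxE2 := (@row_mxKl R 1 n n, @row_mxKr R 1 n n).

(* Reduces a formula to two identities, one for each part, between sums of
   multilinear terms in the data at x. *)
Ltac frame_components :=
  rewrite frame_riemE; congr (frame w _);
  rewrite !(pd_omega _ _ _ Ux).2 !omega.unlock frame_bracket.unlock /=;
  rewrite -/x -/xi !lsubmx_frame !rsubmx_frame -/x -/xi !mxE2;
  rewrite ?(Zpd, Zero, Addz) ?(opp_row_mx, add_row_mx) ?CE ?Addz ?(Add, Neg) ?Addz.

Lemma riem_vvv X Y Z :
  riem Ct w (frame w (row_mx 0 X)) (frame w (row_mx 0 Y)) (frame w (row_mx 0 Z)) =
  frame w (row_mx (R1 x (K x X Z) xi Y - R1 x (K x Y Z) xi X)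
                  (K x Y (K x X Z) - K x X (K x Y Z))).
Proof.
frame_components.
by congr row_mx; apply/rowP => i; rewrite !mxE; ring.
Qed.

(** The quadratic terms in K and the two terms R1(Z, Y, X), R1(Z, X, Y) come from
    differentiating omega along the fibre, where xi is replaced by X or Y; they
    combine to Rg(X, Y) Z by R1_commutator. *)
Lemma riem_vvh X Y Z :
  riem Ct w (frame w (row_mx 0 X)) (frame w (row_mx 0 Y)) (frame w (row_mx Z 0)) =
  frame w (row_mx
    (riem Cg x X Y Z + R1 x (R1 x Z xi Y) xi X - R1 x (R1 x Z xi X) xi Y)
    (K x (R1 x Z xi Y) X - K x (R1 x Z xi X) Y)).
Proof.
have S a b : K x a b = K x b a by exact: Ksym.
have A3 := R1_commutator hS R1P X Y Z Ux; rewrite -/x in A3.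
have -> : riem Cg x X Y Z = R1 x Z Y X - R1 x Z X Y - K x X (K x Y Z)
    + K x Y (K x X Z).
  by rewrite A3; apply/rowP => i; rewrite !mxE; ring.
frame_components.
rewrite (S (R1 x Z xi Y)) (S (R1 x Z xi X)).
by congr row_mx; apply/rowP => i; rewrite !mxE; ring.
Qed.

Lemma riem_vhh X Y Z :
  riem Ct w (frame w (row_mx 0 X)) (frame w (row_mx Y 0)) (frame w (row_mx Z 0)) =
  frame w (row_mx
    (- (2^-1 *: K x X (riem C x Y Z xi)) + R1 x (K x Y Z) xi X
     + cov3 C R1 x Y Z xi X - K x Y (R1 x Z xi X) - R1 x Y xi (K x X Z))
    (- (2^-1 *: riem C x Y Z X) + (K x X (K x Y Z) - K x Y (K x X Z))
     + cov2 C K x Y X Z - 2^-1 *: riem C x Y (R1 x Z xi X) xi)).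
Proof.
frame_components; rewrite /cov2 /cov3 ?CE ?(Add, Neg).
by congr row_mx; apply/rowP => i; rewrite !mxE; ring.
Qed.

Lemma riem_vhv X Y Z :
  riem Ct w (frame w (row_mx 0 X)) (frame w (row_mx Y 0)) (frame w (row_mx 0 Z)) =
  frame w (row_mx
    ((K x Y (K x X Z) - K x X (K x Y Z)) + R1 x (R1 x Y xi Z) xi X
     - R1 x Y X Z - cov2 C K x Y X Z)
    (K x (R1 x Y xi Z) X + 2^-1 *: riem C x Y (K x X Z) xi)).
Proof.
have S a b : K x a b = K x b a by exact: Ksym.
frame_components; rewrite /cov2 ?CE ?(Add, Neg) (S (R1 x Y xi Z)).
by congr row_mx; apply/rowP => i; rewrite !mxE; ring.
Qed.

(** The vertical part contains the derivatives of R(Y, Z) xi along X and of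
    R(X, Z) xi along Y, which the second Bianchi identity turns into the
    derivative of R(X, Y) xi along Z. *)
Lemma riem_hhh X Y Z :
  riem Ct w (frame w (row_mx X 0)) (frame w (row_mx Y 0)) (frame w (row_mx Z 0)) =
  frame w (row_mx
    (riem Cg x X Y Z + 2^-1 *: (R1 x X xi (riem C x Y Z xi)
      - R1 x Y xi (riem C x X Z xi) - 2 *: R1 x Z xi (riem C x X Y xi)))
    (2^-1 *: (cov3 C (riem C) x Z X Y xi - riem C x Y (K x X Z) xi
      + riem C x X (K x Y Z) xi + K x X (riem C x Y Z xi)
      - K x Y (riem C x X Z xi) - 2 *: K x Z (riem C x X Y xi)))).
Proof.
have S a b : K x a b = K x b a by exact: Ksym.
have B2 : cov3 C (riem C) x Z X Y xi =
    cov3 C (riem C) x Y X Z xi - cov3 C (riem C) x X Y Z xi.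
  have Cn : \forall y \near x, forall u v, C y u v = C y v u.
    by apply: filterS nearU => y; exact: Csym.
  have sk u a b : pd u (fun y => riem C y a b xi) x =
      - pd u (fun y => riem C y b a xi) x.
    rewrite -pd_opp; last by apply: riem_smooth => //; exact: Cs.
    by apply: pd_near; apply: filterE => y; rewrite riem_skew.
  have := riem_bianchi2 Cb (Cs Ux) Cn X Y Z xi.
  rewrite /cov3 (sk Y X Z) (riem_skew C x X Z)
    (riem_skew C x (C x Y X)) (riem_skew C x X (C x Y Z))
    (riem_skew C x X Z (C x Y xi)) !(bilinNr (Cb x)) => /rowP B.
  by apply/rowP => i; have := B i; rewrite !mxE; lra.
have E : riem Cg x X Y Z = pd X (fun y => Cg y Y Z) x - pd Y (fun y => Cg y X Z) x
  + Cg x X (Cg x Y Z) - Cg x Y (Cg x X Z) by rewrite riem.unlock.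
rewrite B2 E.
frame_components; rewrite /cov3 ?CE ?(Add, Neg).
rewrite (S (riem C x X Y xi) Z) (Cgsym Ux Y X) (Ksym Y X Ux).
by congr row_mx; apply/rowP => i; rewrite !mxE; field.
Qed.

Lemma riem_hhv X Y Z :
  riem Ct w (frame w (row_mx X 0)) (frame w (row_mx Y 0)) (frame w (row_mx 0 Z)) =
  frame w (row_mx
    (cov3 C R1 x Y X xi Z - cov3 C R1 x X Y xi Z + K x X (R1 x Y xi Z)
     - K x Y (R1 x X xi Z) + K x (riem C x X Y xi) Z
     + R1 x X xi (K x Y Z) - R1 x Y xi (K x X Z))
    (riem Cg x X Y Z + 2^-1 *: (riem C x X (R1 x Y xi Z) xi
      - riem C x Y (R1 x X xi Z) xi))).
Proof.
have E : riem Cg x X Y Z = pd X (fun y => Cg y Y Z) x - pd Y (fun y => Cg y X Z) x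
  + Cg x X (Cg x Y Z) - Cg x Y (Cg x X Z) by rewrite riem.unlock.
rewrite E.
frame_components; rewrite /cov3 ?CE ?(Add, Neg).
rewrite (Cgsym Ux Y X) (Ksym Y X Ux).
by congr row_mx; apply/rowP => i; rewrite !mxE; ring.
Qed.

End Formulas.

End Bundle.

(** * Smooth atlases *)

(** What the passage to a chart uses of a manifold. Topology enters only through
    the openness of overlaps in coordinate space, so that the atlas induced on
    the tangent bundle is covered without giving that set a topology. *)
Record smooth_atlas {R : realType} {n : nat} {M : Type} (A : atlas R n M)
    : Prop := SmoothAtlas {
  atlas_at_dom : forall p, chart_dom (chart_at A p) p;
  atlas_open : forall c c' : chart_index A,
    open (chart_map c @` (chart_dom c `&` chart_dom c'));
  atlas_mapK : forall (c : chart_index A) p,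
    chart_dom c p -> chart_inv c (chart_map c p) = p;
  atlas_smooth : forall c c' : chart_index A,
    smooth_on (chart_map c @` (chart_dom c `&` chart_dom c'))
              (chart_map c' \o chart_inv c)
}.

Arguments atlas_open {R n M A} _ c c'.
Arguments atlas_smooth {R n M A} _ c c'.

Lemma manifold_smooth_atlas (R : realType) n (M : topologicalType)
  (A : atlas R n M) : manifold A -> smooth_atlas A.
Proof.
move=> hM; split.
- exact: chart_at_dom hM.
- move=> c c'; have Uo := @chart_image_open _ _ _ _ hM c.
  have := @chart_inv_continuous _ _ _ _ hM c.
  rewrite continuous_open_subspace // => ic.
  rewrite openE => _ [q [qc qc'] <-].
  have Uq : (chart_map c @` chart_dom c) (chart_map c q) by exists q.
  have := ic (chart_map c q) (mem_set Uq) (chart_dom c').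
  rewrite (chart_mapK hM qc) => /(_ (open_nbhs_nbhs (conj (@chart_dom_open _ _ _ _ hM c') qc'))).
  move=> H; rewrite /interior /=; near=> y.
  have [q' q'c yE] : (chart_map c @` chart_dom c) y.
    by near: y; apply: open_nbhs_nbhs.
  exists q' => //; split=> //.
  have : chart_dom c' (chart_inv c y) by near: y.
  by rewrite -yE (chart_mapK hM q'c).
- by move=> c q; exact: (chart_mapK hM).
- by move=> c c'; exact: (chart_transition_smooth hM).
Unshelve. all: by end_near. Qed.

(** A function of the coordinates, not of the point; inverse to field_with over
    the image of the chart. *)
HB.lock Definition components {R : realType} {n : nat} {M : Type} {A : atlas R n M}
    (c : chart_index A) (X : M -> 'rV[R]_n) (x : 'rV[R]_n) : 'rV[R]_n :=
  to_chart c (chart_inv c x) (X (chart_inv c x)).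

HB.lock Definition field_with {R : realType} {n : nat} {M : Type} {A : atlas R n M}
    (c : chart_index A) (Xh : 'rV[R]_n -> 'rV[R]_n) (q : M) : 'rV[R]_n :=
  from_chart c q (Xh (chart_map c q)).

Section Atlas.
Context {R : realType} {n : nat} {M : Type} (A : atlas R n M).
Hypothesis hA : smooth_atlas A.
Local Notation V := 'rV[R]_n.
Local Notation cmap := chart_map.
Local Notation cinv := chart_inv.
Local Notation cdom := chart_dom.
Implicit Types (c : chart_index A) (q : M) (u v : V) (X Y Z : M -> V).

Definition trans c c' : V -> V := cmap c' \o cinv c.

Lemma near_chart c c' q : cdom c q -> cdom c' q ->
  \forall y \near cmap c q,
    [/\ cdom c (cinv c y), cdom c' (cinv c y) & cmap c (cinv c y) = y].
Proof.
move=> qc qc'; have Uo := atlas_open hA c c'.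
have Uq : (cmap c @` (cdom c `&` cdom c')) (cmap c q) by exists q.
apply: filterS (open_near Uo Uq) => _ [q' [q'c q'c'] <-].
by rewrite (atlas_mapK hA q'c).
Qed.

Lemma trans_smooth c c' q : cdom c q -> cdom c' q ->
  smooth_at (cmap c q) (trans c c').
Proof.
move=> qc qc'; apply: smooth_at_on (atlas_open hA c c') _ (atlas_smooth hA c c').
by exists q.
Qed.

Lemma transE c c' q : cdom c q -> trans c c' (cmap c q) = cmap c' q.
Proof. by move=> qc; rewrite /trans /= (atlas_mapK hA qc). Qed.

Lemma transK c c' q : cdom c q -> cdom c' q ->
  \forall y \near cmap c q, trans c' c (trans c c' y) = y.
Proof.
move=> qc qc'; apply: filterS (near_chart qc qc') => y [yc yc' yE].
by rewrite /trans /= (atlas_mapK hA yc') yE.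
Qed.

Lemma pd_trans_id c q v : cdom c q -> pd v (trans c c) (cmap c q) = v.
Proof.
move=> qc; rewrite (pd_near (g := id)).
  by apply: pd_linear => // y; exact: cvg_id.
by apply: filterS (near_chart qc qc) => y [].
Qed.

Lemma pd_trans_comp c c' c'' q v : cdom c q -> cdom c' q -> cdom c'' q ->
  pd v (trans c c'') (cmap c q) =
  pd (pd v (trans c c') (cmap c q)) (trans c' c'') (cmap c' q).
Proof.
move=> qc qc' qc''; rewrite -(transE c' qc) -pd_comp.
- apply: pd_near; apply: filterS (near_chart qc qc') => y [yc yc' yE].
  by rewrite /trans /= (atlas_mapK hA yc').
- exact: trans_smooth.
- by rewrite (transE c' qc); exact: trans_smooth.
Qed.

Lemma to_chartE c q v :
  to_chart c q v = pd v (trans (chart_at A q) c) (cmap (chart_at A q) q).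
Proof. by rewrite /to_chart pdE. Qed.

Lemma from_chartE c q v :
  from_chart c q v = pd v (trans c (chart_at A q)) (cmap c q).
Proof. by rewrite /from_chart pdE. Qed.

Lemma from_chartK c q : cdom c q -> cancel (from_chart c q) (to_chart c q).
Proof.
move=> qc v; rewrite to_chartE from_chartE -pd_trans_comp ?pd_trans_id //.
exact: atlas_at_dom.
Qed.

Lemma to_chartK c q : cdom c q -> cancel (to_chart c q) (from_chart c q).
Proof.
move=> qc v; rewrite to_chartE from_chartE -pd_trans_comp ?pd_trans_id //;
exact: atlas_at_dom.
Qed.

Lemma to_chart_linear c q : cdom c q -> linear (to_chart c q).
Proof.
move=> qc a u v; rewrite !to_chartE; apply: pd_lin.
by apply: trans_smooth => //; exact: atlas_at_dom.
Qed.

Lemma from_chart_linear c q : cdom c q -> linear (from_chart c q).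
Proof.
move=> qc a u v; rewrite !from_chartE; apply: pd_lin.
by apply: trans_smooth => //; exact: atlas_at_dom.
Qed.

Lemma to_chart_trans c c' q v : cdom c q -> cdom c' q ->
  to_chart c' q v = pd (to_chart c q v) (trans c c') (cmap c q).
Proof.
move=> qc qc'; rewrite !to_chartE -pd_trans_comp //.
exact: atlas_at_dom.
Qed.

Lemma to_from_chart c c' q v : cdom c q -> cdom c' q ->
  to_chart c' q (from_chart c q v) = pd v (trans c c') (cmap c q).
Proof. by move=> qc qc'; rewrite (to_chart_trans _ qc) // from_chartK. Qed.

Lemma to_chart_at q v : to_chart (chart_at A q) q v = v.
Proof. by rewrite to_chartE pd_trans_id //; exact: atlas_at_dom. Qed.

Local Notation components := (components (A := A)).
Local Notation field_with := (field_with (A := A)).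

Lemma componentsE c X q : cdom c q -> components c X (cmap c q) = to_chart c q (X q).
Proof. by move=> qc; rewrite components.unlock (atlas_mapK hA qc). Qed.

Lemma components_field_with c Xh q : cdom c q ->
  \forall y \near cmap c q, components c (field_with c Xh) y = Xh y.
Proof.
move=> qc; apply: filterS (near_chart qc qc) => y [yc _ yE].
by rewrite components.unlock field_with.unlock from_chartK // yE.
Qed.

Lemma field_with_components c X q : cdom c q -> field_with c (components c X) q = X q.
Proof. by move=> qc; rewrite field_with.unlock componentsE // to_chartK. Qed.

Lemma extendE q v : extend A q v = field_with (chart_at A q) (cst v).
Proof. by rewrite field_with.unlock. Qed.

Lemma smooth_change (W : normedModType R) c c' q (f : M -> W) :
  cdom c q -> cdom c' q ->
  smooth_at (cmap c q) (f \o cinv c) -> smooth_at (cmap c' q) (f \o cinv c').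
Proof.
move=> qc qc' fs.
apply: (@smooth_at_eq _ _ _ _ ((f \o cinv c) \o trans c' c)).
  apply: filterS (near_chart qc' qc) => y [yc' yc yE].
  by rewrite /= (atlas_mapK hA yc).
apply: smooth_at_comp; first exact: trans_smooth.
by rewrite transE.
Qed.

Lemma smooth_nearP (W : normedModType R) c q (f : M -> W) : cdom c q ->
  smooth_near A q f <-> smooth_at (cmap c q) (f \o cinv c).
Proof.
move=> qc; have q0 := atlas_at_dom hA q; split=> fs.
  exact: smooth_change fs.
exact: (smooth_change (c := c)).
Qed.

(** The transformation of vector fields by the derivative of the transition
    map, written at the image of y so that the chain rule applies to it. *)
Lemma components_change c c' q X : cdom c q -> cdom c' q ->
  \forall y \near cmap c q,
    components c' X (trans c c' y) = pd (components c X y) (trans c c') y.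
Proof.
move=> qc qc'; apply: filterS (near_chart qc qc') => y [yc yc' yE].
rewrite components.unlock /trans /= (atlas_mapK hA yc') -/(trans c c').
by rewrite (to_chart_trans _ yc yc') yE.
Qed.

Lemma smooth_components_change c c' q X : cdom c q -> cdom c' q ->
  smooth_at (cmap c q) (components c X) -> smooth_at (cmap c' q) (components c' X).
Proof.
move=> qc qc' Xs.
apply: (@smooth_at_eq _ _ _ _
   ((fun y => pd (components c X y) (trans c c') y) \o trans c' c)).
  have H := components_change X qc qc'.
  have tc : {for cmap c' q, continuous (trans c' c)}.
    exact/differentiable_continuous/smooth_at_diff/trans_smooth.
  have {}H : \forall y \near cmap c' q,
     components c' X (trans c c' (trans c' c y)) =
     pd (components c X (trans c' c y)) (trans c c') (trans c' c y).
    rewrite -(transE c qc') in H.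
    exact: tc _ H.
  move: H; apply: filterS2 (transK qc' qc) => y E.
  by rewrite E => ->.
apply: smooth_at_comp; first exact: trans_smooth.
by rewrite transE //; apply: smooth_along => //; exact: trans_smooth.
Qed.

Lemma local_rep_components q X :
  local_rep A q X \o cinv (chart_at A q) = components (chart_at A q) X.
Proof. by apply/funext => y; rewrite components.unlock. Qed.

Lemma smooth_vfieldP c q X : cdom c q ->
  smooth_vfield A q X <-> smooth_at (cmap c q) (components c X).
Proof.
move=> qc; have q0 := atlas_at_dom hA q.
rewrite /smooth_vfield /smooth_near local_rep_components.
by split=> fs; [exact: (smooth_components_change q0 qc fs)|exact: (smooth_components_change qc q0 fs)].
Qed.

Lemma dirE (W : normedModType R) c q (f : M -> W) v : cdom c q ->
  smooth_near A q f ->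
  dir A f q v = pd (to_chart c q v) (f \o cinv c) (cmap c q).
Proof.
move=> qc fs; have q0 := atlas_at_dom hA q.
rewrite /dir pdE to_chartE -[in RHS](transE c q0) -pd_comp.
- apply: pd_near; apply: filterS (near_chart q0 qc) => y [yc yc' yE].
  by rewrite /trans /= (atlas_mapK hA yc').
- exact: trans_smooth.
- by rewrite transE //; apply/smooth_nearP.
Qed.

(** Composing components in c' with the transition map tau turns the derivatives
    into second derivatives of tau, symmetric in the two fields, plus the image
    of the bracket in c. *)
Lemma lie_change c c' q X Y : cdom c q -> cdom c' q ->
  smooth_at (cmap c q) (components c X) -> smooth_at (cmap c q) (components c Y) ->
  lie (components c' X) (components c' Y) (cmap c' q) =
  pd (lie (components c X) (components c Y) (cmap c q)) (trans c c') (cmap c q).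
Proof.
move=> qc qc' Xs Ys; set x := cmap c q.
have ts := trans_smooth qc qc'.
have E P Q : smooth_at x (components c P) -> smooth_at x (components c Q) ->
   pd (components c' P (cmap c' q)) (components c' Q) (cmap c' q) =
   pd (components c P x) (pd (components c Q x) (trans c c')) x +
   pd (pd (components c P x) (components c Q) x) (trans c c') x.
  move=> Ps Qs; rewrite -pd_along // -(transE c' qc) -/x.
  have -> : components c' P (trans c c' x) = pd (components c P x) (trans c c') x.
    exact: (nbhs_singleton (components_change P qc qc')).
  have Qs' : smooth_at (trans c c' x) (components c' Q).
    by rewrite /x transE //; exact: (smooth_components_change qc qc' Qs).
  apply: etrans (esym (pd_comp (components c P x) ts Qs')) _.
  by apply: pd_near; exact: components_change.
rewrite /lie !E // (linB (pd_lin ts)).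
rewrite (pd_comm (components c Y x) (components c X x) ts).
by apply/rowP => i; rewrite !mxE; ring.
Qed.

Lemma bracketE c q X Y : cdom c q -> smooth_vfield A q X ->
  smooth_vfield A q Y ->
  to_chart c q (bracket A X Y q) = lie (components c X) (components c Y) (cmap c q).
Proof.
move=> qc Xs Ys; have q0 := atlas_at_dom hA q.
rewrite (lie_change q0 qc); [|exact/smooth_vfieldP|exact/smooth_vfieldP].
rewrite to_chartE; congr (pd _ _ _).
by rewrite /lie !(componentsE _ q0) !to_chart_at /bracket /dir !pdE !local_rep_components.
Qed.

Lemma smooth_field_with c q Xh : cdom c q -> smooth_at (cmap c q) Xh ->
  smooth_vfield A q (field_with c Xh).
Proof.
move=> qc Xs; apply/(smooth_vfieldP _ qc); apply: smooth_at_eq Xs.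
by apply: filterS (components_field_with Xh qc) => y.
Qed.

Lemma smooth_vfield_add q X Y : smooth_vfield A q X -> smooth_vfield A q Y ->
  smooth_vfield A q (X \+ Y).
Proof.
move=> Xs Ys; have q0 := atlas_at_dom hA q.
apply/(smooth_vfieldP _ q0).
have {}Xs := (smooth_vfieldP _ q0).1 Xs.
have {}Ys := (smooth_vfieldP _ q0).1 Ys.
apply: smooth_at_eq (smooth_at_add Xs Ys).
apply: filterS (near_chart q0 q0) => y [yc _ _].
by rewrite components.unlock /= (linD (to_chart_linear yc)).
Qed.

Lemma smooth_vfield_scale q (f : M -> R) X : smooth_near A q f ->
  smooth_vfield A q X -> smooth_vfield A q (fun q' => f q' *: X q').
Proof.
move=> fs Xs; have q0 := atlas_at_dom hA q.
apply/(smooth_vfieldP _ q0).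
have {}Xs := (smooth_vfieldP _ q0).1 Xs.
apply: smooth_at_eq (smooth_at_scale fs Xs).
apply: filterS (near_chart q0 q0) => y [yc _ _].
by rewrite components.unlock /= (linZ (to_chart_linear yc)).
Qed.

Lemma smooth_vfield_sum q (I : Type) (r : seq I) (f : I -> M -> R)
    (X : I -> M -> V) : (forall i, smooth_near A q (f i)) ->
  (forall i, smooth_vfield A q (X i)) ->
  smooth_vfield A q (fun q' => \sum_(i <- r) f i q' *: X i q').
Proof.
move=> fs Xs; elim: r => [|i r IH].
  have -> : (fun q' => \sum_(i <- [::]) f i q' *: X i q') =
            field_with (chart_at A q) (cst 0).
    apply/funext => q'; by rewrite big_nil field_with.unlock /from_chart derive0.
  apply: smooth_field_with; [exact: atlas_at_dom|exact: smooth_at_cst].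
have -> : (fun q' => \sum_(j <- i :: r) f j q' *: X j q') =
    (fun q' => f i q' *: X i q') \+ (fun q' => \sum_(j <- r) f j q' *: X j q').
  by apply/funext => q'; rewrite big_cons.
apply: smooth_vfield_add; last exact: IH.
exact: smooth_vfield_scale (fs i) (Xs i).
Qed.

End Atlas.

(** * Connections in a chart *)

Section Connection.
Context {R : realType} {n : nat} {M : Type} (A : atlas R n M).
Hypothesis hA : smooth_atlas A.
Local Notation V := 'rV[R]_n.
Local Notation cmap := chart_map.
Local Notation cinv := chart_inv.
Local Notation cdom := chart_dom.
Local Notation components := (components (A := A)).
Local Notation field_with := (field_with (A := A)).
Implicit Types (c : chart_index A) (q : M) (u v : V) (X Y Z : M -> V).
Variable D : (M -> V) -> (M -> V) -> M -> V.
Hypothesis hD : affine_connection A D.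

(* Locality of a connection: the scalar field that is 1 where two fields agree
   and 0 elsewhere is smooth where they agree on a neighbourhood, and it makes
   them equal everywhere when they are multiplied by it. *)
Let agree X X' : M -> R := fun q => if `[< X q = X' q >] then 1 else 0.

Let agree_scale X X' :
  (fun q => agree X X' q *: X q) = (fun q => agree X X' q *: X' q).
Proof.
apply/funext => q; rewrite /agree; case: asboolP => [->//|_].
by rewrite !scale0r.
Qed.

Let agree1 X X' q : X q = X' q -> agree X X' q = 1.
Proof. by move=> E; rewrite /agree; case: asboolP. Qed.

Let agree_smooth X X' c q : cdom c q ->
  (\forall y \near cmap c q, X (cinv c y) = X' (cinv c y)) ->
  smooth_near A q (agree X X').
Proof.
move=> qc H; apply/(smooth_nearP hA _ qc).
apply: (@smooth_at_eq _ _ _ _ (cst (1 : R))); last exact: smooth_at_cst.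
by apply: filterS H => y E; rewrite /= agree1.
Qed.

Lemma near_agree X X' c q : cdom c q ->
  (\forall y \near cmap c q, X (cinv c y) = X' (cinv c y)) -> X q = X' q.
Proof. by move=> qc /nbhs_singleton; rewrite /= (atlas_mapK hA qc). Qed.

Lemma conn_locall X X' Y c q : cdom c q ->
  smooth_vfield A q X -> smooth_vfield A q X' -> smooth_vfield A q Y ->
  (\forall y \near cmap c q, X (cinv c y) = X' (cinv c y)) ->
  D X Y q = D X' Y q.
Proof.
move=> qc Xs Xs' Ys H; have s := agree_smooth qc H.
have a1 := agree1 (near_agree qc H).
have := conn_scalel hD s Xs Ys; have := conn_scalel hD s Xs' Ys.
by rewrite a1 !scale1r agree_scale => <- <-.
Qed.

Lemma conn_localr X Y Y' c q : cdom c q ->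
  smooth_vfield A q X -> smooth_vfield A q Y -> smooth_vfield A q Y' ->
  (\forall y \near cmap c q, Y (cinv c y) = Y' (cinv c y)) ->
  D X Y q = D X Y' q.
Proof.
move=> qc Xs Ys Ys' H; have s := agree_smooth qc H.
have a1 := agree1 (near_agree qc H).
have := conn_leibniz hD s Xs Ys; have := conn_leibniz hD s Xs Ys'.
by rewrite a1 !scale1r agree_scale (near_agree qc H) => -> /addrI ->.
Qed.

Lemma smooth_near_cst (W : normedModType R) q (a : W) : smooth_near A q (cst a).
Proof. exact: (smooth_at_cst (cmap (chart_at A q) q) a). Qed.

Lemma conn_suml q (I : Type) (r : seq I) (f : I -> M -> R) (X : I -> M -> V) Y :
  (forall i, smooth_near A q (f i)) -> (forall i, smooth_vfield A q (X i)) ->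
  smooth_vfield A q Y ->
  D (fun q' => \sum_(i <- r) f i q' *: X i q') Y q =
  \sum_(i <- r) f i q *: D (X i) Y q.
Proof.
move=> fs Xs Ys; elim: r => [|i r IH].
  rewrite big_nil -[RHS](scale0r (D Y Y q)).
  rewrite -(conn_scalel hD (smooth_near_cst q (0 : R)) Ys Ys).
  by congr (D _ Y q); apply/funext => q'; rewrite big_nil scale0r.
have -> : (fun q' => \sum_(j <- i :: r) f j q' *: X j q') =
    (fun q' => f i q' *: X i q') \+ (fun q' => \sum_(j <- r) f j q' *: X j q').
  by apply/funext => q'; rewrite big_cons.
have s1 := smooth_vfield_scale hA (fs i) (Xs i).
have s2 := smooth_vfield_sum hA r fs Xs.
by rewrite (conn_addl hD s1 s2 Ys) IH (conn_scalel hD (fs i) (Xs i) Ys) big_cons.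
Qed.

Lemma conn_sumr q (I : Type) (r : seq I) (f : I -> M -> R) X (Y : I -> M -> V) :
  (forall i, smooth_near A q (f i)) -> smooth_vfield A q X ->
  (forall i, smooth_vfield A q (Y i)) ->
  D X (fun q' => \sum_(i <- r) f i q' *: Y i q') q =
  \sum_(i <- r) (dir A (f i) q (X q) *: Y i q + f i q *: D X (Y i) q).
Proof.
move=> fs Xs Ys; elim: r => [|i r IH].
  have H := conn_leibniz hD (smooth_near_cst q (0 : R)) Xs Xs.
  rewrite big_nil; transitivity (D X (fun q' => cst (0 : R) q' *: X q') q).
    by congr (D X _ q); apply/funext => q'; rewrite big_nil scale0r.
  rewrite H scale0r addr0 /dir.
  have -> : (cst (0 : R) \o cinv (chart_at A q)) = cst 0 by [].
  by rewrite derive_cst scale0r.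
have -> : (fun q' => \sum_(j <- i :: r) f j q' *: Y j q') =
    (fun q' => f i q' *: Y i q') \+ (fun q' => \sum_(j <- r) f j q' *: Y j q').
  by apply/funext => q'; rewrite big_cons.
have s1 := smooth_vfield_scale hA (fs i) (Ys i).
have s2 := smooth_vfield_sum hA r fs Ys.
by rewrite (conn_addr hD Xs s1 s2) IH (conn_leibniz hD (fs i) Xs (Ys i)) big_cons.
Qed.

Definition coord_field c (i : 'I_n) : M -> V := field_with c (cst (delta_mx 0 i)).

End Connection.

(** Bilinear in u and v by construction, also at coordinates x outside the image
    of the chart. *)
HB.lock Definition christoffel {R : realType} {n : nat} {M : Type}
    (A : atlas R n M) (D : (M -> 'rV[R]_n) -> (M -> 'rV[R]_n) -> M -> 'rV[R]_n)
    (c : chart_index A) (x u v : 'rV[R]_n) : 'rV[R]_n :=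
  \sum_i u 0 i *: \sum_j v 0 j *:
    components c (D (coord_field c i) (coord_field c j)) x.

Section Christoffel.
Context {R : realType} {n : nat} {M : Type} (A : atlas R n M).
Hypothesis hA : smooth_atlas A.
Local Notation V := 'rV[R]_n.
Local Notation cmap := chart_map.
Local Notation cinv := chart_inv.
Local Notation cdom := chart_dom.
Local Notation components := (components (A := A)).
Local Notation field_with := (field_with (A := A)).
Implicit Types (c : chart_index A) (q : M) (u v : V) (X Y Z : M -> V).
Variable D : (M -> V) -> (M -> V) -> M -> V.
Hypothesis hD : affine_connection A D.

Local Notation Gam := (christoffel A D).

Lemma christoffel_bilin c x : bilin (Gam c x).
Proof.
rewrite christoffel.unlock; split=> [v|u] a s t /=.
  rewrite scaler_sumr -big_split /=; apply: eq_bigr => i _.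
  by rewrite !mxE scalerDl scalerA.
rewrite scaler_sumr -big_split /=; apply: eq_bigr => i _.
rewrite scalerA mulrC -scalerA -scalerDr; congr (_ *: _).
rewrite scaler_sumr -big_split /=; apply: eq_bigr => j _.
by rewrite !mxE scalerDl scalerA.
Qed.

Lemma coord_field_smooth c q i : cdom c q -> smooth_vfield A q (coord_field c i).
Proof.
move=> qc; apply: (smooth_field_with hA qc).
exact: smooth_at_cst.
Qed.

Lemma smooth_components_conn c q X Y : cdom c q -> smooth_vfield A q X ->
  smooth_vfield A q Y -> smooth_at (cmap c q) (components c (D X Y)).
Proof.
by move=> qc Xs Ys; apply/(smooth_vfieldP hA _ qc); exact: (conn_smooth hD Xs Ys).
Qed.

Lemma christoffel_smooth c q u v : cdom c q ->
  smooth_at (cmap c q) (fun x => Gam c x u v).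
Proof.
move=> qc; rewrite christoffel.unlock.
apply: smooth_at_sum => i.
apply: (@smooth_at_scale _ _ _ _ (cst _)); first exact: smooth_at_cst.
apply: smooth_at_sum => j.
apply: (@smooth_at_scale _ _ _ _ (cst _)); first exact: smooth_at_cst.
apply: smooth_components_conn => //; exact: coord_field_smooth.
Qed.

Lemma coord_field_expand c X q : cdom c q ->
  X q = \sum_i components c X (cmap c q) 0 i *: coord_field c i q.
Proof.
move=> qc; rewrite -[LHS](field_with_components hA X qc) /coord_field field_with.unlock.
rewrite [in LHS](row_sum_delta (components c X (cmap c q))).
rewrite (lin_sum (from_chart_linear hA qc)); apply: eq_bigr => i _.
by rewrite (linZ (from_chart_linear hA qc)).
Qed.

Lemma smooth_near_component c q X i : cdom c q -> smooth_vfield A q X ->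
  smooth_near A q (fun q' => components c X (cmap c q') 0 i).
Proof.
move=> qc /(smooth_vfieldP hA _ qc) Xs; apply/(smooth_nearP hA _ qc).
apply: smooth_at_eq (smooth_at_coord i Xs).
by apply: filterS (near_chart hA qc qc) => y [_ _ yE]; rewrite /= yE.
Qed.

(** Near q both fields are combinations of coordinate fields; by locality the
    derivative may be computed on these, with linearity in the first and the
    Leibniz rule in the second argument. *)
Lemma connE c q X Y : cdom c q -> smooth_vfield A q X -> smooth_vfield A q Y ->
  to_chart c q (D X Y q) = nabla (Gam c) (components c X) (components c Y) (cmap c q).
Proof.
move=> qc Xs Ys; set x := cmap c q.
pose E Z : M -> V := fun q' => \sum_i components c Z (cmap c q') 0 i *: coord_field c i q'.
have EZ Z : \forall y \near x, Z (cinv c y) = E Z (cinv c y).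
  apply: filterS (near_chart hA qc qc) => y [yc _ _].
  by rewrite {1}(coord_field_expand Z yc).
have Es Z : smooth_vfield A q Z -> smooth_vfield A q (E Z).
  move=> Zs; apply: (smooth_vfield_sum hA) => i.
    exact: smooth_near_component qc Zs.
  exact: coord_field_smooth.
rewrite (conn_locall hA hD qc Xs (Es X Xs) Ys (EZ X)).
rewrite (conn_suml hA hD _ (f := fun i q' => components c X (cmap c q') 0 i)
   (X := coord_field c)); last first.
- exact: Ys.
- by move=> i; exact: coord_field_smooth.
- by move=> i; exact: smooth_near_component qc Xs.
have tl := to_chart_linear hA qc.
have Yat := (smooth_vfieldP hA _ qc).1 Ys; rewrite -/x in Yat.
have step i : to_chart c q (D (coord_field c i) Y q) =
   pd (delta_mx 0 i) (components c Y) x + \sum_j components c Y x 0 j *: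
     components c (D (coord_field c i) (coord_field c j)) x.
  have is_ := coord_field_smooth i qc.
  rewrite (conn_localr hA hD qc is_ Ys (Es Y Ys) (EZ Y)).
  rewrite (conn_sumr hA hD _ (f := fun j q' => components c Y (cmap c q') 0 j)
     (Y := coord_field c)); last first.
  - by move=> j; exact: coord_field_smooth.
  - exact: is_.
  - by move=> j; exact: smooth_near_component qc Ys.
  rewrite big_split /= (linD tl) !(lin_sum tl); congr (_ + _); last first.
    by apply: eq_bigr => j _; rewrite (linZ tl) /x -(componentsE hA _ qc).
  rewrite [RHS]row_sum_delta; apply: eq_bigr => j _; rewrite (linZ tl).
  have -> : to_chart c q (coord_field c j q) = delta_mx 0 j.
    by rewrite /coord_field field_with.unlock (from_chartK hA qc).
  congr (_ *: _).
  rewrite (dirE hA _ qc (smooth_near_component j qc Ys)).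
  have -> : to_chart c q (coord_field c i q) = delta_mx 0 i.
    by rewrite /coord_field field_with.unlock (from_chartK hA qc).
  rewrite -[RHS](pd_lincomp (f := fun w : V => w 0 j)) //; last first.
    by move=> a w w'; rewrite !mxE.
  apply: pd_near; apply: filterS (near_chart hA qc qc) => y [_ _ yE].
  by rewrite /= yE.
rewrite (lin_sum tl).
under eq_bigr do rewrite (linZ tl) step scalerDr.
rewrite big_split /= /nabla christoffel.unlock; congr (_ + _).
rewrite [X in pd X](row_sum_delta (components c X x)) (lin_sum (pd_lin Yat)).
by apply: eq_bigr => i _; rewrite (linZ (pd_lin Yat)).
Qed.

Lemma components_connE c q X Y : cdom c q -> smooth_vfield A q X ->
  smooth_vfield A q Y ->
  \forall y \near cmap c q,
    components c (D X Y) y = nabla (Gam c) (components c X) (components c Y) y.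
Proof.
move=> qc Xs Ys.
have Xn := smooth_at_near ((smooth_vfieldP hA _ qc).1 Xs).
have Yn := smooth_at_near ((smooth_vfieldP hA _ qc).1 Ys).
near=> y.
have [yc _ yE] : [/\ cdom c (cinv c y), cdom c (cinv c y) & cmap c (cinv c y) = y].
  by near: y; exact: (near_chart hA qc qc).
have Xy : smooth_at y (components c X) by near: y.
have Yy : smooth_at y (components c Y) by near: y.
have Xv : smooth_vfield A (cinv c y) X.
  by apply/(smooth_vfieldP hA _ yc); rewrite yE.
have Yv : smooth_vfield A (cinv c y) Y.
  by apply/(smooth_vfieldP hA _ yc); rewrite yE.
by rewrite -{1}yE (componentsE hA _ yc) (connE yc Xv Yv) yE.
Unshelve. all: by end_near. Qed.

(** All three terms are computed by connE, for which the inner covariant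
    derivatives and the bracket have to be known near q and not only at q. *)
Lemma curvature_fields c q X Y Z : cdom c q -> smooth_vfield A q X ->
  smooth_vfield A q Y -> smooth_vfield A q Z ->
  to_chart c q (D X (D Y Z) q - D Y (D X Z) q - D (bracket A X Y) Z q) =
  riem (Gam c) (cmap c q) (to_chart c q (X q)) (to_chart c q (Y q))
    (to_chart c q (Z q)).
Proof.
move=> qc Xs Ys Zs.
have Xr := (smooth_vfieldP hA _ qc).1 Xs.
have Yr := (smooth_vfieldP hA _ qc).1 Ys.
have Zr := (smooth_vfieldP hA _ qc).1 Zs.
have Xn := smooth_at_near Xr; have Yn := smooth_at_near Yr.
have Bn : \forall y \near cmap c q,
   components c (bracket A X Y) y = lie (components c X) (components c Y) y.
  near=> y.
  have [yc _ yE] : [/\ cdom c (cinv c y), cdom c (cinv c y) & cmap c (cinv c y) = y].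
    by near: y; exact: (near_chart hA qc qc).
  have Xy : smooth_at y (components c X) by near: y.
  have Yy : smooth_at y (components c Y) by near: y.
  have Xv : smooth_vfield A (cinv c y) X.
    by apply/(smooth_vfieldP hA _ yc); rewrite yE.
  have Yv : smooth_vfield A (cinv c y) Y.
    by apply/(smooth_vfieldP hA _ yc); rewrite yE.
  by rewrite -{1}yE (componentsE hA _ yc) (bracketE hA yc Xv Yv) yE.
have Bs : smooth_vfield A q (bracket A X Y).
  apply/(smooth_vfieldP hA _ qc).
  by apply: (smooth_at_eq _ (lie_smooth Xr Yr)); apply: filterS Bn => y ->.
rewrite -!(componentsE hA _ qc) -riem_fields //; last first.
- by move=> u v; exact: christoffel_smooth.
- by move=> y; exact: christoffel_bilin.
have tl := to_chart_linear hA qc.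
rewrite !(linB tl) (connE qc Xs (conn_smooth hD Ys Zs)).
rewrite (connE qc Ys (conn_smooth hD Xs Zs)) (connE qc Bs Zs).
congr (_ - _ - _).
- apply: nabla_near; exact: components_connE.
- apply: nabla_near; exact: components_connE.
- by rewrite /nabla (nbhs_singleton Bn).
Unshelve. all: by end_near. Qed.

Lemma extend_smooth q v : smooth_vfield A q (extend A q v).
Proof.
rewrite extendE; apply: (smooth_field_with hA); first exact: atlas_at_dom.
exact: smooth_at_cst.
Qed.

Lemma extend_at q v : extend A q v q = v.
Proof.
have q0 := atlas_at_dom hA q.
by rewrite extendE field_with.unlock -[LHS](to_chart_at hA q) (from_chartK hA q0).
Qed.

Lemma curvatureE c q u v z : cdom c q ->
  to_chart c q (curvature A D q u v z) =
  riem (Gam c) (cmap c q) (to_chart c q u) (to_chart c q v) (to_chart c q z).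
Proof.
move=> qc; rewrite /curvature curvature_fields; try exact: extend_smooth.
  by rewrite !extend_at.
exact: qc.
Qed.

Lemma smooth_field_with_cst c q u : cdom c q -> smooth_vfield A q (field_with c (cst u)).
Proof. by move=> qc; apply: (smooth_field_with hA qc); exact: smooth_at_cst. Qed.

Lemma to_chart_field_with_cst c q u : cdom c q -> to_chart c q (field_with c (cst u) q) = u.
Proof. by move=> qc; rewrite field_with.unlock (from_chartK hA qc). Qed.

Lemma conn_field_with_cst c q a b : cdom c q ->
  to_chart c q (D (field_with c (cst a)) (field_with c (cst b)) q) = Gam c (cmap c q) a b.
Proof.
move=> qc; rewrite (connE qc (smooth_field_with_cst a qc) (smooth_field_with_cst b qc)) /nabla.
rewrite (pd_near _ (components_field_with hA (cst b) qc)) pd_cst add0r.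
by rewrite !(nbhs_singleton (components_field_with hA _ qc)).
Qed.

Lemma torsion_freeE c q u v : torsion_free A D -> cdom c q ->
  Gam c (cmap c q) u v = Gam c (cmap c q) v u.
Proof.
move=> hT qc.
have us w := smooth_field_with_cst w qc.
apply/eqP; rewrite -subr_eq0 -!conn_field_with_cst // -(linB (to_chart_linear hA qc)).
rewrite (hT q _ _ (us u) (us v)) (bracketE hA qc (us u) (us v)) /lie.
by rewrite !(pd_near _ (components_field_with hA (cst _) qc)) !pd_cst subrr.
Qed.

End Christoffel.

(** * Metrics and tensors in a chart *)

(** As for the Christoffel symbols, bilinear at every x by construction. *)
HB.lock Definition gram {R : realType} {n : nat} {M : Type} (A : atlas R n M)
    (g : M -> 'rV[R]_n -> 'rV[R]_n -> R)
    (c : chart_index A) (x u v : 'rV[R]_n) : R :=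
  \sum_i u 0 i *: \sum_j v 0 j *:
    g (chart_inv c x) (coord_field c i (chart_inv c x))
      (coord_field c j (chart_inv c x)).

Section Gram.
Context {R : realType} {n : nat} {M : Type} (A : atlas R n M).
Hypothesis hA : smooth_atlas A.
Local Notation V := 'rV[R]_n.
Local Notation cmap := chart_map.
Local Notation cinv := chart_inv.
Local Notation cdom := chart_dom.
Local Notation components := (components (A := A)).
Local Notation field_with := (field_with (A := A)).
Implicit Types (c : chart_index A) (q : M) (u v w z : V) (X Y Z : M -> V).
Variable g : M -> V -> V -> R.
Hypothesis hg : riemannian_metric A g.
Local Notation gram := (gram A g).

Lemma gram_bilin c x : bilin (gram c x).
Proof.
rewrite gram.unlock; split=> [v|u] a s t /=.
  rewrite scaler_sumr -big_split /=; apply: eq_bigr => i _.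
  by rewrite !mxE scalerDl scalerA.
rewrite scaler_sumr -big_split /=; apply: eq_bigr => i _.
rewrite scalerA mulrC -scalerA -scalerDr; congr (_ *: _).
rewrite scaler_sumr -big_split /=; apply: eq_bigr => j _.
by rewrite !mxE scalerDl scalerA.
Qed.

Lemma metric_bilin q : bilin (g q).
Proof.
split=> [v|u] a s t /=; first exact: metric_linear hg q a s t v.
rewrite (Defs.metric_sym hg q u) (metric_linear hg q a s t u).
by rewrite (Defs.metric_sym hg q s) (Defs.metric_sym hg q t).
Qed.

Lemma metricE c q a b : cdom c q ->
  g q a b = gram c (cmap c q) (to_chart c q a) (to_chart c q b).
Proof.
move=> qc.
have E w : w = \sum_i to_chart c q w 0 i *: coord_field c i q.
  rewrite -[LHS](to_chartK hA qc) [in LHS](row_sum_delta (to_chart c q w)).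
  rewrite (lin_sum (from_chart_linear hA qc)); apply: eq_bigr => i _.
  by rewrite (linZ (from_chart_linear hA qc)) /coord_field field_with.unlock.
rewrite gram.unlock (atlas_mapK hA qc).
rewrite [in LHS](E a) (lin_sum ((metric_bilin q).1 b)); apply: eq_bigr => i _.
rewrite (linZ ((metric_bilin q).1 b)); congr (_ *: _).
rewrite [in LHS](E b) (lin_sum ((metric_bilin q).2 _)); apply: eq_bigr => j _.
by rewrite (linZ ((metric_bilin q).2 _)).
Qed.

Lemma gramE c q u v : cdom c q ->
  gram c (cmap c q) u v = g q (from_chart c q u) (from_chart c q v).
Proof. by move=> qc; rewrite (metricE _ _ qc) !(from_chartK hA qc). Qed.

Lemma gram_smooth c q u v : cdom c q ->
  smooth_at (cmap c q) (fun x => gram c x u v).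
Proof.
move=> qc; rewrite gram.unlock.
apply: smooth_at_sum => i.
apply: (@smooth_at_scale _ _ _ _ (cst _)); first exact: smooth_at_cst.
apply: smooth_at_sum => j.
apply: (@smooth_at_scale _ _ _ _ (cst _)); first exact: smooth_at_cst.
have H := metric_smooth hg (coord_field_smooth hA i qc) (coord_field_smooth hA j qc).
exact: ((smooth_nearP hA _ qc).1 H).
Qed.

Lemma gram_sym c q u v : cdom c q ->
  gram c (cmap c q) u v = gram c (cmap c q) v u.
Proof. by move=> qc; rewrite !(gramE _ _ qc) (Defs.metric_sym hg). Qed.

Lemma gram_pos c q u : cdom c q -> u != 0 -> 0 < gram c (cmap c q) u u.
Proof.
move=> qc u0; rewrite (gramE _ _ qc); apply: (Defs.metric_pos hg).
apply: contra_neq u0 => E.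
by rewrite -[u](from_chartK hA qc) E (lin0 (to_chart_linear hA qc)).
Qed.

Lemma cov_metricE (D : (M -> V) -> (M -> V) -> M -> V) c q u v w :
  affine_connection A D -> cdom c q ->
  cov_metric A D g (field_with c (cst u)) (field_with c (cst v)) (field_with c (cst w)) q =
  pd u (fun x => gram c x v w) (cmap c q)
  - gram c (cmap c q) (christoffel A D c (cmap c q) u v) w
  - gram c (cmap c q) v (christoffel A D c (cmap c q) u w).
Proof.
move=> hD qc; have us a := smooth_field_with_cst hA a qc.
rewrite /cov_metric (dirE hA _ qc (metric_smooth hg (us v) (us w))).
rewrite (to_chart_field_with_cst hA u qc).
rewrite !(metricE _ _ qc) !(conn_field_with_cst hA hD _ _ qc).
rewrite !(to_chart_field_with_cst hA _ qc); congr (_ - _ - _).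
apply: pd_near; apply: filterS (near_chart hA qc qc) => y [yc _ yE].
by rewrite /= (metricE _ _ yc) !(to_chart_field_with_cst hA _ yc) yE.
Qed.

Lemma levi_civitaE (D : (M -> V) -> (M -> V) -> M -> V) c q u v w :
  levi_civita A g D -> cdom c q ->
  pd u (fun x => gram c x v w) (cmap c q) =
  gram c (cmap c q) (christoffel A D c (cmap c q) u v) w
  + gram c (cmap c q) v (christoffel A D c (cmap c q) u w).
Proof.
move=> [hD _ hm] qc; have us a := smooth_field_with_cst hA a qc.
have := hm q _ _ _ (us u) (us v) (us w); rewrite (cov_metricE _ _ _ hD qc).
by move/eqP; rewrite -addrA -opprD subr_eq0 => /eqP.
Qed.

Lemma codazziE (D : (M -> V) -> (M -> V) -> M -> V) c q u v w :
  statistical_structure A g D -> cdom c q ->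
  pd u (fun x => gram c x v w) (cmap c q)
  - gram c (cmap c q) (christoffel A D c (cmap c q) u v) w
  - gram c (cmap c q) v (christoffel A D c (cmap c q) u w) =
  pd v (fun x => gram c x u w) (cmap c q)
  - gram c (cmap c q) (christoffel A D c (cmap c q) v u) w
  - gram c (cmap c q) u (christoffel A D c (cmap c q) v w).
Proof.
move=> [_ hD _ hm] qc; have us a := smooth_field_with_cst hA a qc.
by rewrite -!(cov_metricE _ _ _ hD qc); apply: hm.
Qed.

End Gram.

Section Tensors.
Context {R : realType} {n : nat} {M : Type} (A : atlas R n M).
Hypothesis hA : smooth_atlas A.
Local Notation V := 'rV[R]_n.
Local Notation cmap := chart_map.
Local Notation cinv := chart_inv.
Local Notation cdom := chart_dom.
Local Notation components := (components (A := A)).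
Local Notation field_with := (field_with (A := A)).
Implicit Types (c : chart_index A) (q p : M) (u v w z : V) (X Y Z : M -> V).
Variable D : (M -> V) -> (M -> V) -> M -> V.
Hypothesis hD : affine_connection A D.
Local Notation Gam := (christoffel A D).

(** The derivatives of the components of the local extension cancel. *)
Lemma difference_tensorE (D' : (M -> V) -> (M -> V) -> M -> V) c q a b :
  affine_connection A D' -> cdom c q ->
  to_chart c q (difference_tensor A D D' q a b) =
  Gam c (cmap c q) (to_chart c q a) (to_chart c q b) -
  christoffel A D' c (cmap c q) (to_chart c q a) (to_chart c q b).
Proof.
move=> hD' qc; have es v := extend_smooth hA q v.
rewrite /difference_tensor (linB (to_chart_linear hA qc)).
rewrite (connE hA hD qc (es a) (es b)) (connE hA hD' qc (es a) (es b)) /nabla.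
rewrite !(componentsE hA _ qc) !(extend_at hA) opprD addrACA subrr add0r.
by [].
Qed.

(** At p, in the chart selected at p, a tangent vector is equal to its
    components. *)
Lemma conn_extend p w F (Fh : V -> V) :
  let c := chart_at A p in
  smooth_at (cmap c p) Fh ->
  (\forall y \near cmap c p, to_chart c (cinv c y) (F (cinv c y)) = Fh y) ->
  D (extend A p w) F p = pd w Fh (cmap c p) + Gam c (cmap c p) w (Fh (cmap c p)).
Proof.
move=> c Fs H; have pc : cdom c p := atlas_at_dom hA p.
have Fn : \forall y \near cmap c p, components c F y = Fh y.
  by apply: filterS H => y; rewrite components.unlock.
have Fv : smooth_vfield A p F.
  apply/(smooth_vfieldP hA _ pc); apply: smooth_at_eq Fs.
  by apply: filterS Fn => y.
rewrite -[LHS](to_chart_at hA p) (connE hA hD pc (extend_smooth hA p w) Fv).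
rewrite (nabla_near _ _ Fn) /nabla (componentsE hA _ pc) (extend_at hA).
by rewrite (to_chart_at hA).
Qed.

Lemma conn_extend_extend p u v : D (extend A p u) (extend A p v) p =
  Gam (chart_at A p) (cmap (chart_at A p) p) u v.
Proof.
rewrite (@conn_extend p u _ (cst v)); [|exact: smooth_at_cst|].
  by rewrite pd_cst add0r.
have p0 := atlas_at_dom hA p.
apply: filterS (near_chart hA p0 p0) => y [yc _ _].
by rewrite extendE (to_chart_field_with_cst hA).
Qed.

Lemma cov_tensor2E p (T : M -> V -> V -> V) (Th : V -> V -> V -> V) w u v :
  let c := chart_at A p in
  (forall q a b, cdom c q -> to_chart c q (T q a b) =
     Th (cmap c q) (to_chart c q a) (to_chart c q b)) ->
  smooth_at (cmap c p) (fun y => Th y u v) ->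
  cov_tensor2 A D T p w u v = cov2 (Gam c) Th (cmap c p) w u v.
Proof.
move=> c TE Ts; have pc : cdom c p := atlas_at_dom hA p.
have E a b : T p a b = Th (cmap c p) a b.
  by rewrite -[LHS](to_chart_at hA p) TE // !(to_chart_at hA).
rewrite /cov_tensor2 !conn_extend_extend !E -/c /cov2; congr (_ - _ - _).
rewrite (@conn_extend p w _ (fun y => Th y u v)) //.
apply: filterS (near_chart hA pc pc) => y [yc _ yE].
by rewrite TE // !extendE !(to_chart_field_with_cst hA _ yc) yE.
Qed.

Lemma cov_tensor3E p (T : M -> V -> V -> V -> V) (Th : V -> V -> V -> V -> V)
    w u v z :
  let c := chart_at A p in
  (forall q a b d, cdom c q -> to_chart c q (T q a b d) =
     Th (cmap c q) (to_chart c q a) (to_chart c q b) (to_chart c q d)) ->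
  smooth_at (cmap c p) (fun y => Th y u v z) ->
  cov_tensor3 A D T p w u v z = cov3 (Gam c) Th (cmap c p) w u v z.
Proof.
move=> c TE Ts; have pc : cdom c p := atlas_at_dom hA p.
have E a b d : T p a b d = Th (cmap c p) a b d.
  by rewrite -[LHS](to_chart_at hA p) TE // !(to_chart_at hA).
rewrite /cov_tensor3 !conn_extend_extend !E -/c /cov3; congr (_ - _ - _ - _).
rewrite (@conn_extend p w _ (fun y => Th y u v z)) //.
apply: filterS (near_chart hA pc pc) => y [yc _ yE].
by rewrite TE // !extendE !(to_chart_field_with_cst hA _ yc) yE.
Qed.

End Tensors.

(** * The tangent bundle *)

Lemma smooth_on_at (R : realType) (V W : normedModType R) (U : set V) (f : V -> W) :
  (forall x, U x -> smooth_at x f) -> smooth_on U f.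
Proof.
move=> H k; elim: k f H => [|k IH] f H /=.
  by move=> x /H /smooth_at_diff /differentiable_continuous.
split=> [x /H /smooth_at_diff //|v]; apply: IH => x /H.
exact: smooth_at_derive.
Qed.

Section Tangent.
Context {R : realType} {n : nat} {M : Type} (A : atlas R n M).
Hypothesis hA : smooth_atlas A.
Local Notation V := 'rV[R]_n.
Local Notation W := 'rV[R]_(n + n).
Local Notation cmap := chart_map.
Local Notation cinv := chart_inv.
Local Notation cdom := chart_dom.
Local Notation T := (tangent_atlas A).
Implicit Types (c : chart_index A) (q : M) (u v : V).

Lemma tangent_mapE c q v :
  chart_map (a := T) c (q, v) = row_mx (cmap c q) (to_chart c q v).
Proof. by []. Qed.

Lemma tangent_mapK c (w : M * V) : cdom c w.1 ->
  chart_inv (a := T) c (chart_map (a := T) c w) = w.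
Proof.
case: w => q v /= qc.
by rewrite row_mxKl row_mxKr (atlas_mapK hA qc) (to_chartK hA qc).
Qed.

Lemma tangent_image (c c' : chart_index A) :
  chart_map (a := T) c @` (chart_dom (a := T) c `&` chart_dom (a := T) c') =
  (fun u : W => (lsubmx u : V)) @^-1` (cmap c @` (cdom c `&` cdom c')).
Proof.
apply/seteqP; split=> u /=.
  by move=> [[q v] /= [qc qc'] <-]; exists q => //; rewrite row_mxKl.
move=> [q [qc qc'] qE]; exists (q, from_chart c q (rsubmx u)) => //=.
by rewrite qE (from_chartK hA qc) hsubmxK.
Qed.

Lemma tangent_transE c c' q v : cdom c q -> cdom c' q ->
  \forall u \near (chart_map (a := T) c (q, v) : W),
    trans (A := T) c c' u =
    row_mx (trans c c' (lsubmx u)) (pd (rsubmx u) (trans c c') (lsubmx u)).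
Proof.
move=> qc qc'; have N := near_chart hA qc qc'.
have : \forall u \near (chart_map (a := T) c (q, v) : W),
    [/\ cdom c (cinv c (lsubmx u)), cdom c' (cinv c (lsubmx u)) &
      cmap c (cinv c (lsubmx u)) = lsubmx u].
  rewrite -(row_mxKl (cmap c q) (to_chart c q v)) in N.
  exact: (@continuous_lsubmx R 1 n n _ _ N).
apply: filterS => u [uc uc' uE].
by rewrite {1}/trans /= (to_from_chart hA _ uc uc') uE.
Qed.

Let smooth_tangent_aux (c c' : chart_index A) (u : W) :
  smooth_at (lsubmx u) (trans c c') ->
  smooth_at u (fun u : W => row_mx (trans c c' (lsubmx u))
    (pd (rsubmx u) (trans c c') (lsubmx u))).
Proof.
move=> ts; apply: smooth_row_mx; first exact: (smooth_lsubmx_comp ts).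
apply: (smooth_family (L := fun (u : W) v => pd v (trans c c') (lsubmx u))).
- have N := smooth_at_near ts.
  have : \forall y \near u, smooth_at (lsubmx y) (trans c c').
    exact: (@continuous_lsubmx R 1 n n _ _ N).
  by apply: filterS => y; exact: pd_lin.
- by move=> v; apply: (smooth_lsubmx_comp (f := pd v (trans c c'))); exact: pd_smooth.
- exact: smooth_rsubmx.
Qed.

Lemma tangent_trans_smooth c c' q v : cdom c q -> cdom c' q ->
  smooth_at (chart_map (a := T) c (q, v) : W) (trans (A := T) c c').
Proof.
move=> qc qc'.
have N : \forall u \near (chart_map (a := T) c (q, v) : W),
    row_mx (trans c c' (lsubmx u)) (pd (rsubmx u) (trans c c') (lsubmx u)) =
    trans (A := T) c c' u.
  by apply: filterS (tangent_transE v qc qc') => y ->.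
apply: (smooth_at_eq N); apply: smooth_tangent_aux.
by rewrite tangent_mapE row_mxKl; exact: trans_smooth.
Qed.

Lemma tangent_smooth_atlas : smooth_atlas T.
Proof.
split.
- by move=> w; exact: (atlas_at_dom hA).
- move=> c c'; rewrite tangent_image; apply: open_comp; last exact: atlas_open.
  by move=> u _; exact: continuous_lsubmx.
- by move=> c w; exact: tangent_mapK.
- move=> c c'; apply: smooth_on_at => u [[q v] [qc qc'] <-].
  exact: tangent_trans_smooth.
Qed.

(** The derivative of the change of coordinates has a mixed term: the second
    derivative of tau in the directions of the base part and of eta. *)
Lemma to_chart_tangent c q (eta : V) (H : W) : cdom c q ->
  let tau := trans (chart_at A q) c in let x := cmap (chart_at A q) q in
  to_chart (A := T) c (q, eta) H =
  row_mx (pd (lsubmx H) tau x)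
         (pd (lsubmx H) (pd eta tau) x + pd (rsubmx H) tau x).
Proof.
move=> qc tau x; have q0 := atlas_at_dom hA q.
have ts : smooth_at x tau by exact: trans_smooth.
rewrite to_chartE (pd_near _ (tangent_transE eta q0 qc)).
rewrite tangent_mapE (to_chart_at hA) -/x -/tau.
have lx : lsubmx (row_mx x eta) = x by rewrite row_mxKl.
have ts' : smooth_at (lsubmx (row_mx x eta)) tau by rewrite lx.
have Ln : \forall y \near row_mx x eta, linear (fun v => pd v tau (lsubmx y)).
  have N := smooth_at_near ts'.
  have : \forall y \near row_mx x eta, smooth_at (lsubmx y) tau.
    exact: (@continuous_lsubmx R 1 n n _ _ N).
  by apply: filterS => y; exact: pd_lin.
have Ls v : smooth_at (row_mx x eta) (fun y : W => pd v tau (lsubmx y)).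
  by apply: (smooth_lsubmx_comp (f := pd v tau)); exact: pd_smooth.
rewrite pd_row_mx; last first.
- apply: (smooth_family (L := fun (u : W) v => pd v tau (lsubmx u))) => //.
  exact: smooth_rsubmx.
- exact: (smooth_lsubmx_comp ts').
rewrite (pd_lsubmx_comp _ ts') lx; congr row_mx.
rewrite (pd_family (L := fun (u : W) v => pd v tau (lsubmx u))) //; last first.
  exact: smooth_rsubmx.
rewrite (pd_linear_row _ _ (@rsubmx_linear _ _ _)) row_mxKr lx; congr (_ + _).
by rewrite (pd_lsubmx_comp (f := pd eta tau)) ?lx //; exact: pd_smooth.
Qed.

Lemma vliftE q (eta X : V) : vlift A q eta X = row_mx 0 X.
Proof.
rewrite /vlift /velocity /= pdE.
set f := (F in pd _ F _).
have -> : f = (fun t : R => row_mx (cmap (chart_at A q) q) (eta + t *: X)).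
  by apply/funext => t; rewrite /f /= (to_chart_at hA).
have sl : linear (fun t : R => t *: X).
  by move=> a s t; rewrite scalerDl scalerA.
have sc : continuous (fun t : R => t *: X) by exact: scalel_continuous.
have ss : smooth_at (0 : R) (fun t : R => t *: X) by exact: smooth_at_linear.
have s1 : smooth_at (0 : R) (fun=> cmap (chart_at A q) q) by exact: smooth_at_cst.
have s2 : smooth_at (0 : R) (fun=> eta) by exact: smooth_at_cst.
rewrite pd_row_mx //; last exact: smooth_at_add.
rewrite pd_add // (pd_cst (cmap (chart_at A q) q)) (pd_cst eta).
by rewrite add0r (pd_linear _ _ sl sc) scale1r.
Qed.

Lemma to_chart_vlift c q (eta X : V) : cdom c q ->
  to_chart (A := T) c (q, eta) (vlift A q eta X) = row_mx 0 (to_chart c q X).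
Proof.
move=> qc; have q0 := atlas_at_dom hA q.
have ts := trans_smooth hA q0 qc.
rewrite vliftE (to_chart_tangent _ _ qc) row_mxKl row_mxKr.
rewrite (lin0 (pd_lin ts)) (lin0 (pd_lin (pd_smooth _ ts))) add0r.
by rewrite to_chartE.
Qed.

Variable D : (M -> V) -> (M -> V) -> M -> V.
Hypothesis hD : affine_connection A D.
Local Notation Gam := (christoffel A D).

(** Only the equation of parallel transport at time 0 matters: it gives the
    velocity of the fibre component. *)
Lemma is_hliftE q (xi X : V) (H : W) : is_hlift A D q xi X H ->
  H = row_mx X (- Gam (chart_at A q) (cmap (chart_at A q) q) X xi).
Proof.
move=> [gam [v [[_ [U U0 Us]] [g0 gX v0] _ Hv ->]]].
have {Hv} := nbhs_singleton Hv; rewrite /cov_along gX v0 g0.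
rewrite (conn_extend_extend hA hD) => Hv.
rewrite /velocity /= g0 in gX *.
rewrite /= g0 in Us.
rewrite pdE; set f := (F in pd _ F _).
have fs : smooth_at (0 : R) f by exists U.
rewrite -[LHS]hsubmxK.
rewrite -(pd_lincomp _ (@lsubmx_linear _ _ _) fs) -(pd_lincomp _ (@rsubmx_linear _ _ _) fs).
congr row_mx.
  rewrite -gX pdE; apply: pd_near; apply: filterE => t /=.
  by rewrite row_mxKl.
apply/eqP; rewrite -subr_eq0 opprK; apply/eqP; rewrite -[RHS]Hv pdE.
congr (_ + _); apply: pd_near; apply: filterE => t /=.
by rewrite row_mxKr.
Qed.

(** The transformation law of the Christoffel symbols: the covariant derivative
    of the local extension of Y along X, in the chart selected at q and in c. *)
Lemma christoffel_change c q (X Y : V) : cdom c q ->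
  let tau := trans (chart_at A q) c in let x := cmap (chart_at A q) q in
  pd (Gam (chart_at A q) x X Y) tau x =
  pd X (pd Y tau) x + Gam c (cmap c q) (to_chart c q X) (to_chart c q Y).
Proof.
move=> qc tau x; have q0 := atlas_at_dom hA q.
have ts : smooth_at x tau by exact: trans_smooth.
have es v := extend_smooth hA q v.
rewrite -(conn_extend_extend hA hD) -to_chartE (connE hA hD qc (es X) (es Y)) /nabla.
rewrite !(componentsE hA _ qc) !(extend_at hA); congr (_ + _).
have Ys : smooth_at (cmap c q) (components c (extend A q Y)).
  exact: ((smooth_vfieldP hA _ qc).1 (es Y)).
have tE : tau x = cmap c q by rewrite /tau /x (transE hA _ q0).
rewrite to_chartE -/tau -/x -tE -pd_comp //; last by rewrite tE.
apply: pd_near.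
have N1 := components_change hA (extend A q Y) q0 qc.
have N2 := components_field_with hA (cst Y) q0.
by apply: filterS2 N1 N2 => y /= ->; rewrite extendE => ->.
Qed.

(** The mixed term of to_chart_tangent cancels the second derivative in the
    transformation law of the Christoffel symbols. *)
Lemma to_chart_hlift c q (xi X : V) (H : W) : is_hlift A D q xi X H ->
  cdom c q -> to_chart (A := T) c (q, xi) H =
  row_mx (to_chart c q X)
    (- Gam c (cmap c q) (to_chart c q X) (to_chart c q xi)).
Proof.
move=> /is_hliftE -> qc; have q0 := atlas_at_dom hA q.
have ts := trans_smooth hA q0 qc.
rewrite (to_chart_tangent _ _ qc) row_mxKl row_mxKr -to_chartE; congr row_mx.
rewrite (linN (pd_lin ts)) (christoffel_change _ _ qc).
by rewrite opprD addrA subrr add0r.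
Qed.

Variables (g : M -> V -> V -> R) (hlift : M -> V -> V -> W)
  (gt : M * V -> W -> W -> R).
Hypothesis hg : riemannian_metric A g.
Hypothesis hhlift : horizontal_lift A D hlift.
Hypothesis hgt : sasakian_metric A g hlift gt.

Lemma frame_lifts c q (xi : V) (B : W) : cdom c q ->
  frame (Gam c) (chart_map (a := T) c (q, xi)) B =
  to_chart (A := T) c (q, xi)
    (hlift q xi (from_chart c q (lsubmx B))
     + vlift A q xi (from_chart c q (rsubmx B))).
Proof.
move=> qc; rewrite (linD (to_chart_linear tangent_smooth_atlas _)) //.
rewrite (to_chart_hlift (hhlift _ _ _) qc) (to_chart_vlift _ _ qc).
rewrite !(from_chartK hA qc) frame.unlock tangent_mapE row_mxKl row_mxKr.
by rewrite add_row_mx addr0 (addrC (- _)).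
Qed.

Lemma gram_frame c q (xi : V) (B B' : W) : cdom c q ->
  let w := chart_map (a := T) c (q, xi) in
  gram T gt c w (frame (Gam c) w B) (frame (Gam c) w B') =
  gram A g c (cmap c q) (lsubmx B) (lsubmx B')
  + gram A g c (cmap c q) (rsubmx B) (rsubmx B').
Proof.
move=> qc w; have [hgR hS] := hgt.
rewrite !frame_lifts // -(metricE tangent_smooth_atlas hgR) //.
rewrite !(gramE hA hg _ _ qc).
have gb := metric_bilin hgR (q, xi).
set a := from_chart c q (lsubmx B); set a' := from_chart c q (rsubmx B).
set b := from_chart c q (lsubmx B'); set b' := from_chart c q (rsubmx B').
have [_ hh _] := hS q xi a b.
have [vv _ _] := hS q xi a' b'.
have [_ _ vh] := hS q xi a' b.
have [_ _ vh'] := hS q xi b' a.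
rewrite !(bilinDl gb) !(bilinDr gb) hh vv vh (Defs.metric_sym hgR _ (hlift q xi a)) vh'.
by rewrite addr0 add0r.
Qed.

End Tangent.

(** * The structures of the theorem in one chart *)

Section ChartStructures.
Context {R : realType} {n : nat} {M : Type} (A : atlas R n M).
Hypothesis hA : smooth_atlas A.
Local Notation V := 'rV[R]_n.
Local Notation W := 'rV[R]_(n + n).
Local Notation cmap := chart_map.
Local Notation cinv := chart_inv.
Local Notation cdom := chart_dom.
Local Notation T := (tangent_atlas A).
Variables (g : M -> V -> V -> R) (D Dg : (M -> V) -> (M -> V) -> M -> V).
Hypothesis hgD : statistical_structure A g D.
Hypothesis hDg : levi_civita A g Dg.

Lemma chart_image_open (c : chart_index A) : open (cmap c @` cdom c).
Proof. by have := atlas_open hA c c; rewrite setIid. Qed.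

Lemma christoffel_on D' c : affine_connection A D' -> torsion_free A D' ->
  symbols_on (cmap c @` cdom c) (christoffel A D' c).
Proof.
move=> hD' tD'; split=> [x|x [q qc <-] u v|x [q qc <-] u v].
- exact: christoffel_bilin.
- exact: (christoffel_smooth hA hD').
- exact: (torsion_freeE hA hD').
Qed.

Lemma gram_on (g' : M -> V -> V -> R) c : riemannian_metric A g' ->
  metric_on (cmap c @` cdom c) (gram A g' c).
Proof.
move=> hg'; split=> [x|x [q qc <-] u v|x [q qc <-] u v|x [q qc <-] u u0].
- exact: gram_bilin.
- exact: (gram_smooth hA hg').
- exact: (gram_sym hA hg').
- exact: (gram_pos hA hg').
Qed.

Lemma levi_civita_on (g' : M -> V -> V -> R) D' c :
  riemannian_metric A g' -> levi_civita A g' D' ->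
  metric_compatible (cmap c @` cdom c) (christoffel A D' c) (gram A g' c).
Proof. by move=> hg' hD' x [q qc <-] u v w; apply: (levi_civitaE hA). Qed.

Definition difference_symbols (c : chart_index A) x u v :=
  christoffel A D c x u v - christoffel A Dg c x u v.

Lemma statistical_structure_on c :
  statistical_on (cmap c @` cdom c) (christoffel A D c) (christoffel A Dg c)
    (difference_symbols c) (gram A g c).
Proof.
have [hg hD tD _] := hgD; have [hDg' tDg _] := hDg; split.
- exact: chart_image_open.
- exact: christoffel_on.
- exact: christoffel_on.
- exact: gram_on.
- exact: levi_civita_on.
- by move=> x [q qc <-] u v w; apply: (codazziE hA).
- by move=> x u v; rewrite /difference_symbols addrC subrK.
Qed.

Variable R1 : M -> V -> V -> V -> V.
Hypothesis hR1 : is_R1 A g D R1.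

Definition R1_components (c : chart_index A) x a b d : V :=
  let q := cinv c x in
  to_chart c q (R1 q (from_chart c q a) (from_chart c q b) (from_chart c q d)).

Lemma R1_componentsE c q a b d : cdom c q ->
  to_chart c q (R1 q a b d) =
  R1_components c (cmap c q) (to_chart c q a) (to_chart c q b) (to_chart c q d).
Proof.
by move=> qc; rewrite /R1_components (atlas_mapK hA qc) !(to_chartK hA qc).
Qed.

Lemma R1_componentsP c :
  is_R1_on (cmap c @` cdom c) (christoffel A D c) (gram A g c) (R1_components c).
Proof.
have [hg hD tD _] := hgD; move=> x [q qc <-] w a b d.
rewrite -[w](from_chartK hA qc) -[a](from_chartK hA qc) -[b](from_chartK hA qc).
rewrite -[d](from_chartK hA qc) -R1_componentsE // -(metricE hA hg _ _ qc) hR1.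
by rewrite -(curvatureE hA hD _ _ _ qc) -(metricE hA hg _ _ qc).
Qed.

End ChartStructures.

Section TangentStructures.
Context {R : realType} {n : nat} {M : Type} (A : atlas R n M).
Hypothesis hA : smooth_atlas A.
Local Notation V := 'rV[R]_n.
Local Notation W := 'rV[R]_(n + n).
Local Notation cmap := chart_map.
Local Notation cinv := chart_inv.
Local Notation cdom := chart_dom.
Local Notation T := (tangent_atlas A).
Variables (g : M -> V -> V -> R) (D Dg : (M -> V) -> (M -> V) -> M -> V).
Hypothesis hgD : statistical_structure A g D.
Variables (hlift : M -> V -> V -> W) (gt : M * V -> W -> W -> R)
  (Dgt : (M * V -> W) -> (M * V -> W) -> M * V -> W).
Hypothesis hhlift : horizontal_lift A D hlift.
Hypothesis hgt : sasakian_metric A g hlift gt.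
Hypothesis hDgt : levi_civita T gt Dgt.

Lemma tangent_chart_image (c : chart_index A) :
  [set w : W | (cmap c @` cdom c) (lsubmx w)] =
  chart_map (a := T) c @` chart_dom (a := T) c.
Proof.
have := tangent_image hA c c; rewrite !setIid => ->.
by [].
Qed.

(** Both structures live over the chart of the tangent bundle induced by c, whose
    image is the set of all (x, xi) with x in the image of c. *)
Lemma sasakian_structure_on (c : chart_index A) :
  sasakian_on (cmap c @` cdom c) (christoffel A D c) (gram A g c)
    (christoffel T Dgt c) (gram T gt c).
Proof.
have hT := tangent_smooth_atlas hA.
have [hg hD tD _] := hgD; have [hDgt' tDgt _] := hDgt; have [hgR _] := hgt.
split.
- rewrite tangent_chart_image; exact: (christoffel_on hT).
- rewrite tangent_chart_image; exact: (gram_on hT).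
- rewrite tangent_chart_image; exact: (levi_civita_on hT).
- move=> w wU B B'.
  have : (chart_map (a := T) c @` chart_dom (a := T) c) w.
    by rewrite -tangent_chart_image.
  move=> [[q v] qc <-].
  have := gram_frame hA hD hg hhlift hgt v B B' qc.
  by rewrite tangent_mapE row_mxKl.
Qed.

End TangentStructures.

Theorem proposition2p6 (R : realType) (n : nat) (M : topologicalType)
    (A : atlas R n M)
    (g : M -> 'rV[R]_n -> 'rV[R]_n -> R)
    (D Dg : (M -> 'rV[R]_n) -> (M -> 'rV[R]_n) -> M -> 'rV[R]_n)
    (R1 : M -> 'rV[R]_n -> 'rV[R]_n -> 'rV[R]_n -> 'rV[R]_n)
    (hlift : M -> 'rV[R]_n -> 'rV[R]_n -> 'rV[R]_(n + n))
    (gt : M * 'rV[R]_n -> 'rV[R]_(n + n) -> 'rV[R]_(n + n) -> R)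
    (Dgt : (M * 'rV[R]_n -> 'rV[R]_(n + n)) ->
           (M * 'rV[R]_n -> 'rV[R]_(n + n)) ->
           M * 'rV[R]_n -> 'rV[R]_(n + n))
    (hM : manifold A)
    (hgD : statistical_structure A g D)
    (hDg : levi_civita A g Dg)
    (hR1 : is_R1 A g D R1)
    (hhlift : horizontal_lift A D hlift)
    (hgt : sasakian_metric A g hlift gt)
    (hDgt : levi_civita (tangent_atlas A) gt Dgt)
    (p : M) (xi X Y Z : 'rV[R]_n) :
  let v := vlift A p xi in
  let h := hlift p xi in
  let K := difference_tensor A D Dg p in
  let comm_K U W S := K U (K W S) - K W (K U S) in (* [K_U, K_W] S *)
  let nK := cov_tensor2 A D (difference_tensor A D Dg) p in
  let Rc := curvature A D p in
  let Rg := curvature A Dg p in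
  let nR := cov_tensor3 A D (curvature A D) p in
  let r1 := R1 p in
  let nR1 := cov_tensor3 A D R1 p in
  let Rt := curvature (tangent_atlas A) Dgt (p, xi) in
  (Rt (v X) (v Y) (v Z) =
     v (comm_K Y X Z)
     + h (r1 (K X Z) xi Y - r1 (K Y Z) xi X))
  /\
  (Rt (v X) (v Y) (h Z) =
     v (K (r1 Z xi Y) X - K (r1 Z xi X) Y)
     + h (Rg X Y Z + r1 (r1 Z xi Y) xi X - r1 (r1 Z xi X) xi Y))
  /\
  (Rt (v X) (h Y) (h Z) =
     v (- (2^-1 *: Rc Y Z X) + comm_K X Y Z + nK Y X Z
        - 2^-1 *: Rc Y (r1 Z xi X) xi)
     + h (- (2^-1 *: K X (Rc Y Z xi)) + r1 (K Y Z) xi X + nR1 Y Z xi X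
          - K Y (r1 Z xi X) - r1 Y xi (K X Z)))
  /\
  (Rt (v X) (h Y) (v Z) =
     v (K (r1 Y xi Z) X + 2^-1 *: Rc Y (K X Z) xi)
     + h (comm_K Y X Z + r1 (r1 Y xi Z) xi X - r1 Y X Z - nK Y X Z))
  /\
  (Rt (h X) (h Y) (h Z) =
     h (Rg X Y Z)
     + 2^-1 *: h (r1 X xi (Rc Y Z xi) - r1 Y xi (Rc X Z xi)
                  - 2 *: r1 Z xi (Rc X Y xi))
     + 2^-1 *: v (nR Z X Y xi - Rc Y (K X Z) xi + Rc X (K Y Z) xi
                  + K X (Rc Y Z xi) - K Y (Rc X Z xi)
                  - 2 *: K Z (Rc X Y xi)))
  /\
  (Rt (h X) (h Y) (v Z) =
     v (Rg X Y Z)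
     + 2^-1 *: v (Rc X (r1 Y xi Z) xi - Rc Y (r1 X xi Z) xi)
     + h (nR1 Y X xi Z - nR1 X Y xi Z + K X (r1 Y xi Z) - K Y (r1 X xi Z)
          + K (Rc X Y xi) Z + r1 X xi (K Y Z) - r1 Y xi (K X Z))).
Proof.
have hA := manifold_smooth_atlas hM.
have hT := tangent_smooth_atlas hA.
have [hg hD tD _] := hgD; have [hDg' _ _] := hDg; have [hDgt' _ _] := hDgt.
pose c := chart_at A p; have pc : chart_dom c p := atlas_at_dom hA p.
pose x := chart_map c p; pose w : 'rV[R]_(n + n) := row_mx x xi.
have wE : chart_map (a := tangent_atlas A) c (p, xi) = w.
  by rewrite tangent_mapE (to_chart_at hA).
have lw : lsubmx w = x by rewrite row_mxKl.
have rw : rsubmx w = xi by rewrite row_mxKr.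
have xU : (chart_map c @` chart_dom c) x by exists p.
have wU : (chart_map c @` chart_dom c) (lsubmx w) by rewrite lw.
have hS := statistical_structure_on hA hgD hDg c.
have hR := R1_componentsP hA hgD hR1 (c := c).
have hB := sasakian_structure_on hA hgD hhlift hgt hDgt c.
set C := christoffel A D c in hS hR hB *.
set Cg := christoffel A Dg c in hS.
set Kc := difference_symbols D Dg c in hS.
set R1c := R1_components R1 c in hR.
(* The lifts are frame vectors at w, and every tensor at p is given by its
   components at x, because the chart c is the one selected at p. *)
have vE U : vlift A p xi U = frame C w (row_mx 0 U).
  by rewrite (vliftE hA) (frame_vert (symbols_bilin (stat_symbols hS))).
have hE U : hlift p xi U = frame C w (row_mx U 0).
  rewrite (is_hliftE hA hD (hhlift p xi U)).
  by rewrite frame_hor lw rw.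
have vhE U U' : vlift A p xi U + hlift p xi U' = frame C w (row_mx U' U).
  have fl := frame_lin (symbols_bilin (stat_symbols hS)) w.
  by rewrite vE hE addrC -(linD fl) add_row_mx addr0 add0r.
have differenceE U U' : difference_tensor A D Dg p U U' = Kc x U U'.
  rewrite -[LHS](to_chart_at hA p) (difference_tensorE hA hD _ _ hDg' pc).
  by rewrite !(to_chart_at hA).
have RcE U U' S : curvature A D p U U' S = riem C x U U' S.
  rewrite -[LHS](to_chart_at hA p) (curvatureE hA hD _ _ _ pc).
  by rewrite !(to_chart_at hA).
have RgE U U' S : curvature A Dg p U U' S = riem Cg x U U' S.
  rewrite -[LHS](to_chart_at hA p) (curvatureE hA hDg' _ _ _ pc).
  by rewrite !(to_chart_at hA).
have R1E U U' S : R1 p U U' S = R1c x U U' S.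
  rewrite -[LHS](to_chart_at hA p) (R1_componentsE hA _ _ _ _ pc).
  by rewrite !(to_chart_at hA).
have RtE U U' S : curvature (tangent_atlas A) Dgt (p, xi) U U' S =
    riem (christoffel (tangent_atlas A) Dgt c) w U U' S.
  rewrite -[LHS](to_chart_at hT (p, xi)).
  rewrite (curvatureE hT hDgt' _ _ _ (atlas_at_dom hT (p, xi))).
  by rewrite !(to_chart_at hT) wE.
have nKE U U' S : cov_tensor2 A D (difference_tensor A D Dg) p U U' S =
    cov2 C Kc x U U' S.
  apply: (cov_tensor2E hA hD).
    by move=> q a b qc; exact: (difference_tensorE hA hD _ _ hDg' qc).
  exact: (difference_smooth hS).
have nRE U U' S S' : cov_tensor3 A D (curvature A D) p U U' S S' =
    cov3 C (riem C) x U U' S S'.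
  apply: (cov_tensor3E hA hD).
    by move=> q a b d qc; exact: (curvatureE hA hD _ _ _ qc).
  apply: riem_smooth.
    exact: (symbols_bilin (stat_symbols hS)).
  exact: (symbols_smooth (stat_symbols hS)).
have nR1E U U' S S' : cov_tensor3 A D R1 p U U' S S' =
    cov3 C R1c x U U' S S'.
  apply: (cov_tensor3E hA hD).
    by move=> q a b d qc; exact: (R1_componentsE hA).
  exact: (R1_smooth hS hR hB).
move=> v h K comm_K nK Rc Rg nR r1 nR1 Rt.
rewrite /comm_K {comm_K}.
rewrite -/v in vE vhE; rewrite -/h in hE vhE.
have {}differenceE : forall U U', K U U' = Kc x U U' := differenceE.
have {}RcE : forall U U' S, Rc U U' S = riem C x U U' S := RcE.
have {}RgE : forall U U' S, Rg U U' S = riem Cg x U U' S := RgE.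
have {}R1E : forall U U' S, r1 U U' S = R1c x U U' S := R1E.
have {}RtE : forall U U' S, Rt U U' S =
  riem (christoffel (tangent_atlas A) Dgt c) w U U' S := RtE.
have {}nKE : forall U U' S, nK U U' S = cov2 C Kc x U U' S := nKE.
have {}nRE : forall U U' S S', nR U U' S S' = cov3 C (riem C) x U U' S S' := nRE.
have {}nR1E : forall U U' S S', nR1 U U' S S' = cov3 C R1c x U U' S S' := nR1E.
move: v h K nK Rc Rg nR r1 nR1 Rt vE hE vhE differenceE RcE RgE R1E RtE nKE nRE nR1E.
move=> v h K nK Rc Rg nR r1 nR1 Rt vE hE vhE differenceE RcE RgE R1E RtE nKE nRE nR1E.
have fl := frame_lin (symbols_bilin (stat_symbols hS)) w.
(* The rest is an identity between the data in the chart; forgetting their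
   definitions keeps unification from unfolding them. *)
clear hM hgD hDg hR1 hhlift hgt hDgt hA hT hg hD tD hDg' hDgt' pc xU wE.
clearbody C Cg Kc R1c w.
rewrite !RtE !vhE.
split; [|split; [|split; [|split; [|split]]]].
- rewrite !vE (riem_vvv hS hR hB wU) lw rw; congr (frame C w (row_mx _ _)).
    by rewrite !R1E !differenceE.
  by rewrite !differenceE.
- rewrite !vE !hE (riem_vvh hS hR hB wU) lw rw; congr (frame C w (row_mx _ _)).
    by rewrite !R1E !RgE.
  by rewrite !R1E !differenceE.
- rewrite !vE !hE (riem_vhh hS hR hB wU) lw rw; congr (frame C w (row_mx _ _)).
    by rewrite !nR1E !R1E !differenceE !RcE.
  by rewrite !nKE !R1E !RcE !differenceE.
- rewrite !vE !hE (riem_vhv hS hR hB wU) lw rw; congr (frame C w (row_mx _ _)).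
    by rewrite !nKE !R1E !differenceE.
  by rewrite !R1E !differenceE !RcE.
- rewrite !vE !hE (riem_hhh hS hR hB wU) lw rw.
  rewrite -!(linZ fl) -!(linD fl) !scale_row_mx !add_row_mx !scaler0 !addr0 !add0r.
  congr (frame C w (row_mx _ _)).
    by rewrite !R1E !RcE !RgE.
  by rewrite !nRE !differenceE !RcE.
- rewrite !vE !hE (riem_hhv hS hR hB wU) lw rw.
  rewrite -!(linZ fl) -!(linD fl) !scale_row_mx !add_row_mx !scaler0 !addr0 !add0r.
  congr (frame C w (row_mx _ _)).
    by rewrite !nR1E !R1E !RcE !differenceE.
  by rewrite !R1E !RcE !RgE.
Qed.
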